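(* Let $\lambda>0$, $c\in\mathbb{R}$, $\sigma_1,\sigma_{-1}\ge0$ with $\sigma_1^2+\sigma_{-1}^2>0$, and let $H_1,H_{-1}:[0,\infty)\to[0,\infty)$ be nonnegative nondecreasing locally Lipschitz continuous functions that arise as limits $H_i(t)=\lim_{n\to\infty}\sqrt n\,F^n_i(t/\sqrt n)$, $t\ge0$, for some sequences of cumulative distribution functions $F^n_i$ with $F^n_i(0)=0$. Let $Q$ be the diffusion process satisfying $$Q(t)=q+\sqrt{\lambda^3(\sigma_1^2+\sigma_{-1}^2)}\,W(t)+ct-\lambda\int_0^tH_1\!\left(\frac{Q^+(s)}{\lambda}\right)ds+\lambda\int_0^tH_{-1}\!\left(\frac{Q^-(s)}{\lambda}\right)ds,\quad t\ge0,$$ where $W$ is a standard Brownian motion independent of the random variable $q$. Assume that $$\lim_{x\to\infty}H_1(x)>\frac{c}{\lambda}\ \text{ if } c\ge0,\qquad\text{and}\qquad \lim_{x\to\infty}H_{-1}(x)>-\frac{c}{\lambda}\ \text{ if } c\le0 .$$ Then $Q$ has a unique stationary distribution, and it is given by $$\pi(dx)=\begin{cases}C_0\exp\left\{-\dfrac{2}{\lambda^3(\sigma_1^2+\sigma_{-1}^2)}\left(-cx+\lambda^2\displaystyle\int_0^{x/\lambda}H_1(u)\,du\right)\right\}dx,& x\ge0,\\[2ex] C_0\exp\left\{-\dfrac{2}{\lambda^3(\sigma_1^2+\sigma_{-1}^2)}\left(-cx+\lambda^2\displaystyle\int_0^{-x/\lambda}H_{-1}(u)\,du\right)\right\}dx,&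 x<0,\end{cases}$$ where $C_0$ is the positive constant such that $\int_{\mathbb{R}}\pi(dx)=1$.
   Context: Conventions: $a^+=\max\{a,0\}$, $a^-=\max\{0,-a\}$, $Q^{\pm}(s)=Q(s)^{\pm}$. A function $f:[0,\infty)\to[0,\infty)$ is locally Lipschitz continuous if for each $t\ge0$ there is $\kappa\in(0,\infty)$ (possibly depending on $t$) with $|f(x_1)-f(x_2)|\le\kappa|x_1-x_2|$ for all $x_1,x_2\in[0,t]$. *)

(* Defs.v *)
From HB Require Import structures.
From mathcomp Require Import all_boot all_order all_algebra.
From mathcomp Require Import all_classical all_reals all_analysis.

Set Implicit Arguments.
Unset Strict Implicit.
Unset Printing Implicit Defensive.

Import Order.TTheory GRing.Theory Num.Theory numFieldNormedType.Exports.

Local Open Scope classical_set_scope.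
Local Open Scope ring_scope.

(* A function [0, oo) -> [0, oo) is represented by H : R -> R; only its values
   on [0, oo) are ever constrained or used. *)
Section coefficients.
Context {R : realType}.
Implicit Types H : R -> R.

Definition nonnegative_on_nneg H := forall x, 0 <= x -> 0 <= H x.

Definition nondecreasing_on_nneg H :=
  forall x y, 0 <= x -> x <= y -> H x <= H y.

Definition locally_lipschitz_on_nneg H :=
  forall t, 0 <= t -> exists2 k : R, 0 < k & k.-lipschitz_(`[0, t]) H.

Definition scaled_cdf_limit H :=
  exists F : nat -> cumulativeBounded (0 : R) (1 : R),
    (forall n, F n 0 = 0) /\
    forall t, 0 <= t ->
      Num.sqrt n%:R * F n (t / Num.sqrt n%:R) @[n --> \oo] --> H t.

End coefficients.

Section processes.
Context {d : measure_display} {T : measurableType d} {R : realType}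
  (P : probability T R).

Definition independent_systems (F G : set_system T) :=
  forall A B, F A -> G B -> P (A `&` B) = (P A * P B)%E.

Definition sigma_rv (X : T -> R) : set_system T :=
  preimage_set_system setT X measurable.

Definition sigma_process (I : set R) (X : R -> T -> R) : set_system T :=
  <<s \bigcup_(t in I) sigma_rv (X t) >>.

(* Time is [0, oo); X t is irrelevant for t < 0. The second parameter of
   normal_prob is the standard deviation. *)
Definition standard_brownian_motion (W : R -> {RV P >-> R}) : Prop :=
  [/\ {ae P, forall w, W 0 w = 0},
      {ae P, forall w, {within `[0, +oo[, continuous (fun t => W t w)}},
      (forall s t, 0 <= s -> s < t ->
         independent_systems (sigma_process `[0, s] W)
                             (sigma_rv (W t \- W s))) &
      (forall s t, 0 <= s -> s < t -> forall A, measurable A ->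
         P ((W t \- W s) @^-1` A) = normal_prob 0 (Num.sqrt (t - s)) A)].

Definition has_law (X : {RV P >-> R}) (mu : probability (measurableTypeR R) R) :=
  forall A, measurable A -> distribution P X A = mu A.

Variables (lambda c sigma1 sigmam1 : R) (H1 Hm1 : R -> R).

(* The diffusion coefficient is constant, so the equation is pathwise and
   involves no stochastic integral. *)
Definition sde_path (x : R) (w q : R -> R) : Prop :=
  forall t, 0 <= t ->
    q t = x + Num.sqrt (lambda ^+ 3 * (sigma1 ^+ 2 + sigmam1 ^+ 2)) * w t
          + c * t
          - lambda * (\int[lebesgue_measure]_(s in `[0, t])
                        H1 (Num.max (q s) 0 / lambda))%R
          + lambda * (\int[lebesgue_measure]_(s in `[0, t])
                        Hm1 (Num.max 0 (- q s) / lambda))%R.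

Definition diffusion (W : R -> {RV P >-> R}) (q : {RV P >-> R})
    (Q : R -> {RV P >-> R}) : Prop :=
  [/\ standard_brownian_motion W,
      independent_systems (sigma_rv q) (sigma_process `[0, +oo[ W),
      {ae P, forall w, {within `[0, +oo[, continuous (fun t => Q t w)}} &
      {ae P, forall w, sde_path (q w) (fun t => W t w) (fun t => Q t w)}].

End processes.

(* mu is stationary if every diffusion with the given coefficients whose initial
   state has law mu has law mu at all times. The first conjunct ensures that
   such a diffusion exists, so that the second one is not vacuous. *)
Definition stationary_distribution {R : realType}
    (lambda c sigma1 sigmam1 : R) (H1 Hm1 : R -> R)
    (mu : probability (measurableTypeR R) R) : Prop :=
  (exists (d : measure_display) (T : measurableType d) (P : probability T R)
     (W : R -> {RV P >-> R}) (q : {RV P >-> R}) (Q : R -> {RV P >-> R}),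
     diffusion lambda c sigma1 sigmam1 H1 Hm1 W q Q /\ has_law q mu) /\
  (forall (d : measure_display) (T : measurableType d) (P : probability T R)
     (W : R -> {RV P >-> R}) (q : {RV P >-> R}) (Q : R -> {RV P >-> R}),
     diffusion lambda c sigma1 sigmam1 H1 Hm1 W q Q -> has_law q mu ->
     forall t, 0 <= t -> has_law (Q t) mu).

Definition stationary_weight {R : realType}
    (lambda c sigma1 sigmam1 : R) (H1 Hm1 : R -> R) (x : R) : R :=
  let k := 2 / (lambda ^+ 3 * (sigma1 ^+ 2 + sigmam1 ^+ 2)) in
  if 0 <= x then
    expR (- k * (- c * x + lambda ^+ 2 *
      (\int[lebesgue_measure]_(u in `[0, x / lambda]) H1 u)%R))
  else
    expR (- k * (- c * x + lambda ^+ 2 *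
      (\int[lebesgue_measure]_(u in `[0, - x / lambda]) Hm1 u)%R)).

(* Main.v *)
Require Import Defs.
From HB Require Import structures.
From mathcomp Require Import all_boot all_order all_algebra.
From mathcomp Require Import all_classical all_reals all_analysis.
From mathcomp Require Import measurable_realfun ring lra.
Set Implicit Arguments.
Unset Strict Implicit.
Unset Printing Implicit Defensive.
Import Order.TTheory GRing.Theory Num.Theory numFieldNormedType.Exports.
Local Open Scope classical_set_scope.
Local Open Scope ring_scope.

(* Since the drift [b] is nonincreasing, the resolvent [J_h = (id - h b)^-1] is a
   contraction. Hence the kernel [K_h] of the implicit Euler chain
   [X_{n+1} = J_h (X_n + s dW_n)] preserves Lipschitz constants, and the chains
   converge pathwise to the solution, which also yields its existence.

   The weight satisfies [w' = (2/s^2) b w], so for a compactly supported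
   Lipschitz [g] with [int g w = 0] the Poisson equation
   [s^2/2 u'' + b u' = g] has an explicit bounded Lipschitz solution, and
   [K_h u - u = h g + O(h^{3/2})]. Summed along the chain, this shows that every
   stationary law integrates such [g] to zero, so it is proportional to [w].

   Conversely, a Lyapunov function shows that the chain spends a positive
   fraction of its time near the origin. Summing the Poisson estimate for a
   truncated and recentred [f - K_h^n f] with [f >= 0] then gives
   [int K_h^n f w <= int f w + O(sqrt h)] on compact sets. As [h -> 0], the law at
   time [t] of the solution started from the density [w] is dominated by its
   initial law, and both have mass one. *)

(** The drift is only locally Lipschitz and comes without a growth bound, so an explicit Euler
    scheme could not be controlled. The implicit step is a contraction for every step size because
    [b] is nonincreasing, and errors then add up over the steps without any Gronwall factor. Ito's
    formula and semigroup theory are avoided: the generator appears through a Gaussian integral of a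
    Taylor expansion, and the Poisson equation is a first-order linear equation for [u'] with
    integrating factor [w]. The cubic Taylor remainder of a Gaussian of size [sqrt h] produces the
    order [h^{3/2}], so about [1/h] steps accumulate only [sqrt h]. A law known to be stationary can
    be averaged over directly. To show that [w] is stationary no invariant law is available
    beforehand, so the chain is started at 0 and averaged over a long time. Its escape to infinity
    must then be excluded, and the Lyapunov function only bounds the occupation from below; this is
    why an inequality is proved there instead of an equality. Brownian motion is not constructed: it
    is taken from the given diffusion and carried to a product space. *)

Section density.
Context {R : realType}.
Local Notation leb := (@lebesgue_measure R).
Variables (nu : {finite_measure set (measurableTypeR R) -> \bar R}) (p : R -> R).
Hypothesis p_ge0 : forall x, 0 <= p x.
Hypothesis mp : measurable_fun [set: R] p.
Hypothesis nuE : forall A, measurable A -> nu A = (\int[leb]_(x in A) (p x)%:E)%E.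

Lemma density_dominates : nu `<< leb.
Proof.
apply/null_content_dominatesP => A mA muA0; rewrite nuE//.
apply: null_set_integral => //=; apply: measurable_funTS.
exact/measurable_EFinP.
Qed.

(** [p] and the Radon-Nikodym derivative of [nu] have the same integral over every measurable set,
    hence agree almost everywhere, and the change of variables for the latter carries over to
    [p]. *)
Lemma ge0_integral_density (f : R -> \bar R) : (forall x, 0 <= f x)%E ->
  measurable_fun [set: R] f ->
  (\int[nu]_x f x = \int[leb]_x (f x * (p x)%:E))%E.
Proof.
move=> f0 mf; have dom := density_dominates.
rewrite -(Radon_Nikodym_SigmaFinite.change_of_variables dom)//.
apply: ae_eq_integral => //.
- apply: emeasurable_funM => //.
  exact: measurable_int (Radon_Nikodym_SigmaFinite.f_integrable dom).
- by apply: emeasurable_funM => //; exact/measurable_EFinP.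
apply: ae_eqe_mul2l; apply: integral_ae_eq => //.
- exact: Radon_Nikodym_SigmaFinite.f_integrable.
- exact/measurable_EFinP.
- by move=> E _ mE; rewrite -nuE// -Radon_Nikodym_SigmaFinite.f_integral.
Qed.

Lemma integrable_density (f : R -> R) : measurable_fun [set: R] f ->
  leb.-integrable [set: R] (EFin \o (fun x => f x * p x)) ->
  nu.-integrable [set: R] (EFin \o f).
Proof.
move=> mf /integrableP[_ ifp]; apply/integrableP; split.
  exact/measurable_EFinP.
rewrite ge0_integral_density//; last first.
  exact/measurableT_comp/measurable_EFinP.
apply: le_lt_trans ifp; rewrite le_eqVlt; apply/orP; left; apply/eqP.
by apply: eq_integral => x _; rewrite /= normrM (ger0_norm (p_ge0 x)).
Qed.

Lemma integral_density (f : R -> R) : measurable_fun [set: R] f ->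
  (\int[nu]_x (f x)%:E = \int[leb]_x (f x * p x)%:E)%E.
Proof.
move=> mf; have mf' : measurable_fun [set: R] (EFin \o f) by exact/measurable_EFinP.
rewrite integralE [RHS]integralE.
rewrite !ge0_integral_density//; last 2 first.
- exact: measurable_funeneg.
- exact: measurable_funepos.
have pE x : ((f x * p x)%:E = (f x)%:E * (p x)%:E)%E by [].
congr (_ - _)%E; apply: eq_integral => x _.
  by rewrite !funeposE maxe_pMl ?lee_fin// ?mul0e.
by rewrite !funenegE maxe_pMl ?lee_fin// ?mul0e// EFinM mulNe.
Qed.

End density.

Section dominated.
Context d (T : measurableType d) (R : realType) (mu : {measure set T -> \bar R}).

Lemma Rdominated_cvg (f_ : nat -> T -> R) (f g : T -> R) :
  (forall n, measurable_fun setT (f_ n)) -> measurable_fun setT f ->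
  {ae mu, forall x, f_ n x @[n --> \oo] --> f x} ->
  mu.-integrable setT (EFin \o g) ->
  (forall n x, `|f_ n x| <= g x) ->
  \int[mu]_x f_ n x @[n --> \oo] --> \int[mu]_x f x.
Proof.
move=> mf_ mf ff ig fg.
have [|||||iF _ h] := @dominated_convergence _ _ R mu setT measurableT
  (fun n x => (f_ n x)%:E) (EFin \o f) (EFin \o g).
- by move=> n; exact/measurable_EFinP.
- exact/measurable_EFinP.
- by apply: filterS ff => x fx _; apply/cvg_EFin => //; exact: nearW.
- exact: ig.
- by apply: aeW => x n _ /=; rewrite lee_fin.
by apply: fine_cvg; rewrite fineK//; exact: integrable_fin_num.
Qed.

End dominated.

(** * Calculus with functions that are differentiable everywhere *)

Section mean_value_bounds.
Context {R : realType}.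

Lemma is_derive_continuous (f df : R -> R) :
  (forall x : R, is_derive x 1 f (df x)) -> continuous f.
Proof.
move=> fd x; apply/differentiable_continuous/derivable1_diffP.
by case: (fd x).
Qed.

Lemma mean_value_bound (f df : R -> R) (a b C : R) :
  (forall x : R, is_derive x 1 f (df x)) ->
  (forall x, Num.min a b <= x <= Num.max a b -> `|df x| <= C) ->
  `|f b - f a| <= C * `|b - a|.
Proof.
move=> fd; wlog ab : a b / a <= b => [h dfC|].
  have [ab|/ltW ba] := leP a b; first exact: h.
  by rewrite distrC (distrC b); apply: h => // x; rewrite minC maxC; exact: dfC.
rewrite (min_idPl ab) (max_idPr ab) => dfC.
have [x|c + ->] := @MVT_segment _ f df a b ab (fun x _ => fd x).
  exact/continuous_subspaceT/is_derive_continuous.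
by rewrite in_itv/= => /dfC; rewrite normrM => ?; exact: ler_wpM2r.
Qed.

Lemma mean_value_const (f df : R -> R) (a b : R) :
  (forall x : R, is_derive x 1 f (df x)) ->
  (forall x, Num.min a b <= x <= Num.max a b -> df x = 0) -> f b = f a.
Proof.
move=> fd df0; apply/eqP; rewrite -subr_eq0 -normr_le0 -[leRHS](mul0r `|b - a|).
by apply: mean_value_bound fd _ => x /df0 ->; rewrite normr0.
Qed.

Lemma derive1_unique (f df : R -> R) :
  (forall x : R, is_derive x 1 f (df x)) -> f^`()%classic = df.
Proof.
by move=> fd; apply/funext => x; rewrite derive1E; case: (fd x).
Qed.

Lemma integral_derivative (f df : R -> R) (a b : R) : a <= b ->
  (forall x : R, is_derive x 1 f (df x)) -> continuous df ->
  (\int[lebesgue_measure]_(x in `[a, b]) (df x)%:E = (f b - f a)%:E)%E.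
Proof.
rewrite le_eqVlt => /predU1P[-> _ _|ab fd cdf].
  by rewrite set_itv1 integral_set1 subrr.
rewrite EFinB; apply: continuous_FTC2 => //.
- exact: continuous_subspaceT.
- have cf := is_derive_continuous fd; split.
  + by move=> x _; case: (fd x).
  + exact/cvg_at_right_filter/cf.
  + exact/cvg_at_left_filter/cf.
- by move=> x _; rewrite (derive1_unique fd).
Qed.

Lemma integral_derivative_eq0 (f df : R -> R) :
  (forall x : R, is_derive x 1 f (df x)) -> continuous df ->
  lebesgue_measure.-integrable setT (EFin \o df) ->
  f x @[x --> +oo] --> 0 -> f x @[x --> -oo] --> 0 ->
  \int[lebesgue_measure]_x df x = 0.
Proof.
move=> fd cdf idf fy fNy.
(* Truncating to [[-n, n]] turns the integral into [f n - f (- n)], which tends to 0. *)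
pose g n x := df x * \1_(`[- n%:R, n%:R]%classic : set R) x.
have mdf : measurable_fun setT df by exact: continuous_measurable_fun.
have /cvg_lim <- // : \int[lebesgue_measure]_x g n x @[n --> \oo] -->
    \int[lebesgue_measure]_x df x.
  apply: (@Rdominated_cvg _ _ R (@lebesgue_measure R) g df (fun x => `|df x|)) => //.
  - by move=> n; apply: measurable_funM => //; exact: measurable_indic.
  - apply: aeW => x; apply: cvg_near_cst; near=> n.
    rewrite /g indicE mem_set ?mulr1//= in_itv/= -ler_norml.
    by near: n; exact: nbhs_infty_ger.
  - exact: integrable_norm.
  - move=> n x; rewrite /g normrM ler_piMr// indicE.
    by case: (_ \in _); rewrite ?normr1 ?normr0.
apply: cvg_lim => //.
rewrite (_ : (fun n => _) = (fun n => f n%:R - f (- n%:R))); last first.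
  apply/funext => n; rewrite /g.
  have nn : - n%:R <= n%:R :> R by rewrite -subr_ge0 opprK addr_ge0.
  have := integral_derivative nn fd cdf; rewrite integral_mkcond => /(congr1 fine) /= <-.
  rewrite /Rintegral; congr fine; apply: eq_integral => x _.
  by rewrite patchE indicE; case: ifPn => // _; rewrite ?mulr1 ?mulr0.
rewrite -[X in _ --> X](subrr (0:R)); apply: cvgB.
  apply: (cvg_comp (fun n => n%:R) f _ fy).
  exact: cvgr_idn.
move/cvgNy_compNP : fNy => fNy.
by apply: (cvg_comp (fun n => n%:R) (f \o -%R) _ fNy); exact: cvgr_idn.
Unshelve. all: by end_near.
Qed.

End mean_value_bounds.

Definition rv_of d d' (T : measurableType d) (T' : measurableType d') (R : realType)
    (P : probability T R) (f : T -> T') (mf : measurable_fun setT f) : {RV P >-> T'} :=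
  HB.pack f (isMeasurableFun.Build _ _ _ _ _ mf).

Section probability_rays.
Context {R : realType}.

(** The complements of the given rays are closed under intersection and generate the Borel sets;
    total mass one transfers the hypothesis to them. *)
Lemma probability_eq_rays (m1 m2 : probability (measurableTypeR R) R) :
  (forall x, m1 `]-oo, x]%classic = m2 `]-oo, x]%classic) ->
  forall A, measurable A -> m1 A = m2 A.
Proof.
move=> m12 A mA.
have rayE (m : probability (measurableTypeR R) R) x :
    (m `]x, +oo[%classic = 1 - m `]-oo, x]%classic)%E.
  by rewrite -setCitvl probability_setC.
have mG := @RGenOInfty.measurableE R.
apply: (@measure_unique _ R (measurableTypeR R) (@RGenOInfty.G R)
  (fun n => `]- n%:R, +oo[%classic) mG _ _ _ m1 m2) => //.
- move=> _ _ [x ->] [y ->]; exists (Num.max x y).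
  by apply/seteqP; split => z /=; rewrite !in_itv/= !andbT gt_max => /andP.
- by move=> n; eexists; reflexivity.
- apply/seteqP; split => // x _; exists (Num.truncn `|x|).+1 => //=.
  rewrite in_itv/= andbT ltrNl (le_lt_trans (ler_norm _))// normrN.
  exact: truncnS_gt.
- move=> _ [x ->]; apply: etrans (rayE m1 x) _.
  by apply: etrans _ (esym (rayE m2 x)); rewrite m12.
- move=> k; rewrite (le_lt_trans (probability_le1 _ _)) ?ltry//.
Qed.

End probability_rays.

(** * Gaussian moments *)

Section gaussian.
Context {R : realType}.
Local Notation leb := (@lebesgue_measure R).
Local Notation phi := (@normal_pdf R 0 1).
Local Notation gauss := (@normal_prob R 0 1).

Lemma normal_pdf_std (x : R) : phi x = normal_peak 1 * expR (- x ^+ 2 / 2).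
Proof. by rewrite normal_pdfE ?oner_neq0// /normal_fun subr0 expr1n. Qed.

Lemma is_derive_normal_pdf (x : R) : is_derive x 1 phi (- x * phi x).
Proof.
rewrite (_ : phi = fun y => normal_peak 1 * expR (- y ^+ 2 / 2)); last first.
  by apply/funext => y; exact: normal_pdf_std.
apply: is_derive_eq.
rewrite /GRing.scale/=; field.
Unshelve. all: by [].
Qed.

(** Squaring [1 + u <= expR u] at [u = x^2/8] gives [(8 + x^2)^2 <= 64 expR (x^2/4)], whence the 64.
    The exponential left over is, up to a factor, the normal density of variance 2. *)
Lemma expR_quartic_bound (x : R) :
  (1 + x ^+ 4) * expR (- x ^+ 2 / 2) <= 64 * expR (- x ^+ 2 / 4).
Proof.
have -> : - x ^+ 2 / 2 = - x ^+ 2 / 4 + - (x ^+ 2 / 4) by field.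
rewrite expRD mulrCA mulrC ler_pM2r ?expR_gt0//.
rewrite expRN ler_pdivrMr ?expR_gt0//.
have -> : x ^+ 2 / 4 = x ^+ 2 / 8 + x ^+ 2 / 8 by field.
rewrite expRD.
have h := expR_ge1Dx (x ^+ 2 / 8).
have x0 : 0 <= x ^+ 2 / 8 by rewrite divr_ge0// sqr_ge0.
have : (1 + x ^+ 2 / 8) ^+ 2 <= expR (x ^+ 2 / 8) * expR (x ^+ 2 / 8).
  by rewrite -expr2 lerXn2r// ?nnegrE ?expR_ge0// addr_ge0.
nra.
Qed.

(** The dominating function is a multiple of the normal density of variance 2. Quartic growth covers
    every integrand below: Lipschitz functions, quadratic expansions and their cubic remainders. *)
Lemma gauss_integrable (f : R -> R) (C : R) : measurable_fun setT f ->
  (forall y, `|f y| <= C * (1 + y ^+ 4)) -> gauss.-integrable setT (EFin \o f).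
Proof.
move=> mf fC; apply: (@integrable_density _ _ phi) => //.
- by move=> x; exact: normal_pdf_ge0.
- exact: measurable_normal_pdf.
apply: (@le_integrable _ _ _ leb setT measurableT _ (EFin \o (fun x =>
   (C * 64 * normal_peak 1 / normal_peak (Num.sqrt 2)) * normal_pdf 0 (Num.sqrt 2) x))).
- apply/measurable_EFinP; apply: measurable_funM => //.
  exact: measurable_normal_pdf.
- move=> x _; rewrite /= lee_fin.
  apply: le_trans (ler_norm _).
  rewrite normrM (ger0_norm (normal_pdf_ge0 _ _ _)).
  have s2 : Num.sqrt 2 != 0 :> R by rewrite gt_eqF// sqrtr_gt0.
  rewrite (normal_pdfE _ s2) /normal_fun subr0 sqr_sqrtr//.
  have -> : - x ^+ 2 / (2 *+ 2) = - x ^+ 2 / 4 by congr (_ / _); rewrite -mulr_natr -natrM.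
  have p2 := normal_peak_gt0 s2.
  rewrite mulrA divfK ?gt_eqF// normal_pdf_std.
  have p1 : 0 < normal_peak (1:R) by rewrite normal_peak_gt0// oner_neq0.
  have C0 : 0 <= C.
    by have := le_trans (normr_ge0 _) (fC 0); rewrite expr0n/= addr0 mulr1.
  rewrite mulrCA [leRHS]mulrAC [leRHS]mulrC ler_wpM2l ?(ltW p1)//.
  apply: (@le_trans _ _ (C * (1 + x ^+ 4) * expR (- x ^+ 2 / 2))).
    by rewrite ler_wpM2r ?expR_ge0.
  by rewrite -!mulrA ler_wpM2l// expR_quartic_bound.
- apply: (@eq_integrable _ _ _ leb setT measurableT (fun x => (C * 64 * normal_peak 1 / normal_peak (Num.sqrt 2))%:E
     * (normal_pdf 0 (Num.sqrt 2) x)%:E)%E) => //.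
  exact/integrableZl/integrable_normal_pdf.
Qed.

Lemma gauss_RintegralE (f : R -> R) : measurable_fun setT f ->
  \int[gauss]_y f y = \int[leb]_y (f y * phi y).
Proof.
move=> mf; rewrite /Rintegral; congr fine; apply: integral_density => //.
- by move=> x; exact: normal_pdf_ge0.
- exact: measurable_normal_pdf.
Qed.

Lemma normal_pdf_decay (x : R) : (1 + x ^+ 4) * phi x <= 64 * normal_peak 1.
Proof.
rewrite normal_pdf_std mulrCA mulrC ler_wpM2r ?normal_peak_ge0//.
apply: le_trans (expR_quartic_bound x) _.
rewrite ger_pMr// -[leRHS]expR0 ler_expR mulNr oppr_le0 divr_ge0// sqr_ge0//.
Qed.

Lemma cvgN_0 (F : set_system R) (FF : Filter F) (g : R -> R) :
  g x @[x --> F] --> 0 -> - g x @[x --> F] --> 0.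
Proof. by move=> h; have := @cvgN R R^o _ F FF g 0 h; rewrite oppr0; exact. Qed.

Lemma cvg_xpdfy : x * phi x @[x --> +oo] --> 0.
Proof.
apply: (@squeeze_cvgr _ _ _ _ (fun=> 0) (fun x => 64 * normal_peak 1 / x)); last 2 first.
- exact: cvg_cst.
- rewrite -[X in _ --> X](mulr0 (64 * normal_peak 1)).
  apply: cvgMl_tmp; apply/gtr0_cvgV0; last exact: cvg_id.
  exact: nbhs_pinfty_gt.
near=> x; have x1 : 1 <= x by near: x; exact: nbhs_pinfty_ge.
have x0 : 0 < x by exact: lt_le_trans x1.
rewrite mulr_ge0 ?(ltW x0) ?normal_pdf_ge0//= ler_pdivlMr//.
apply: le_trans (normal_pdf_decay x).
rewrite mulrAC ler_wpM2r ?normal_pdf_ge0//.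
have : x <= x ^+ 2 by rewrite expr2 ler_pMr.
have -> : x ^+ 4 = (x ^+ 2) ^+ 2 by rewrite -exprM.
nra.
Unshelve. all: by end_near.
Qed.

Lemma cvg_pdfy : phi x @[x --> +oo] --> 0.
Proof.
apply: (@squeeze_cvgr _ _ _ _ (fun=> 0) (fun x => x * phi x)); last 2 first.
- exact: cvg_cst.
- exact: cvg_xpdfy.
near=> x; have x1 : 1 <= x by near: x; exact: nbhs_pinfty_ge.
by rewrite normal_pdf_ge0/= ler_peMl// normal_pdf_ge0.
Unshelve. all: by end_near.
Qed.

Lemma normal_pdfN (x : R) : phi (- x) = phi x.
Proof. by rewrite !normal_pdf_std sqrrN. Qed.

Lemma gauss_poly_integrable (f : R -> R) (C : R) : continuous f ->
  (forall y, `|f y| <= C * (1 + y ^+ 4)) ->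
  leb.-integrable setT (EFin \o (fun y => f y * phi y)).
Proof.
move=> cf fC; have mf : measurable_fun setT f by exact: continuous_measurable_fun.
have /integrableP[_ iF] := gauss_integrable mf fC.
apply/integrableP; split.
  by apply/measurable_EFinP/measurable_funM => //; exact: measurable_normal_pdf.
apply: le_lt_trans iF; rewrite le_eqVlt; apply/orP; left; apply/eqP.
have p0 (x : R) : 0 <= phi x by exact: normal_pdf_ge0.
have mp : measurable_fun setT phi by exact: measurable_normal_pdf.
rewrite (@ge0_integral_density _ gauss _ mp)//; last first.
  by do 2 apply: measurableT_comp => //.
by apply: eq_integral => x _; rewrite /= normrM EFinM (ger0_norm (p0 x)).
Qed.

Lemma quartic_bounds (y : R) : [/\ `|y| <= 2 * (1 + y ^+ 4),
  y ^+ 2 <= 1 * (1 + y ^+ 4) & `|y| ^+ 3 <= 2 * (1 + y ^+ 4)].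
Proof.
have -> : y ^+ 4 = `|y| ^+ 4 by rewrite -normrX ger0_norm// exprn_even_ge0.
have -> : y ^+ 2 = `|y| ^+ 2 by rewrite real_normK// num_real.
have := normr_ge0 y; move: `|y| => t t0.
have := sqr_ge0 (t ^+ 2 - 1); have := sqr_ge0 (t - 1); have := sqr_ge0 (t * (t - 1)).
by split; nra.
Qed.

Lemma gauss_mean : \int[gauss]_y y = 0.
Proof.
rewrite gauss_RintegralE//.
have dF (x : R) : is_derive x 1 (fun x => - phi x) (x * phi x).
  by have h := is_derive_normal_pdf x; apply: is_derive_eq; rewrite mulNr opprK.
have c1 : continuous (fun x : R => x) by move=> x; exact: cvg_id.
have cphi : continuous phi by apply: continuous_normal_pdf; exact: oner_neq0.
apply: (integral_derivative_eq0 dF).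
- by move=> x; apply: cvgM; [exact: c1|exact: cphi].
- by apply: (gauss_poly_integrable (C := 2) c1) => y; have [] := quartic_bounds y.
- exact: cvgN_0 cvg_pdfy.
- apply/cvgNy_compNP; rewrite (_ : _ \o _ = (fun x => - phi x)); last first.
    by apply/funext => x /=; rewrite normal_pdfN.
  exact: cvgN_0 cvg_pdfy.
Qed.

(** [(1 - x^2) phi] is the derivative of [x phi], which vanishes at both infinities. *)
Lemma gauss_variance : \int[gauss]_y (y ^+ 2) = 1.
Proof.
have dF (x : R) : is_derive x 1 (fun x => x * phi x) ((1 - x ^+ 2) * phi x).
  have h := is_derive_normal_pdf x; apply: is_derive_eq.
  by rewrite /GRing.scale/=; ring.
have c1 : continuous (fun x : R => x) by move=> x; exact: cvg_id.
have cphi : continuous phi by apply: continuous_normal_pdf; exact: oner_neq0.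
have c2 : continuous (fun x : R => x ^+ 2) by exact: exprn_continuous.
have c3 : continuous (fun x : R => 1 - x ^+ 2).
  by move=> x; apply: cvgB; [exact: cvg_cst|exact: c2].
have i1 : gauss.-integrable setT (EFin \o (fun _ : R => 1 : R)).
  apply: (@gauss_integrable _ 1) => // y.
  by rewrite normr1 mul1r lerDl exprn_even_ge0.
have m2 : measurable_fun setT (fun x : R => x ^+ 2) by exact: continuous_measurable_fun.
have i2 : gauss.-integrable setT (EFin \o (fun y : R => y ^+ 2)).
  apply: (@gauss_integrable _ 1) => // y.
  by rewrite ger0_norm ?sqr_ge0//; have [] := quartic_bounds y.
have : \int[gauss]_y (1 - y ^+ 2) = 0.
  rewrite gauss_RintegralE; last exact: continuous_measurable_fun.
  apply: (integral_derivative_eq0 dF).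
  - by move=> x; apply: cvgM; [exact: c3|exact: cphi].
  - apply: (gauss_poly_integrable (C := 1) c3) => y.
    rewrite ler_norml mul1r; have : 0 <= y ^+ 4 by rewrite exprn_even_ge0.
    by have [_ + _] := quartic_bounds y; have := sqr_ge0 y; lra.
  - exact: cvg_xpdfy.
  - apply/cvgNy_compNP; rewrite (_ : _ \o _ = (fun x => - (x * phi x))); last first.
      by apply/funext => x /=; rewrite normal_pdfN mulNr.
    exact: cvgN_0 cvg_xpdfy.
rewrite RintegralB// => /eqP; rewrite subr_eq0 => /eqP <-.
rewrite Rintegral_cst// mul1r.
by have /(congr1 fine) := @probability_setT _ _ R gauss.
Qed.

(** Brownian increments over a step [h] have standard deviation [sqrt h], while the kernel
    integrates against the standard normal law; this is the bridge between the two. *)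
Lemma normal_prob_scale (s : R) (A : set R) : 0 < s -> measurable A ->
  normal_prob 0 s A = gauss ((fun y => s * y) @^-1` A).
Proof.
move=> s0 mA.
have ms : @measurable_fun _ _ (measurableTypeR R) (measurableTypeR R) setT
  (fun y : R => s * y) by exact: measurable_funM.
pose X := rv_of gauss ms.
apply: (@probability_eq_rays R (normal_prob 0 s) (distribution gauss X) _ A mA) => x.
have sn0 : s != 0 by rewrite gt_eqF.
have dF (y : R) : is_derive y 1 (fun y => s * y) s.
  by apply: is_derive_eq; rewrite /GRing.scale/= mulr1.
have dFE := derive1_unique dF.
rewrite /distribution/pushforward/=.
have -> : (fun y => s * y) @^-1` `]-oo, x] = `]-oo, s^-1 * x]%classic.
  apply/seteqP; split => y /=; rewrite !in_itv/=.
    by move=> h; rewrite ler_pdivlMl.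
  by rewrite ler_pdivlMl.
rewrite /normal_prob.
have {1}-> : x = s * (s^-1 * x) by rewrite mulVKf.
rewrite (@increasing_ge0_integration_by_substitutionNy R (fun y => s * y)
  (normal_pdf 0 s) (s^-1 * x)); last 8 first.
- by move=> a b _ _ ab; rewrite ltr_pM2l.
- by rewrite dFE => y _; exact: cvg_cst.
- by rewrite dFE; exact: is_cvg_cst.
- by rewrite dFE; exact: cvg_cst.
- split; first by move=> y _; case: (dF y).
  exact/cvg_at_left_filter/(is_derive_continuous dF).
- by apply: gt0_cvgMrNy => //; exact: cvg_id.
- exact/continuous_subspaceT/continuous_normal_pdf.
- by move=> y _; exact: normal_pdf_ge0.
apply: eq_integral => y _; rewrite dFE; congr EFin.
have -> : ((normal_pdf 0 s \o [eta *%R s]) * (fun=> s)) y =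
  normal_pdf 0 s (s * y) * s by [].
rewrite normal_pdf_std (normal_pdfE _ sn0) /normal_fun subr0.
have -> : - (s * y) ^+ 2 / (s ^+ 2 *+ 2) = - y ^+ 2 / 2.
  by rewrite -mulr_natr; field; rewrite sn0.
rewrite mulrAC; congr (_ * _); rewrite /normal_peak expr1n mul1r.
rewrite -mulrnAr sqrtrM ?sqr_ge0// sqrtr_sqr gtr0_norm// invfM mulrAC mulVf// mul1r//.
Qed.

End gaussian.

(** * The implicit Euler kernel *)

Section lipschitz_functions.
Context {R : realType}.
Implicit Types (f g : R -> R) (L M : R).

(** The constant is explicit and global, since the iterates of the kernel must share one constant
    for all step sizes and step numbers. Its sign is not imposed; the points 1 and 0 show that it is
    nonnegative. *)
Definition lip L g := forall x y, `|g x - g y| <= L * `|x - y|.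

Lemma lip_continuous L g : lip L g -> continuous g.
Proof.
move=> gL x; apply/(@cvgrPdist_lt _ R^o) => e e0.
near=> y; apply: le_lt_trans (gL _ _) _.
have L0 : 0 < `|L| + 1 by rewrite ltr_wpDl.
apply: (@le_lt_trans _ _ ((`|L| + 1) * `|x - y|)).
  by rewrite ler_wpM2r// (le_trans (ler_norm _))// lerDl.
rewrite -ltr_pdivlMl// mulrC.
near: y; apply: cvgr_dist_lt => //; exact: divr_gt0.
Unshelve. all: by end_near. Qed.

Lemma lip_measurable L g : lip L g -> measurable_fun setT g.
Proof. by move=> /lip_continuous; exact: continuous_measurable_fun. Qed.

Lemma lipW L M g : L <= M -> lip L g -> lip M g.
Proof. by move=> LM gL x y; rewrite (le_trans (gL _ _))// ler_wpM2r. Qed.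

Lemma lip_cst c : lip 0 (fun=> c).
Proof. by move=> x y; rewrite subrr normr0 mul0r. Qed.

Lemma lipD L M f g : lip L f -> lip M g -> lip (L + M) (fun x => f x + g x).
Proof.
move=> fL gM x y; rewrite opprD addrACA mulrDl.
by rewrite (le_trans (ler_normD _ _))// lerD.
Qed.

Lemma lipZ L c f : lip L f -> lip (`|c| * L) (fun x => c * f x).
Proof. by move=> fL x y; rewrite -mulrBr normrM -mulrA ler_wpM2l. Qed.

Lemma lipB L M f g : lip L f -> lip M g -> lip (L + M) (fun x => f x - g x).
Proof.
move=> fL gM x y; rewrite mulrDl.
have -> : f x - g x - (f y - g y) = (f x - f y) - (g x - g y) by ring.
by rewrite (le_trans (ler_normB _ _))// lerD.
Qed.

Lemma lipM L M A B f g : lip L f -> lip M g ->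
  (forall x, `|f x| <= A) -> (forall x, `|g x| <= B) ->
  lip (L * B + A * M) (fun x => f x * g x).
Proof.
move=> fL gM fA gB x y.
have -> : f x * g x - f y * g y = (f x - f y) * g x + f y * (g x - g y) by ring.
rewrite (le_trans (ler_normD _ _))// !normrM mulrDl lerD//.
  by rewrite mulrAC ler_pM.
by rewrite -mulrA ler_pM.
Qed.

(** Squaring: [a^2 = u^2 - 2 m u + m^2 >= u^2]. With [m] an increment of [h b], this is the
    accretivity inequality behind both the contraction and the stability of the implicit step. *)
Lemma norm_contraction (u a m : R) : u = a + m -> m * u <= 0 -> `|u| <= `|a|.
Proof.
move=> uE mu0; rewrite -ler_sqr ?nnegrE// !real_normK ?num_real//.
have -> : a = u - m by rewrite uE addrK.
have := sqr_ge0 m; nra.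
Qed.

End lipschitz_functions.

Section implicit_step.
Context {R : realType}.
Variable (b : R -> R).
Hypotheses (cb : continuous b) (nb : forall x y, x <= y -> b y <= b x).

Lemma nonincreasing_mul_le0 x y : (b x - b y) * (x - y) <= 0.
Proof.
have [xy|/ltW yx] := leP x y.
  by rewrite mulr_ge0_le0 ?subr_le0// subr_ge0 nb.
by rewrite mulr_le0_ge0 ?subr_ge0// subr_le0 nb.
Qed.

Definition implicit_step (h y : R) : R := xget 0 [set z | z - h * b z = y].

Local Notation J := implicit_step.

Lemma implicit_stepE h y : 0 <= h -> J h y = y + h * b (J h y).
Proof.
move=> h0; suff : [set z | z - h * b z = y] (J h y).
  by move=> /= /eqP; rewrite subr_eq => /eqP.
apply: xgetPex.
(* One explicit step from 0 brackets the root: since [b] is nonincreasing, [z - h b z] lies on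
   opposite sides of [y] at the smaller and at the larger of 0 and [y + h b 0]. *)
pose lo := Num.min 0 (y + h * b 0); pose hi := Num.max 0 (y + h * b 0).
have lohi : lo <= hi by rewrite ge_min le_max lexx.
have [||z _ zE] := @IVT R (fun z => z - h * b z) lo hi y lohi.
- apply: continuous_subspaceT => x; apply: cvgB; first exact: cvg_id.
  by apply: cvgM; [exact: cvg_cst|exact: cb].
- have Jlo : lo - h * b lo <= y.
    rewrite lerBlDr; apply: (@le_trans _ _ (y + h * b 0)).
      by rewrite ge_min lexx orbT.
    by rewrite lerD2l ler_wpM2l// nb// ge_min lexx.
  have Jhi : y <= hi - h * b hi.
    rewrite lerBrDr; apply: (@le_trans _ _ (y + h * b 0)).
      by rewrite lerD2l ler_wpM2l// nb// le_max lexx.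
    by rewrite le_max lexx orbT.
  by rewrite ge_min le_max Jlo Jhi orbT.
- by exists z.
Qed.

Lemma implicit_step_lip h : 0 <= h -> lip 1 (J h).
Proof.
move=> h0 x y; rewrite mul1r.
apply: (@norm_contraction _ _ _ (h * (b (J h x) - b (J h y)))).
  by rewrite {1}(implicit_stepE x h0) {1}(implicit_stepE y h0); ring.
by rewrite -mulrA mulr_ge0_le0// nonincreasing_mul_le0.
Qed.

Section kernel.
Variables (s h : R).
Implicit Types (f g : R -> R) (x : R).
Hypothesis h_ge0 : 0 <= h.
Local Notation gauss := (@normal_prob R 0 1).

Definition euler_kernel (g : R -> R) (x : R) : R :=
  \int[gauss]_y g (J h (x + s * Num.sqrt h * y)).

Local Notation K := euler_kernel.

Lemma euler_measurable g x : measurable_fun [set: R] g ->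
  measurable_fun [set: R] (fun y : R => g (J h (x + s * Num.sqrt h * y))).
Proof.
move=> mg; apply: measurableT_comp => //; apply: measurableT_comp.
  exact: lip_measurable (implicit_step_lip h_ge0).
by apply: measurable_funD => //; exact: measurable_funM.
Qed.

Lemma euler_integrable L g x : lip L g ->
  gauss.-integrable setT (EFin \o (fun y => g (J h (x + s * Num.sqrt h * y)))).
Proof.
move=> gL; have L0 : 0 <= L.
  by have := le_trans (normr_ge0 _) (gL 1 0); rewrite subr0 normr1 mulr1.
set a := s * Num.sqrt h.
apply: (@gauss_integrable _ _ (`|g (J h x)| + 2 * L * `|a|)).
  by apply: euler_measurable; exact: lip_measurable gL.
move=> y; rewrite -[X in `|X|](subrK (g (J h x))) (le_trans (ler_normD _ _))//.
have gy := gL (J h (x + a * y)) (J h x).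
have := implicit_step_lip h_ge0 (x + a * y) x; rewrite mul1r (_ : x + a * y - x = a * y); last by ring.
move=> Jy.
have [y1 _ _] := quartic_bounds y; rewrite mulrDl [leLHS]addrC; apply: lerD.
  by rewrite ler_peMr// lerDl exprn_even_ge0.
apply: le_trans gy _.
rewrite (_ : 2 * L * `|a| * _ = L * (`|a| * (2 * (1 + y ^+ 4)))); last by ring.
by apply: ler_wpM2l => //; rewrite (le_trans Jy)// normrM ler_wpM2l.
Qed.

Lemma euler_kernel_cst c : K (fun=> c) = fun=> c.
Proof.
apply/funext => x; rewrite /K Rintegral_cst//.
by have /(congr1 fine) /= -> := @probability_setT _ _ R gauss; rewrite mulr1.
Qed.

Lemma euler_kernelD L M f g : lip L f -> lip M g ->
  K (fun x => f x + g x) = fun x => K f x + K g x.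
Proof.
move=> fL gM; apply/funext => x; rewrite /K RintegralD//.
- exact: euler_integrable fL.
- exact: euler_integrable gM.
Qed.

Lemma euler_kernelB L M f g : lip L f -> lip M g ->
  K (fun x => f x - g x) = fun x => K f x - K g x.
Proof.
move=> fL gM; apply/funext => x; rewrite /K RintegralB//.
- exact: euler_integrable fL.
- exact: euler_integrable gM.
Qed.

Lemma euler_kernelZ L c f : lip L f -> K (fun x => c * f x) = fun x => c * K f x.
Proof.
by move=> fL; apply/funext => x; rewrite /K RintegralZl//; exact: euler_integrable fL.
Qed.

Lemma le_euler_kernel L M f g x : lip L f -> lip M g ->
  (forall x, f x <= g x) -> K f x <= K g x.
Proof.
move=> fL gM fg; apply: le_Rintegral => //.
- exact: euler_integrable fL.
- exact: euler_integrable gM.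
Qed.

(** Both starting points receive the same Gaussian increment and [J h] is a contraction, so their
    distance cannot grow. The constant is kept exactly, not up to a factor [1 + O(h)], and therefore
    survives any number of iterations. *)
Lemma euler_kernel_lip L g : lip L g -> lip L (K g).
Proof.
move=> gL x x'; rewrite /K -RintegralB//; last 2 first.
- exact: euler_integrable gL.
- exact: euler_integrable gL.
set a := s * Num.sqrt h.
have mB : measurable_fun [set: R] (fun y : R => g (J h (x + a * y)) - g (J h (x' + a * y))).
  by apply: measurable_funB; apply: euler_measurable; exact: lip_measurable gL.
have L0 : 0 <= L.
  by have := le_trans (normr_ge0 _) (gL 1 0); rewrite subr0 normr1 mulr1.
have Bx y : `|g (J h (x + a * y)) - g (J h (x' + a * y))| <= L * `|x - x'|.
  apply: le_trans (gL _ _) _; apply: ler_wpM2l => //.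
  have := implicit_step_lip h_ge0 (x + a * y) (x' + a * y).
  by rewrite mul1r opprD addrACA subrr addr0.
have iB : gauss.-integrable setT
    (EFin \o (fun y => g (J h (x + a * y)) - g (J h (x' + a * y)))).
  apply: (@gauss_integrable _ _ (L * `|x - x'|) mB) => y.
  rewrite (le_trans (Bx y))// ler_peMr ?mulr_ge0// lerDl exprn_even_ge0//.
apply: le_trans (le_normr_Rintegral measurableT iB) _.
rewrite [leRHS](_ : _ = \int[gauss]_y (L * `|x - x'|)); last first.
  rewrite Rintegral_cst//.
  by have /(congr1 fine) /= -> := @probability_setT _ _ R gauss; rewrite mulr1.
apply: le_Rintegral => //.
- exact: integrable_norm.
- apply: (@gauss_integrable _ _ (L * `|x - x'|)) => // y.
  by rewrite ger0_norm ?mulr_ge0// ler_peMr ?mulr_ge0// lerDl exprn_even_ge0.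
Qed.

End kernel.
End implicit_step.

(** * The Poisson equation and the generator *)

Section antiderivative.
Context {R : realType}.
Local Notation leb := (@lebesgue_measure R).

Lemma continuous_itv_integrable (f : R -> R) (a b : R) : continuous f ->
  leb.-integrable `[a, b] (EFin \o f).
Proof.
move=> cf; apply: continuous_compact_integrable; first exact: segment_compact.
exact: continuous_subspaceT.
Qed.

Lemma continuous_antiderivative (f : R -> R) : continuous f ->
  exists F : R -> R, forall x : R, is_derive x 1 F (f x).
Proof.
move=> cf.
(* Subtracting the integral up to 0 makes [G a x] independent of [a] as long as [a] lies to the left
   of [x] and of 0. The base point of [F] can then move with its argument, and near a given [x] the
   function [F] coincides with a [G] of fixed base point, to which the fundamental theorem
   applies. *)
pose G a x := \int[leb]_(t in `[a, x]) f t - \int[leb]_(t in `[a, 0]) f t.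
have GE a a' x : a <= a' -> a' <= x -> a' <= 0 -> G a x = G a' x.
  move=> aa' a'x a'0; rewrite /G.
  have h y : a' <= y -> \int[leb]_(t in `[a, y]) f t =
      \int[leb]_(t in `[a', y]) f t + \int[leb]_(t in `[a, a']) f t.
    move=> a'y; apply/eqP; rewrite -subr_eq; apply/eqP.
    rewrite (@Rintegral_itvB _ _ (BLeft a) (BRight y))//.
    - by rewrite Rintegral_itv_obnd_cbnd//; apply: integrableS
        (continuous_itv_integrable a' y cf) => //; exact: subset_itv_oc_cc.
    - exact: continuous_itv_integrable.
  by rewrite h// (h 0)//; ring.
pose F x := G (- (`|x| + 1)) x.
exists F => x.
have dG : is_derive x 1 (G (- (`|x| + 2))) (f x).
  have xx : - (`|x| + 2) < x by rewrite ltrNl -normrN (le_lt_trans (ler_norm _))// ltrDl.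
  have xx1 : x < x + 1 by rewrite ltrDl.
  have [dI IE] := @continuous_FTC1_closed _ f (- (`|x| + 2)) x (x + 1)
    xx1 (continuous_itv_integrable _ _ cf) xx (cf x).
  rewrite derive1E in IE; have hI := DeriveDef dI IE.
  rewrite -[f x]subr0; exact: (is_deriveB hI (is_derive_cst _ x 1)).
have GF : {near x, G (- (`|x| + 2)) =1 F}.
  near=> y.
  have yx : `|x - y| < 1 by near: y; exact: cvgr_dist_lt.
  have yx1 : `|y| < `|x| + 1.
    by rewrite -(subrK x y) (le_lt_trans (ler_normD _ _))// addrC ltrD2l distrC.
  have := ler_norm (- y); rewrite normrN => y1; have y0 := normr_ge0 y.
  by rewrite /F (GE (- (`|x| + 2)) (- (`|y| + 1)))//; lra.
exact: near_eq_is_derive GF dG.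
Unshelve. all: by end_near. Qed.

End antiderivative.

Section poisson.
Context {R : realType}.
Local Notation leb := (@lebesgue_measure R).
Variables (b w : R -> R) (k : R).
Hypothesis k_gt0 : 0 < k.
Hypothesis cb : continuous b.
Hypothesis b_lip : forall r, exists2 L : R, 0 <= L & forall x y,
  `|x| <= r -> `|y| <= r -> `|b x - b y| <= L * `|x - y|.
Hypothesis w_gt0 : forall x, 0 < w x.
Hypothesis dw : forall x : R, is_derive x 1 w (k * b x * w x).

Let cw : continuous w. Proof. exact: is_derive_continuous dw. Qed.

Lemma continuous_norm_bounded (f : R -> R) r : 0 <= r -> continuous f ->
  exists2 M : R, 0 <= M & forall x, `|x| <= r -> `|f x| <= M.
Proof.
move=> r0 cf; have rr : - r <= r by rewrite -subr_ge0 opprK addr_ge0.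
have cnf : {within `[- r, r], continuous (fun x => `|f x|)}.
  by apply: continuous_subspaceT => x; exact: (cvg_norm (cf x)).
have [c _ fc] := EVT_max rr cnf; exists `|f c| => // x xr.
by apply: fc; rewrite in_itv/= -ler_norml.
Qed.

Lemma vanishing_outside_lip (f df : R -> R) (r C : R) : 0 <= C ->
  (forall x : R, is_derive x 1 f (df x)) ->
  (forall x, r <= `|x| -> df x = 0) -> (forall x, `|x| <= r -> `|df x| <= C) ->
  lip C f.
Proof.
move=> C0 fd df0 dfC x y; rewrite distrC [`|x - y|]distrC.
apply: mean_value_bound fd _ => z _; have [zr|/ltW zr] := leP `|z| r; first exact: dfC.
by rewrite df0// normr0.
Qed.

(** With [v = u'] the equation reads [v' + k b v = k g]. Since [w' = k b w], it becomes
    [(v w)' = k g w], so [v = k I / w] where [I] integrates [g w] from [- r]. The zero mean of [g w]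
    makes [I], hence [v], vanish beyond [r] too; [u] is therefore constant on each side and bounded.
    [C] depends on [r] and [A] but not on [g], because [g] will later vary with the step size and
    the number of steps. *)
Lemma poisson_solution (r A : R) : 0 <= r -> 0 <= A ->
  exists2 C : R, 0 <= C & forall g, lip A g -> (forall x, `|g x| <= A) ->
    (forall x, r <= `|x| -> g x = 0) -> \int[leb]_x (g x * w x) = 0 ->
  exists u v : R -> R,
    [/\ forall x : R, is_derive x 1 u (v x),
        forall x : R, is_derive x 1 v (k * (g x - b x * v x)),
        forall x, r <= `|x| -> v x = 0,
        forall x, `|u x| <= C &
        [/\ lip C u, lip C v, lip C (fun x => b x * v x) &
            lip C (fun x => k * (g x - b x * v x))]].
Proof.
move=> r0 A0.
have rr : - r <= r by rewrite -subr_ge0 opprK addr_ge0.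
have [M M0 bM] := continuous_norm_bounded r0 cb.
have [wM wM0 wwM] := continuous_norm_bounded r0 cw.
have cwV : continuous (fun x => (w x)^-1).
  by move=> x; apply: cvgV; [rewrite gt_eqF|exact: cw].
have [wV wV0 wwV] := continuous_norm_bounded r0 cwV.
have [L L0 bL] := b_lip r.
(* On [[-r, r]], [I1] bounds [I], [V1] bounds [v] and [V2] bounds [v']; [B2] and [C2] are Lipschitz
   constants of [b v] and of [v']. *)
pose I1 := A * wM * (2 * r); pose V1 := k * I1 * wV.
pose V2 := k * (A + M * V1); pose B2 := M * V2 + L * V1.
pose C2 := k * (A + B2).
have I10 : 0 <= I1 by rewrite !mulr_ge0.
have V10 : 0 <= V1 by rewrite !mulr_ge0// ltW.
have V20 : 0 <= V2 by rewrite mulr_ge0 ?addr_ge0 ?mulr_ge0// ltW.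
have B20 : 0 <= B2 by apply: addr_ge0; apply: mulr_ge0.
have C20 : 0 <= C2 by apply: mulr_ge0; [exact: ltW|exact: addr_ge0].
pose C := V1 + V2 + B2 + C2 + V1 * r.
have C0 : 0 <= V1 * r by rewrite mulr_ge0.
exists C => [|g gA gbd g0 gw0]; first by rewrite /C; lra.
have cg := lip_continuous gA.
have cgw : continuous (fun x => g x * w x) by move=> x; apply: cvgM; [exact: cg|exact: cw].
have [P dP] := continuous_antiderivative cgw.
pose I x := P x - P (- r).
have dI (x : R) : is_derive x 1 I (g x * w x).
  by have h := dP x; apply: is_derive_eq; rewrite subr0.
have gw_out x : r <= `|x| -> g x * w x = 0 by move=> /g0 ->; rewrite mul0r.
have Ir : I r = 0.
  have := integral_derivative rr dI cgw; rewrite /I subrr subr0 => /(congr1 fine)/= <-.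
  rewrite integral_mkcond; apply: etrans _ gw0; rewrite /Rintegral.
  congr fine; apply: eq_integral => x _.
  rewrite patchE; case: ifPn => // /negP xr; rewrite gw_out//.
  by apply/ltW; rewrite ltNge; apply/negP => h; apply: xr; rewrite inE/= in_itv/= -ler_norml.
have I_out x : r <= `|x| -> I x = 0.
  have := le_total 0 x => /orP[x0|x0].
    rewrite ger0_norm// => rx; rewrite -Ir.
    apply: mean_value_const dI _ => z; rewrite (min_idPl rx) => /andP[rz _].
    by rewrite gw_out// (le_trans rz)// ler_norm.
  rewrite ler0_norm// => rx; have xr : x <= - r by rewrite lerNr.
  rewrite (_ : 0 = I (- r)); last by rewrite /I subrr.
  apply: mean_value_const dI _ => z; rewrite (max_idPl xr) => /andP[_ zr].
  by rewrite gw_out// -normrN (le_trans _ (ler_norm _))// lerNr.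
have I_in x : `|x| <= r -> `|I x| <= I1.
  move=> xr; have IN : I (- r) = 0 by rewrite /I subrr.
  rewrite -[I x]subr0 -[in leLHS]IN.
  apply: (@le_trans _ _ (A * wM * `|x - - r|)).
    apply: mean_value_bound dI _ => z.
    move: (xr); rewrite ler_norml => /andP[rx xr'].
    rewrite (min_idPl rx) (max_idPr rx) => /andP[rz zx].
    rewrite normrM ler_pM// wwM// ler_norml rz/=; exact: le_trans xr'.
  rewrite ler_wpM2l ?mulr_ge0// opprK (le_trans (ler_normD _ _))//.
  by rewrite (ger0_norm r0); lra.
pose v x := k * I x * (w x)^-1.
have dv (x : R) : is_derive x 1 v (k * (g x - b x * v x)).
  have wn0 : w x != 0 by rewrite gt_eqF.
  have h1 := dI x; have h2 := dw x.
  have h3 : is_derive x 1 (fun x => (w x)^-1) (- (w x) ^- 2 *: (k * b x * w x)).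
    by apply: is_deriveV.
  apply: is_derive_eq; rewrite /v /GRing.scale/=; field.
  by rewrite wn0.
have v_out x : r <= `|x| -> v x = 0 by move=> /I_out; rewrite /v => ->; rewrite mulr0 mul0r.
have v_in x : `|x| <= r -> `|v x| <= V1.
  move=> xr; rewrite /v !normrM (gtr0_norm k_gt0) ler_pM ?mulr_ge0 ?(ltW k_gt0)//.
    by rewrite ler_pM2l// I_in.
  exact: wwV.
have dv_out x : r <= `|x| -> k * (g x - b x * v x) = 0.
  by move=> xr; rewrite g0// v_out// mulr0 subrr mulr0.
have dv_in x : `|x| <= r -> `|k * (g x - b x * v x)| <= V2.
  move=> xr; rewrite normrM (gtr0_norm k_gt0) ler_pM2l//.
  rewrite (le_trans (ler_normB _ _))// lerD// normrM ler_pM ?bM//.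
  exact: v_in.
have v_lip := vanishing_outside_lip V20 dv dv_out dv_in.
have cv := is_derive_continuous dv.
have [u0 du0] := continuous_antiderivative cv.
pose u x := u0 x - u0 0.
have du (x : R) : is_derive x 1 u (v x).
  by have h := du0 x; apply: is_derive_eq; rewrite subr0.
have u_lip := vanishing_outside_lip V10 du v_out v_in.
have bv_lip : lip B2 (fun x => b x * v x).
  have aux x y : `|x| <= r -> `|b x * v x - b y * v y| <= B2 * `|x - y|.
    move=> xr; have [yr|/ltW yr] := leP `|y| r.
      have -> : b x * v x - b y * v y = b x * (v x - v y) + (b x - b y) * v y by ring.
      rewrite (le_trans (ler_normD _ _))// [`|b x * _|]normrM [`|_ * v y|]normrM.
      rewrite mulrDl lerD//; first by rewrite -mulrA ler_pM// bM.
      by rewrite [leRHS]mulrAC; apply: ler_pM => //; [exact: bL|exact: v_in].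
    (* As [v y = 0], the factor [b y], which has no bound outside the support, can be replaced by
       [b x]. *)
    rewrite (v_out y)// mulr0 -(mulr0 (b x)) -(v_out _ yr) -mulrBr normrM.
    apply: (@le_trans _ _ (M * V2 * `|x - y|)).
      by rewrite -mulrA ler_pM// bM.
    by rewrite ler_wpM2r// lerDl mulr_ge0.
  move=> x y; have [xr|/ltW xr] := leP `|x| r; first exact: aux.
  have [yr|/ltW yr] := leP `|y| r; first by rewrite distrC [`|x - y|]distrC aux.
  by rewrite !v_out// !mulr0 subrr normr0 mulr_ge0.
exists u, v; split => //.
  have u_in x : `|x| <= r -> `|u x| <= V1 * r.
    move=> xr; have := u_lip x 0; rewrite {2}/u subrr !subr0 => /le_trans; apply.
    exact: ler_wpM2l.
  have uC : V1 * r <= C by rewrite /C; lra.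
  move=> x; apply: le_trans uC; have [xr|xr] := leP `|x| r; first exact: u_in.
  have [x0|x0] := leP 0 x.
    move: xr; rewrite ger0_norm// => /ltW rx.
    rewrite (_ : u x = u r); first by rewrite u_in// ger0_norm.
    apply: mean_value_const du _ => z; rewrite (min_idPl rx) => /andP[rz _].
    by rewrite v_out// (le_trans rz)// ler_norm.
  move: xr; rewrite ltr0_norm// => /ltW rx; have xr : x <= - r by rewrite lerNr.
  rewrite (_ : u x = u (- r)); first by rewrite u_in// normrN ger0_norm.
  apply: mean_value_const du _ => z; rewrite (max_idPl xr) => /andP[_ zr].
  by rewrite v_out// -normrN (le_trans _ (ler_norm _))// lerNr.
split.
- by apply: lipW u_lip; rewrite /C; lra.
- by apply: lipW v_lip; rewrite /C; lra.
- by apply: lipW bv_lip; rewrite /C; lra.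
- apply: (@lipW _ (`|k| * (A + B2))); last exact/lipZ/lipB.
  by rewrite (gtr0_norm k_gt0) -/C2 /C; lra.
Qed.

End poisson.

(** * One Euler step compared with the generator *)

Section generator.
Context {R : realType}.
Variables (b : R -> R) (s : R).
Hypotheses (cb : continuous b) (nb : forall x y, x <= y -> b y <= b x).
Hypothesis s_gt0 : 0 < s.
Local Notation J := (implicit_step b).
Local Notation K := (euler_kernel b s).
Local Notation gauss := (@normal_prob R 0 1).

(** The mean value bound is applied twice, to the remainder of [v] and then to that of [u]. The
    constant is not sharp; the cubic order is what matters. *)
Lemma taylor2_bound (u v a : R -> R) (C : R) (x y : R) :
  (forall x : R, is_derive x 1 u (v x)) -> (forall x : R, is_derive x 1 v (a x)) ->
  lip C a ->
  `|u (x + y) - u x - v x * y - 2^-1 * a x * y ^+ 2| <= C * `|y| ^+ 3.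
Proof.
move=> du dv aC.
have C0 : 0 <= C.
  by have := le_trans (normr_ge0 _) (aC 1 0); rewrite subr0 normr1 mulr1.
have shift (f df : R -> R) : (forall x : R, is_derive x 1 f (df x)) ->
    forall z : R, is_derive z 1 (fun z => f (x + z)) (df (x + z)).
  move=> fd z; have h := fd (x + z).
  have h2 : is_derive z 1 (fun z => x + z) (1:R).
    by have := is_deriveD (is_derive_cst x z 1) (is_derive_id z 1); rewrite add0r.
  have := @is_derive1_comp R f (fun z => x + z) z (df (x + z)) 1 h h2.
  by rewrite mulr1.
have between (z t : R) : Num.min 0 t <= z <= Num.max 0 t -> `|z| <= `|t|.
  have [t0|t0] := leP 0 t; first by move=> /andP[z0 zt]; rewrite !ger0_norm.
  by move=> /andP[tz z0]; rewrite (ltr0_norm t0) ler0_norm ?lerN2.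
pose psi z := v (x + z) - v x - a x * z.
have dpsi (z : R) : is_derive z 1 psi (a (x + z) - a x).
  have h := shift _ _ dv z; apply: is_derive_eq.
  by rewrite /GRing.scale/=; ring.
have psi_bd z : `|psi z| <= C * `|z| ^+ 2.
  have := @mean_value_bound _ _ _ 0 z (C * `|z|) dpsi.
  rewrite [psi 0]/psi addr0 mulr0 !subrr !subr0 expr2 mulrA; apply => t /between tz.
  by rewrite (le_trans (aC _ _))// addrAC subrr add0r ler_wpM2l.
pose phi z := u (x + z) - u x - v x * z - 2^-1 * a x * z ^+ 2.
have dphi (z : R) : is_derive z 1 phi (psi z).
  have h := shift _ _ du z; apply: is_derive_eq.
  by rewrite /GRing.scale/= /psi; field.
have phi0 : phi 0 = 0 by rewrite /phi addr0 expr0n/= !mulr0 !subrr.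
have : `|phi y - phi 0| <= C * `|y| ^+ 2 * `|y - 0|.
  apply: mean_value_bound dphi _ => t /between ty.
  by rewrite (le_trans (psi_bd _))// ler_wpM2l// lerXn2r ?nnegrE.
by rewrite phi0 !subr0 -mulrA -exprSr.
Qed.

(** The step first adds the noise [e], of size [sqrt h], and then applies the drift implicitly. The
    error splits into the implicit drift step, of order [h^2], the displacement of [b v] by the
    noise, of order [h |e|], and the Taylor remainder [|e|^3]. [D] is uniform in [u], [h] and
    [x]. *)
Lemma generator_estimate (r C : R) : 0 <= r -> 0 <= C ->
  (forall x, r <= x -> b x <= 0) -> (forall x, x <= - r -> 0 <= b x) ->
  exists2 D : R, 0 <= D & forall u v a : R -> R,
    (forall x : R, is_derive x 1 u (v x)) -> (forall x : R, is_derive x 1 v (a x)) ->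
    (forall x, r <= `|x| -> v x = 0) ->
    lip C u -> lip C v -> lip C (fun x => b x * v x) -> lip C a ->
    forall h x, 0 <= h -> h <= 1 ->
    `|K h u x - u x - h * (b x * v x + s ^+ 2 / 2 * a x)| <= D * (h * Num.sqrt h).
Proof.
move=> r0 C0 br bNr.
have [M M0 bM] := continuous_norm_bounded r0 cb.
pose m := \int[gauss]_y (2 * (1 + y ^+ 4)).
have m0 : 0 <= m.
  by apply: Rintegral_ge0 => y _; rewrite mulr_ge0// addr_ge0// exprn_even_ge0.
(* The first two terms come from the drift step, [C s] from evaluating [b v] after the noise,
   [C s^3] from the Taylor remainder. *)
pose E := C * M ^+ 2 + C * M + C * s + C * s ^+ 3.
have s0 := ltW s_gt0.
have E0 : 0 <= E.
  by apply: addr_ge0; [apply: addr_ge0; [apply: addr_ge0|]|]; apply: mulr_ge0 => //; exact: exprn_ge0.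
exists (E * m) => [|u v a du dv v0 uC vC bvC aC h x h0 h1]; first exact: mulr_ge0.
have step y : `|u (J h y) - u y - h * (b y * v y)| <= (C * M ^+ 2 + C * M) * h ^+ 2.
  set z := J h y; have zE : z = y + h * b z by exact: implicit_stepE.
  (* The drift points inward, so a step that ends beyond [r] started even further out on the same
     side. There [v] vanishes and [u] is constant, so the error is zero. This is why a bound for [b]
     on [[-r, r]] suffices. *)
  have out : r < `|z| -> `|u z - u y - h * (b y * v y)| <= 0.
    have [z0|z0] := leP 0 z.
      rewrite ger0_norm// => rz.
      have yz : z <= y by rewrite zE gerDl mulr_ge0_le0// br// ltW.
      rewrite (v0 y) ?mulr0 ?subr0; last by rewrite (le_trans (ltW rz))// (le_trans yz)// ler_norm.
      rewrite -(mul0r `|z - y|); apply: mean_value_bound du _ => t.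
      rewrite (min_idPr yz) => /andP[zt _]; rewrite v0 ?normr0//.
      by rewrite (le_trans (ltW rz))// (le_trans zt)// ler_norm.
    rewrite ltr0_norm// => rz.
    have yz : y <= z by rewrite zE lerDl mulr_ge0// bNr// lerNr ltW.
    have yr : r <= - y by rewrite (le_trans (ltW rz))// lerN2.
    rewrite (v0 y) ?mulr0 ?subr0; last by rewrite -normrN (le_trans yr)// ler_norm.
    rewrite -(mul0r `|z - y|); apply: mean_value_bound du _ => t.
    rewrite (max_idPr yz) => /andP[_ zt]; rewrite v0 ?normr0//.
    by rewrite -normrN (le_trans _ (ler_norm _))// (le_trans (ltW rz))// lerN2.
  have [zr|zr] := leP `|z| r; last first.
    rewrite (le_trans (out zr))// mulr_ge0 ?exprn_ge0//.
    by apply: addr_ge0; apply: mulr_ge0 => //; exact: exprn_ge0.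
  have zyE : z - y = h * b z by rewrite {1}zE addrAC subrr add0r.
  have zy : `|z - y| <= h * M by rewrite zyE normrM (ger0_norm h0) ler_wpM2l// bM.
  (* Linearising [u] at the end point [z] makes the first-order term exact, since
     [z - y = h b z]. *)
  have -> : u z - u y - h * (b y * v y) =
      ((u z - v z * z) - (u y - v z * y)) + h * (b z * v z - b y * v y).
    have -> : h * (b z * v z - b y * v y) = (z - y) * v z - h * (b y * v y).
      by rewrite zyE; ring.
    by ring.
  rewrite (le_trans (ler_normD _ _))// mulrDl lerD//.
    have dq (t : R) : is_derive t 1 (fun t => u t - v z * t) (v t - v z).
      by have q := du t; apply: is_derive_eq; rewrite /GRing.scale/= mulr1.
    apply: (@le_trans _ _ (C * `|z - y| * `|z - y|)).
      apply: mean_value_bound dq _ => t tzy; rewrite (le_trans (vC _ _))// ler_wpM2l//.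
      move: tzy; have [yz|/ltW zy'] := leP y z => /andP[t1 t2].
        by rewrite ler0_norm ?subr_le0// ger0_norm ?subr_ge0//; lra.
      by rewrite ger0_norm ?subr_ge0// ler0_norm ?subr_le0//; lra.
    rewrite (_ : C * M ^+ 2 * h ^+ 2 = C * (h * M) * (h * M)); last by ring.
    by apply: ler_pM => //; [exact: mulr_ge0|exact: ler_wpM2l].
  rewrite normrM (ger0_norm h0) (_ : _ * h ^+ 2 = h * (C * (h * M))); last by ring.
  by rewrite ler_wpM2l// (le_trans (bvC _ _))// ler_wpM2l.
set q := Num.sqrt h; have q0 : 0 <= q by exact: sqrtr_ge0.
have qq : q ^+ 2 = h by rewrite sqr_sqrtr.
have q1 : q <= 1 by rewrite -sqrtr1 ler_sqrt// ltr01.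
(* [p] is quadratic in [y], so the mean 0 and the variance 1 of the Gaussian give its expectation
   exactly. *)
pose p y := (u x + h * (b x * v x)) + v x * s * q * y + 2^-1 * a x * s ^+ 2 * h * y ^+ 2.
have point y : `|u (J h (x + s * q * y)) - p y| <= E * (h * q) * (2 * (1 + y ^+ 4)).
  set e := s * q * y.
  have -> : u (J h (x + e)) - p y =
     (u (J h (x + e)) - u (x + e) - h * (b (x + e) * v (x + e))) +
     h * (b (x + e) * v (x + e) - b x * v x) +
     (u (x + e) - u x - v x * e - 2^-1 * a x * e ^+ 2).
    by rewrite /p /e -qq; ring.
  have T1 := step (x + e).
  have T2 := bvC (x + e) x; rewrite (_ : x + e - x = e) in T2; last by ring.
  have T3 := taylor2_bound x e du dv aC.
  have [y1 _ y3] := quartic_bounds y.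
  have Y1 : 1 <= 2 * (1 + y ^+ 4) by have := @exprn_even_ge0 R 4 y isT; lra.
  have y0 := normr_ge0 y.
  have eE : `|e| = s * q * `|y|.
    by rewrite /e !normrM (gtr0_norm s_gt0) (ger0_norm q0).
  set Y := 2 * (1 + y ^+ 4) in Y1 y1 y3 *.
  have sq0 : 0 <= s * q by exact: mulr_ge0.
  have hq : 0 <= h * q by exact: mulr_ge0.
  rewrite (le_trans (ler_normD _ _))// /E.
  rewrite (_ : _ * (h * q) * Y = (C * M ^+ 2 + C * M) * (h * q * Y) +
     C * s * (h * q * Y) + C * s ^+ 3 * (h * q * Y)); last by ring.
  rewrite lerD//.
    rewrite (le_trans (ler_normD _ _))// lerD//.
      rewrite (le_trans T1)// ler_wpM2l//.
        by apply: addr_ge0; apply: mulr_ge0 => //; exact: exprn_ge0.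
      apply: (@le_trans _ _ (h * q)); last by rewrite ler_peMr.
      by rewrite expr2 ler_wpM2l// -{1}qq expr2 ler_piMl.
    rewrite normrM (ger0_norm h0) (_ : C * s * _ = h * (C * (s * q * Y))); last by ring.
    by rewrite ler_wpM2l// (le_trans T2)// ler_wpM2l// eE ler_wpM2l.
  rewrite (le_trans T3)// eE (_ : C * s ^+ 3 * _ = C * ((s * q) ^+ 3 * Y)).
    by rewrite ler_wpM2l// exprMn ler_wpM2l// exprn_ge0.
  by rewrite -qq; ring.
have i1 : gauss.-integrable setT (EFin \o (fun _ : R => u x + h * (b x * v x))).
  apply: (@gauss_integrable _ _ `|u x + h * (b x * v x)|) => // y.
  by rewrite ler_peMr// lerDl exprn_even_ge0.
have i2 : gauss.-integrable setT (EFin \o (fun y : R => v x * s * q * y)).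
  apply: (@gauss_integrable _ _ (`|v x * s * q| * 2)) => [|y].
    exact: measurable_funM.
  by rewrite normrM -[leRHS]mulrA ler_wpM2l//; have [] := quartic_bounds y.
have i3 : gauss.-integrable setT (EFin \o (fun y : R => 2^-1 * a x * s ^+ 2 * h * y ^+ 2)).
  apply: (@gauss_integrable _ _ (`|2^-1 * a x * s ^+ 2 * h| * 1)) => [|y].
    by apply: measurable_funM => //; exact: measurable_funX.
  rewrite normrM -[leRHS]mulrA ler_wpM2l// ger0_norm ?sqr_ge0//.
  by have [] := quartic_bounds y.
have j2 : gauss.-integrable setT (EFin \o (fun y : R => y)).
  by apply: (@gauss_integrable _ _ 2) => // y; have [] := quartic_bounds y.
have j3 : gauss.-integrable setT (EFin \o (fun y : R => y ^+ 2)).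
  apply: (@gauss_integrable _ _ 1) => // y; rewrite ger0_norm ?sqr_ge0//.
  by have [] := quartic_bounds y.
have i12 : gauss.-integrable setT
    (EFin \o (fun y : R => u x + h * (b x * v x) + v x * s * q * y)).
  exact: (integrableD measurableT i1 i2).
have ip : gauss.-integrable setT (EFin \o p) by exact: (integrableD measurableT i12 i3).
have gT : fine (gauss setT) = 1 by have /(congr1 fine) := @probability_setT _ _ R gauss.
have pE : \int[gauss]_y p y = u x + h * (b x * v x + s ^+ 2 / 2 * a x).
  rewrite /p RintegralD// RintegralD// !RintegralZl// Rintegral_cst// gT.
  by rewrite gauss_mean gauss_variance; ring.
have iu := euler_integrable cb nb s h0 x uC.
rewrite (_ : _ - _ = K h u x - \int[gauss]_y p y); last by rewrite pE; ring.
rewrite /euler_kernel -RintegralB//.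
have iB : gauss.-integrable setT (EFin \o (fun y : R => u (J h (x + s * q * y)) - p y)).
  exact: (integrableB measurableT iu ip).
apply: le_trans (le_normr_Rintegral measurableT iB) _.
have i4 : gauss.-integrable setT (EFin \o (fun y : R => 2 * (1 + y ^+ 4))).
  apply: (@gauss_integrable _ _ 2) => [|y].
    by apply: measurable_funM => //; apply: measurable_funD => //; exact: measurable_funX.
  by rewrite ger0_norm// mulr_ge0// addr_ge0// exprn_even_ge0.
rewrite (_ : E * m * _ = E * (h * q) * m); last by ring.
rewrite -RintegralZl//; apply: le_Rintegral => //.
- exact: integrable_norm.
- exact: (integrableZl measurableT (E * (h * q)) i4).
Qed.

End generator.

(** * Approximate invariance of the weight under the kernel *)

Section cutoff.
Context {R : realType}.
Implicit Types (r x : R).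

(** A Lipschitz substitute for the indicator of a ball, with plateau of height 1 up to [r - 1]; the
    chain estimates apply only to Lipschitz functions. *)
Definition cutoff r x : R := Num.max 0 (Num.min 1 (r - `|x|)).

Lemma cutoff_ge0 r x : 0 <= cutoff r x.
Proof. by rewrite /cutoff le_max lexx. Qed.

Lemma cutoff_le1 r x : cutoff r x <= 1.
Proof. by rewrite /cutoff ge_max ler01 ge_min lexx. Qed.

Lemma norm_cutoff r x : `|cutoff r x| <= 1.
Proof. by rewrite ger0_norm ?cutoff_ge0 ?cutoff_le1. Qed.

Lemma cutoff_eq0 r x : r <= `|x| -> cutoff r x = 0.
Proof.
move=> rx; apply/eqP; rewrite eq_le cutoff_ge0 andbT /cutoff ge_max lexx/=.
by rewrite ge_min subr_le0 rx orbT.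
Qed.

Lemma cutoff_eq1 r x : `|x| <= r - 1 -> cutoff r x = 1.
Proof.
move=> rx; apply/eqP; rewrite eq_le cutoff_le1/= /cutoff le_max le_min lexx/=.
by apply/orP; right; lra.
Qed.

Lemma cutoff_lip r : lip 1 (cutoff r).
Proof.
move=> x y; rewrite mul1r; have := ler_dist_dist x y.
have d (p q : R) : `|Num.max 0 (Num.min 1 (r - p)) - Num.max 0 (Num.min 1 (r - q))| <= `|p - q|.
  have := ler_norm (p - q); have := ler_norm (q - p); rewrite (distrC q p) => h1 h2.
  have h0 := normr_ge0 (p - q).
  case: (leP 1 (r - p)) => hp; case: (leP 1 (r - q)) => hq;
    rewrite ?(max_idPr ler01); try (case: (leP 0 (r - p)) => ?);
    try (case: (leP 0 (r - q)) => ?); rewrite ler_norml; lra.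
exact/le_trans/d.
Qed.

Lemma cvg_cutoff (r_ : nat -> R) x : r_ n @[n --> \oo] --> +oo ->
  cutoff (r_ n) x @[n --> \oo] --> (1 : R).
Proof.
move=> /cvgryPge rn; apply: cvg_near_cst.
by apply: filterS (rn (`|x| + 1)) => n h; apply: cutoff_eq1; rewrite lerBrDr.
Qed.

End cutoff.

Section kernel_iterates.
Context {R : realType}.
Variables (b : R -> R) (s h : R).
Hypotheses (cb : continuous b) (nb : forall x y, x <= y -> b y <= b x).
Hypothesis h_ge0 : 0 <= h.
Local Notation K := (euler_kernel b s h).
Implicit Types (f g : R -> R) (n : nat).

Lemma iter_kernel_lip L g n : lip L g -> lip L (iter n K g).
Proof. by move=> gL; elim: n => //= n; exact: euler_kernel_lip. Qed.

Lemma iter_kernel_cst c n : iter n K (fun=> c) = fun=> c.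
Proof. by elim: n => //= n ->; exact: euler_kernel_cst. Qed.

Lemma iter_kernelD L M f g n : lip L f -> lip M g ->
  iter n K (fun x => f x + g x) = fun x => iter n K f x + iter n K g x.
Proof.
move=> fL gM; elim: n => //= n ->.
by rewrite (euler_kernelD cb nb s h_ge0 (iter_kernel_lip n fL) (iter_kernel_lip n gM)).
Qed.

Lemma iter_kernelB L M f g n : lip L f -> lip M g ->
  iter n K (fun x => f x - g x) = fun x => iter n K f x - iter n K g x.
Proof.
move=> fL gM; elim: n => //= n ->.
by rewrite (euler_kernelB cb nb s h_ge0 (iter_kernel_lip n fL) (iter_kernel_lip n gM)).
Qed.

Lemma iter_kernelZ L c f n : lip L f ->
  iter n K (fun x => c * f x) = fun x => c * iter n K f x.
Proof.
move=> fL; elim: n => //= n ->.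
by rewrite (euler_kernelZ cb nb s h_ge0 c (iter_kernel_lip n fL)).
Qed.

Lemma le_iter_kernel L M f g n x : lip L f -> lip M g ->
  (forall x, f x <= g x) -> iter n K f x <= iter n K g x.
Proof.
move=> fL gM fg; elim: n x => //= n IHn x.
exact: (le_euler_kernel cb nb s h_ge0 x (iter_kernel_lip n fL) (iter_kernel_lip n gM)).
Qed.

Lemma iter_kernel_ge0 L f n x : lip L f -> (forall x, 0 <= f x) -> 0 <= iter n K f x.
Proof.
by move=> fL f0; have := le_iter_kernel n x (lip_cst 0) fL f0; rewrite iter_kernel_cst.
Qed.

Lemma norm_iter_kernel L f A n x : lip L f -> (forall x, `|f x| <= A) ->
  `|iter n K f x| <= A.
Proof.
move=> fL fA; rewrite ler_norml.
have h1 := @le_iter_kernel 0 L (fun=> - A) f n x (lip_cst _) fL.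
have h2 := @le_iter_kernel L 0 f (fun=> A) n x fL (lip_cst _).
rewrite iter_kernel_cst in h1; rewrite iter_kernel_cst in h2.
by rewrite h1 ?h2// => y; have := fA y; rewrite ler_norml => /andP[].
Qed.

End kernel_iterates.

(** * A Lyapunov function and the time spent near the origin *)

Section lyapunov.
Context {R : realType}.
Variables (b : R -> R) (s : R).
Hypotheses (cb : continuous b) (nb : forall x y, x <= y -> b y <= b x).
Hypothesis s_gt0 : 0 < s.
Variables (a r : R).
Hypotheses (a_gt0 : 0 < a) (r_ge0 : 0 <= r).
Hypotheses (br : forall x, r <= x -> b x <= - a) (bNr : forall x, x <= - r -> a <= b x).
Local Notation J := (implicit_step b).
Local Notation K := (euler_kernel b s).
Local Notation gauss := (@normal_prob R 0 1).

(** [V] below is a smoothed absolute value. Unlike [x^2] it is globally Lipschitz, as the kernel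
    calculus requires. Where [|x| >= m] its slope has modulus at least 1/2, so far out the drift
    lowers [V] by at least [h a / 2]. The noise raises it by at most [h s^2 / (2 m)], and the choice
    of [m] makes this [h a / 4], half of the gain. *)
Let m := 2 * s ^+ 2 / a.
Let m_gt0 : 0 < m. Proof. by rewrite divr_gt0// mulr_gt0// exprn_gt0. Qed.
Let V x := Num.sqrt (m ^+ 2 + x ^+ 2).
Let VE x : V x ^+ 2 = m ^+ 2 + x ^+ 2.
Proof. by rewrite sqr_sqrtr// addr_ge0 ?sqr_ge0. Qed.
Let V_ge x : m <= V x.
Proof.
rewrite -(@ler_pXn2r _ 2)// ?nnegrE ?sqrtr_ge0 ?(ltW m_gt0)//.
by rewrite VE lerDl sqr_ge0.
Qed.
Let V_gt0 x : 0 < V x. Proof. exact: lt_le_trans (V_ge x). Qed.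
Let V_norm x : `|x| <= V x.
Proof.
rewrite -(@ler_pXn2r _ 2)// ?nnegrE ?sqrtr_ge0//.
by rewrite VE real_normK ?num_real// lerDr sqr_ge0.
Qed.

(** Convexity, with the tangent taken at the end point [z]: this suits the implicit step, where
    [z - y = h b z]. After multiplication by [V z] it is the Cauchy-Schwarz inequality for [(m, z)]
    and [(m, y)]. *)
Let V_convex z y : V z <= V y + z / V z * (z - y).
Proof.
have Vz := V_gt0 z; have Vy := V_gt0 y.
rewrite -(ler_pM2l Vz) mulrDr (_ : V z * (z / V z * (z - y)) = z * (z - y)); last first.
  by field; rewrite gt_eqF.
rewrite -expr2 VE; suff : m ^+ 2 + z * y <= V z * V y by lra.
rewrite (le_trans (ler_norm _))// -(@ler_pXn2r _ 2)// ?nnegrE ?mulr_ge0 ?(ltW Vz) ?(ltW Vy)//.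
have -> : (V z * V y) ^+ 2 = (m ^+ 2 + z ^+ 2) * (m ^+ 2 + y ^+ 2) by rewrite exprMn !VE.
rewrite real_normK ?num_real//; have := sqr_ge0 (m * (z - y)); lra.
Qed.

Let V_lip : lip 1 V.
Proof.
have aux x y : V x - V y <= `|x - y|.
  rewrite lerBlDl (le_trans (V_convex x y))// lerD2l (le_trans (ler_norm _))//.
  rewrite normrM ler_piMl// normrM normfV (gtr0_norm (V_gt0 x)).
  by rewrite ler_pdivrMr// mul1r V_norm.
by move=> x y; rewrite mul1r ler_norml aux andbT lerNl opprB distrC aux.
Qed.

(** After multiplication by [2 V x] this is [2 V x V (x + y) <= V x^2 + V (x + y)^2]; [V >= m] then
    removes the dependence on [x] in the quadratic term. *)
Let V_taylor x y : V (x + y) <= V x + x / V x * y + (2 * m)^-1 * y ^+ 2.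
Proof.
have Vx := V_gt0 x; have Vxy := V_gt0 (x + y).
apply: (@le_trans _ _ (V x + x / V x * y + (2 * V x)^-1 * y ^+ 2)); last first.
  rewrite lerD2l ler_wpM2r ?sqr_ge0//.
  have := V_ge x; rewrite -(ler_pM2l (ltr0Sn R 1)) => mV.
  by rewrite lef_pV2// posrE mulr_gt0.
have V2 : 0 < 2 * V x by rewrite mulr_gt0.
rewrite -(ler_pM2l V2).
rewrite (_ : _ * (_ + _) = 2 * V x ^+ 2 + 2 * x * y + y ^+ 2); last first.
  by field; rewrite gt_eqF.
have E1 := VE (x + y); have E2 := VE x; have := sqr_ge0 (V (x + y) - V x); nra.
Qed.

Let r1 := Num.max r m.
(** Within [r1] monotonicity gives [b z * z <= b 0 * z], so the drift raises [V] at a rate of at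
    most [|b 0|]; the [a / 2] compensates the decrease that is claimed everywhere. *)
Let C := `|b 0| + a / 2.

Let drift_bound z : b z * (z / V z) <= - (a / 2) + C * cutoff (r1 + 1) z.
Proof.
have Vz := V_gt0 z; have [zr|zr] := leP `|z| r1.
  rewrite cutoff_eq1 ?addrK// mulr1 (_ : - (a / 2) + C = `|b 0|); last by rewrite /C; ring.
  rewrite mulrA ler_pdivrMr//.
  apply: (@le_trans _ _ (`|b 0| * `|z|)); last by rewrite ler_wpM2l.
  apply: (@le_trans _ _ (b 0 * z)); last by rewrite -normrM ler_norm.
  by have := nonincreasing_mul_le0 nb z 0; rewrite subr0; lra.
have C0 : 0 <= C by rewrite addr_ge0// divr_ge0// ltW.
apply: (@le_trans _ _ (- (a / 2))); last by rewrite lerDl mulr_ge0 ?cutoff_ge0.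
have zr' : r <= `|z| by rewrite (le_trans _ (ltW zr))// le_max lexx.
have zm : m <= `|z| by rewrite (le_trans _ (ltW zr))// le_max lexx orbT.
have bz : b z * z <= - a * `|z|.
  have [z0|z0] := leP 0 z.
    by move: zr'; rewrite ger0_norm// => zr'; rewrite ler_wpM2r// br.
  move: zr'; rewrite ltr0_norm// => zr'; rewrite mulrNN.
  by apply: ler_wnM2r; [exact: ltW|rewrite bNr// lerNr].
have Vz2 : V z <= 2 * `|z|.
  rewrite -(@ler_pXn2r _ 2)// ?nnegrE ?mulr_ge0 ?(ltW Vz)//.
  have zz : `|z| ^+ 2 = z ^+ 2 by rewrite real_normK ?num_real.
  have mz : m ^+ 2 <= z ^+ 2 by rewrite -zz ler_pXn2r ?nnegrE ?(ltW m_gt0).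
  by rewrite VE (_ : (2 * `|z|) ^+ 2 = 4 * z ^+ 2); [have := sqr_ge0 z; lra|rewrite -zz; ring].
rewrite mulrA ler_pdivrMr//; apply: le_trans bz _.
have := a_gt0; nra.
Qed.

Let step (y h : R) : 0 <= h ->
  V (J h y) <= V y + h * (- (a / 2) + C * cutoff (r1 + 1) (J h y)).
Proof.
move=> h0; set z := J h y; have zE : z = y + h * b z by exact: implicit_stepE.
have := V_convex z y; rewrite (_ : z - y = h * b z); last by rewrite {1}zE; ring.
by move=> /le_trans; apply; rewrite lerD2l mulrCA ler_wpM2l// mulrC drift_bound.
Qed.

Let kernelV h x : 0 <= h ->
  K h V x <= V x - h * (a / 4) + h * C * K h (cutoff (r1 + 1)) x.
Proof.
move=> h0; set q := Num.sqrt h.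
have qq : q ^+ 2 = h by rewrite sqr_sqrtr.
pose p y := V x - h * (a / 2) + x / V x * s * q * y + (2 * m)^-1 * s ^+ 2 * h * y ^+ 2.
have i1 : gauss.-integrable setT (EFin \o (fun _ : R => V x - h * (a / 2))).
  apply: (@gauss_integrable _ _ `|V x - h * (a / 2)|) => // y.
  by rewrite ler_peMr// lerDl exprn_even_ge0.
have j2 : gauss.-integrable setT (EFin \o (fun y : R => y)).
  by apply: (@gauss_integrable _ _ 2) => // y; have [] := quartic_bounds y.
have j3 : gauss.-integrable setT (EFin \o (fun y : R => y ^+ 2)).
  apply: (@gauss_integrable _ _ 1) => // y; rewrite ger0_norm ?sqr_ge0//.
  by have [] := quartic_bounds y.
have i2 : gauss.-integrable setT (EFin \o (fun y : R => x / V x * s * q * y)).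
  exact: (integrableZl measurableT (x / V x * s * q) j2).
have i3 : gauss.-integrable setT (EFin \o (fun y : R => (2 * m)^-1 * s ^+ 2 * h * y ^+ 2)).
  exact: (integrableZl measurableT ((2 * m)^-1 * s ^+ 2 * h) j3).
have i12 : gauss.-integrable setT
    (EFin \o (fun y : R => V x - h * (a / 2) + x / V x * s * q * y)).
  exact: (integrableD measurableT i1 i2).
have ip : gauss.-integrable setT (EFin \o p) by exact: (integrableD measurableT i12 i3).
have gT : fine (gauss setT) = 1 by have /(congr1 fine) := @probability_setT _ _ R gauss.
have pE : \int[gauss]_y p y = V x - h * (a / 4).
  rewrite /p RintegralD// RintegralD// !RintegralZl// Rintegral_cst// gT.
  rewrite gauss_mean gauss_variance /m; field.
  by rewrite !gt_eqF.
have iV := euler_integrable cb nb s h0 x V_lip.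
have ic := euler_integrable cb nb s h0 x (@cutoff_lip _ (r1 + 1)).
have iC : gauss.-integrable setT (EFin \o (fun y : R =>
    h * C * cutoff (r1 + 1) (J h (x + s * q * y)))).
  exact: (integrableZl measurableT (h * C) ic).
rewrite -pE -RintegralZl// -RintegralD//; apply: le_Rintegral => //.
  exact: (integrableD measurableT ip iC).
move=> y _; rewrite -/q; set e := s * q * y.
apply: le_trans (step (x + e) h0) _.
have := V_taylor x e; rewrite /p.
rewrite (_ : (2 * m)^-1 * s ^+ 2 * h * y ^+ 2 = (2 * m)^-1 * e ^+ 2).
  by rewrite (_ : x / V x * s * q * y = x / V x * e); [lra|rewrite /e; ring].
by rewrite /e -qq; ring.
Qed.

(** Iterating [kernelV] from 0, [V >= 0] forces [h C] times the sum to be at least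
    [n h a / 4 - V 0]. Once [n] is so large that [V 0 <= n h a / 8], half of the main term remains,
    whence [theta = a / (8 C)]. Only [n0] depends on [h]; the uniformity of [theta] keeps the later
    error of order [sqrt h]. *)
Lemma kernel_occupation : exists (r' theta : R), [/\ 1 <= r', 0 < theta &
  forall h, 0 < h -> exists n0, forall n, (n0 <= n)%N ->
    theta * n%:R <= \sum_(k < n) iter k.+1 (K h) (cutoff r') 0].
Proof.
have C_gt0 : 0 < C by rewrite ltr_wpDl// divr_gt0.
exists (r1 + 1), (a / (8 * C)); split.
- by rewrite lerDr le_max r_ge0.
- by rewrite divr_gt0// mulr_gt0.
move=> h h_gt0; have h0 := ltW h_gt0.
have V0lip := V_lip; have clip := @cutoff_lip _ (r1 + 1).
have iterV n : iter n (K h) V 0 <= V 0 - n%:R * (h * (a / 4)) +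
    h * C * \sum_(k < n) iter k.+1 (K h) (cutoff (r1 + 1)) 0.
  elim: n => [|n IHn]; first by rewrite big_ord0 mulr0 addr0 mul0r subr0.
  have l1 := lip_cst (- (h * (a / 4))).
  have lK := euler_kernel_lip cb nb s h0 clip.
  have l2 := lipD V_lip l1; have l3 := lipZ (h * C) lK.
  have := @le_iter_kernel _ _ s _ cb nb h0 _ _ _ _ n 0
    (euler_kernel_lip cb nb s h0 V_lip) (lipD l2 l3) (fun x => kernelV x h0).
  rewrite (iter_kernelD s cb nb h0 n l2 l3) (iter_kernelD s cb nb h0 n V_lip l1).
  rewrite iter_kernel_cst// (iter_kernelZ s cb nb h0 (h * C) n lK) -!iterSr.
  move=> /le_trans; apply; move: IHn; rewrite big_ord_recr -natr1 /=.
  by lra.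
exists (Num.truncn (8 * V 0 / (a * h))).+1 => n n0n.
have V0n : 8 * V 0 / (a * h) <= n%:R.
  by rewrite (le_trans (ltW (truncnS_gt _)))// ler_nat.
have Vn : 0 <= iter n (K h) V 0.
  by apply: (iter_kernel_ge0 s cb nb h0 n 0 V_lip) => x; exact: sqrtr_ge0.
have := le_trans Vn (iterV n); set S := \sum_(k < n) _ => hS.
move: V0n; rewrite ler_pdivrMr ?mulr_gt0// => V0n.
have hC : 0 < h * C by rewrite mulr_gt0.
rewrite -(ler_pM2l hC) (_ : h * C * _ = h * a / 8 * n%:R); last first.
  by field; rewrite gt_eqF.
by move: hS V0n; rewrite (mulrC n%:R (a * h)); lra.
Qed.

End lyapunov.

(** * The weight is almost excessive for the kernel *)

Section invariance.
Context {R : realType}.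
Local Notation leb := (@lebesgue_measure R).
Variables (b w : R -> R) (s a r : R).
Hypotheses (cb : continuous b) (nb : forall x y, x <= y -> b y <= b x).
Hypothesis b_lip : forall r, exists2 L : R, 0 <= L & forall x y,
  `|x| <= r -> `|y| <= r -> `|b x - b y| <= L * `|x - y|.
Hypothesis s_gt0 : 0 < s.
Hypotheses (a_gt0 : 0 < a) (r_ge0 : 0 <= r).
Hypotheses (br : forall x, r <= x -> b x <= - a) (bNr : forall x, x <= - r -> a <= b x).
Hypothesis w_gt0 : forall x, 0 < w x.
Hypothesis dw : forall x : R, is_derive x 1 w (2 / s ^+ 2 * b x * w x).
Hypothesis iw : leb.-integrable setT (EFin \o w).
Local Notation K := (euler_kernel b s).

Let cw : continuous w. Proof. exact: is_derive_continuous dw. Qed.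
Let mw : measurable_fun setT w. Proof. exact: continuous_measurable_fun. Qed.

Lemma bounded_mul_integrable (g : R -> R) (A : R) : measurable_fun setT g ->
  (forall x, `|g x| <= A) -> leb.-integrable setT (EFin \o (fun x => g x * w x)).
Proof.
move=> mg gA; apply: (@le_integrable _ _ _ leb setT measurableT _
  (EFin \o (fun x => A * w x))).
- by apply/measurable_EFinP; exact: measurable_funM.
- move=> x _; rewrite /= lee_fin !normrM ler_wpM2r//.
  by rewrite (le_trans (gA x))// ler_norm.
- exact: (integrableZl measurableT A iw).
Qed.

Lemma cutoff_weight_gt0 r0 : 1 <= r0 -> 0 < \int[leb]_x (cutoff r0 x * w x).
Proof.
(* On [[0, 1/2]] the cutoff is at least 1/2 and [w] is at least [M^-1], where [M] bounds the
   continuous function [1 / w] on the unit ball. *)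
move=> r01; pose I : set R := `[(0:R), 2^-1]%classic.
have cwV : continuous (fun x => (w x)^-1).
  by move=> x; apply: cvgV; [rewrite gt_eqF|exact: cw].
have [M M0 wM] := continuous_norm_bounded (@ler01 R) cwV.
have M_gt0 : 0 < M.
  by apply: lt_le_trans (wM 0 _); rewrite ?normr0// normr_gt0 invr_neq0// gt_eqF.
have h2 : (0 : R) < 2^-1 by rewrite invr_gt0.
have muI : leb I = (2^-1)%:E by rewrite lebesgue_measure_itv/= lte_fin h2 oppr0 adde0.
have mI : measurable I by exact: measurable_itv.
have iI : leb.-integrable setT (EFin \o (\1_I : R -> R)).
  exact: integrable_indic_itv.
apply: (@lt_le_trans _ _ (\int[leb]_x (M^-1 / 2 * \1_I x))).
  rewrite RintegralZl//.
  rewrite mulr_gt0 ?divr_gt0 ?invr_gt0// /Rintegral integral_indic// setIT.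
  by have /(congr1 fine)/= -> := muI.
apply: le_Rintegral => //.
- exact: (integrableZl measurableT (M^-1 / 2) iI).
- apply: (@bounded_mul_integrable _ 1) => [|x]; last exact: norm_cutoff.
  exact: lip_measurable (@cutoff_lip _ _).
- move=> x _; rewrite indicE; have [|_] := boolP (x \in _); last first.
    by rewrite mulr0 mulr_ge0 ?cutoff_ge0// ltW.
  rewrite inE /I/= in_itv/= => /andP[x0 x2]; rewrite mulr1 mulrC.
  have xn : `|x| = x by rewrite ger0_norm.
  apply: ler_pM; rewrite ?invr_ge0//.
    rewrite /cutoff le_max le_min xn; apply/orP; right; apply/andP.
    have half : (2^-1 : R) + 2^-1 = 1 by field.
    by split; lra.
  have x1 : `|x| <= 1 by rewrite xn (le_trans x2)// invf_le1 ?ler1n.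
  have := wM x x1; rewrite gtr0_norm ?invr_gt0// => wxM.
  by rewrite -[leRHS]invrK lef_pV2// posrE ?invr_gt0.
Qed.

(* [u] solves [s^2/2 u'' + b u' = g]. *)
Lemma poisson_kernel (r0 A : R) : r <= r0 -> 0 <= A ->
  exists2 D : R, 0 <= D & forall g, lip A g -> (forall x, `|g x| <= A) ->
    (forall x, r0 <= `|x| -> g x = 0) -> \int[leb]_x (g x * w x) = 0 ->
  exists u : R -> R, [/\ forall x, `|u x| <= D, lip D u &
    forall h x, 0 <= h -> h <= 1 ->
      `|K h u x - u x - h * g x| <= D * (h * Num.sqrt h)].
Proof.
move=> rr0 A0; have r00 := le_trans r_ge0 rr0.
have k0 : 0 < 2 / s ^+ 2 by rewrite divr_gt0// exprn_gt0.
have [C C0 PC] := poisson_solution k0 cb b_lip w_gt0 dw r00 A0.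
have b1 x : r0 <= x -> b x <= 0.
  by move=> /(le_trans rr0) /br/le_trans; apply; rewrite oppr_le0 ltW.
have b2 x : x <= - r0 -> 0 <= b x.
  by move=> xr; rewrite (le_trans (ltW a_gt0))// bNr// (le_trans xr)// lerN2.
have [D D0 GD] := generator_estimate cb nb s_gt0 r00 C0 b1 b2.
exists (C + D) => [|g gA gbd g0 gw]; first exact: addr_ge0.
have [u [v [du dv v0 uC [uL vL bvL aL]]]] := PC g gA gbd g0 gw.
exists u; split.
- by move=> x; rewrite (le_trans (uC x))// lerDl.
- by apply: lipW uL; rewrite lerDl.
move=> h x h0 h1; have := GD u v _ du dv v0 uL vL bvL aL h x h0 h1.
rewrite (_ : _ + s ^+ 2 / 2 * _ = g x); last by field; rewrite gt_eqF.
by move=> /le_trans; apply; rewrite ler_wpM2r ?lerDr// mulr_ge0// sqrtr_ge0.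
Qed.

(** Applying the iterates to [K u - u = h g + O(h^{3/2})] and summing telescopes the left side; the
    two boundary terms cost [2 D] whatever [n] is. The sum starts at the first iterate to match
    [kernel_occupation]. *)
Lemma kernel_average_bound (u g : R -> R) (D A h x : R) n : 0 <= h ->
  lip D u -> (forall x, `|u x| <= D) -> lip A g ->
  (forall x, `|K h u x - u x - h * g x| <= D * (h * Num.sqrt h)) ->
  `|h * \sum_(k < n) iter k.+1 (K h) g x| <= 2 * D + n%:R * (D * (h * Num.sqrt h)).
Proof.
move=> h0 uD uD0 gA hK; set e := D * (h * Num.sqrt h).
have KuL := euler_kernel_lip cb nb s h0 uD.
have step k : `|iter k.+2 (K h) u x - iter k.+1 (K h) u x - h * iter k.+1 (K h) g x| <= e.
  have ZE : iter k.+1 (K h) (fun x => h * g x) x = h * iter k.+1 (K h) g x.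
    by rewrite (iter_kernelZ s cb nb h0 h k.+1 gA).
  rewrite -ZE (iterSr k.+1).
  have L1 := lipB KuL uD; have L2 := lipB L1 (lipZ h gA).
  have := @norm_iter_kernel _ b s h cb nb h0 _ _ e k.+1 x L2 hK.
  by rewrite (iter_kernelB s cb nb h0 k.+1 L1 (lipZ h gA)) (iter_kernelB s cb nb h0 k.+1 KuL uD).
have main : `|iter n.+1 (K h) u x - iter 1 (K h) u x - h * \sum_(k < n) iter k.+1 (K h) g x|
    <= n%:R * e.
  elim: n => [|n IHn]; first by rewrite big_ord0 subrr mulr0 subr0 normr0 mul0r.
  rewrite big_ord_recr -natr1 mulrDl mul1r.
  apply: le_trans (lerD IHn (step n)); apply: le_trans (ler_normD _ _).
  by rewrite le_eqVlt; apply/orP; left; apply/eqP; congr `|_|; rewrite mulrDr; ring.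
have un k := @norm_iter_kernel _ b s h cb nb h0 _ _ D k x uD uD0.
have := un n.+1; have := un 1%N; move: main.
rewrite !ler_norml => /andP[m1 m2] /andP[p1 p2] /andP[q1 q2].
by apply/andP; split; lra.
Qed.

(** Let [beta] be a cutoff, and let [G = f - cutoff * K^n f - c * beta] with [c] chosen so that
    [G w] has integral zero; the claim is that [c] is at least of order [- sqrt h]. Along the chain
    started at 0 the time averages of [G] are [O(sqrt h)]. Those of [f - K^n f] vanish in the limit,
    and cutting off [K^n f >= 0] can only raise the difference. So [c] times the average of [beta]
    is bounded below by [- O(sqrt h)], and the occupation bound allows division by that average. *)
Lemma kernel_almost_invariant (f : R -> R) (A r0 : R) : 0 <= A -> lip A f ->
  (forall x, 0 <= f x <= A) -> (forall x, r0 <= `|x| -> f x = 0) ->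
  forall rho, exists2 C : R, 0 <= C & forall h n, 0 < h -> h <= 1 ->
    \int[leb]_x (cutoff rho x * iter n (K h) f x * w x) <=
    \int[leb]_x (f x * w x) + C * Num.sqrt h.
Proof.
move=> A0 fA f0A fr0 rho.
have [r' [theta [r'1 theta0 occ]]] := kernel_occupation cb nb s_gt0 a_gt0 r_ge0 br bNr.
pose beta := cutoff r'.
have mlip L g : lip L g -> measurable_fun setT g by exact: lip_measurable.
have blip : lip 1 beta by exact: cutoff_lip.
have normf x : `|f x| <= A by have /andP[p q] := f0A x; rewrite ger0_norm.
have ib : leb.-integrable setT (EFin \o (fun x => beta x * w x)).
  by apply: (@bounded_mul_integrable _ 1) => [|x]; [exact: mlip blip|exact: norm_cutoff].
pose B := \int[leb]_x (beta x * w x).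
have B0 : 0 < B by exact: cutoff_weight_gt0.
pose W := \int[leb]_x (w x).
have W0 : 0 <= W by apply: Rintegral_ge0 => x _; exact: ltW.
(* An a priori bound for [|c|], uniform in [h] and [n]. It lets the Poisson constant [D] be fixed
   before [h] and [n], so that the final [C] does not depend on them. *)
pose cbar := 2 * A * W / B.
have cbar0 : 0 <= cbar by rewrite divr_ge0// ?mulr_ge0// ltW.
pose R1 := Num.max r (Num.max r0 (Num.max rho r')).
have rR1 : r <= R1 by rewrite le_max lexx.
have r0R1 : r0 <= R1 by rewrite !le_max lexx orbT.
have rhoR1 : rho <= R1 by rewrite !le_max lexx !orbT.
have r'R1 : r' <= R1 by rewrite !le_max lexx !orbT.
pose A1 := A + (1 * A + 1 * A) + cbar * 1.
have A10 : 0 <= A1 by rewrite /A1 !mul1r mulr1; lra.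
have [D D0 PK] := poisson_kernel rR1 A10.
exists (D / theta * B) => [|h n h0 h1]; first by rewrite mulr_ge0 ?divr_ge0// ltW.
pose g1 := iter n (K h) f; pose g2 x := cutoff rho x * g1 x.
have g1A : lip A g1 by exact: (iter_kernel_lip s cb nb (ltW h0) n fA).
have g1bd x : `|g1 x| <= A by exact: (norm_iter_kernel s cb nb (ltW h0) n x fA normf).
have g1_ge0 x : 0 <= g1 x.
  by apply: (iter_kernel_ge0 s cb nb (ltW h0) n x fA) => y; have /andP[] := f0A y.
have g2A : lip (1 * A + 1 * A) g2.
  exact: (lipM (@cutoff_lip _ rho) g1A (@norm_cutoff _ rho) g1bd).
have g2le x : g2 x <= g1 x by rewrite ler_piMl// cutoff_le1.
have g2_ge0 x : 0 <= g2 x by rewrite mulr_ge0// cutoff_ge0.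
have g2bd x : `|g2 x| <= A.
  by rewrite ger0_norm// (le_trans (g2le x))// (le_trans (ler_norm _)).
have ifw : leb.-integrable setT (EFin \o (fun x => f x * w x)).
  by apply: (@bounded_mul_integrable f A) => //; exact: mlip fA.
have ig2 : leb.-integrable setT (EFin \o (fun x => g2 x * w x)).
  by apply: (@bounded_mul_integrable g2 A) => //; exact: mlip g2A.
have fg2A := lipB fA g2A.
have fg2bd x : `|f x - g2 x| <= 2 * A.
  by rewrite (le_trans (ler_normB _ _))// (le_trans (lerD (normf x) (g2bd x)))//; lra.
have ifg : leb.-integrable setT (EFin \o (fun x => (f x - g2 x) * w x)).
  by apply: (@bounded_mul_integrable _ (2 * A) _ fg2bd); exact: mlip fg2A.
pose X := \int[leb]_x ((f x - g2 x) * w x).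
have XE : X = \int[leb]_x (f x * w x) - \int[leb]_x (g2 x * w x).
  rewrite -RintegralB//; apply: eq_Rintegral => x _; exact: mulrBl.
have Xbd : `|X| <= 2 * A * W.
  rewrite (le_trans (le_normr_Rintegral measurableT ifg))// -RintegralZl//.
  apply: le_Rintegral => //.
  - exact: integrable_norm.
  - exact: (integrableZl measurableT (2 * A) iw).
  - by move=> x _; rewrite normrM (gtr0_norm (w_gt0 x)) ler_wpM2r// ltW.
pose c := X / B.
have cB : c * B = X by rewrite divfK// gt_eqF.
have cbd : `|c| <= cbar.
  by rewrite normrM normfV (gtr0_norm B0) ler_pM2r ?invr_gt0.
pose G x := f x - g2 x - c * beta x.
have clip := lipZ c blip.
have GA : lip A1 G.
  apply: (@lipW _ (A + (1 * A + 1 * A) + `|c| * 1)); last exact: lipB fg2A clip.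
  by rewrite lerD2l !mulr1.
have Gbd x : `|G x| <= A1.
  rewrite (le_trans (ler_normB _ _))// lerD//.
    by rewrite (le_trans (fg2bd x))// !mul1r; lra.
  by rewrite normrM ler_pM// norm_cutoff.
have G0 x : R1 <= `|x| -> G x = 0.
  move=> xr; rewrite /G /g2 /beta (fr0 x (le_trans r0R1 xr)).
  rewrite (cutoff_eq0 (le_trans rhoR1 xr)) (cutoff_eq0 (le_trans r'R1 xr)).
  by rewrite mul0r mulr0 !subrr.
have iG : \int[leb]_x (G x * w x) = 0.
  transitivity (X - c * B); last by rewrite cB subrr.
  rewrite /X /B -RintegralZl// -RintegralB//; last exact: (integrableZl measurableT c ib).
  by apply: eq_Rintegral => x _; rewrite /G; ring.
have [u [uD uL uK]] := PK G GA Gbd G0 iG.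
have avg k := @kernel_average_bound u G D A1 h 0 k (ltW h0) uL uD GA
  (fun x => uK h x (ltW h0) h1).
suff cge : - (D * Num.sqrt h) / theta <= c.
  rewrite -[leLHS]/(\int[leb]_x (g2 x * w x)).
  have -> : \int[leb]_x (g2 x * w x) = \int[leb]_x (f x * w x) - c * B.
    by rewrite cB XE; ring.
  rewrite lerD2l -mulNr (_ : D / theta * B * Num.sqrt h = D * Num.sqrt h / theta * B).
    by rewrite ler_wpM2r ?(ltW B0)// lerNl -mulNr.
  by ring.
have [c0|c0] := leP 0 c.
  by rewrite (le_trans _ c0)// mulNr oppr_le0 divr_ge0 ?mulr_ge0 ?sqrtr_ge0// ltW.
(* Replacing [f] by [g1 = K^n f] shifts the index, so only [n] boundary terms survive. *)
have tele m : - (n%:R * A) <=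
   \sum_(k < m) iter k.+1 (K h) f 0 - \sum_(k < m) iter k.+1 (K h) g1 0.
  have sh p : \sum_(k < p) iter k.+1 (K h) g1 0 =
      \sum_(n <= k < n + p) iter k.+1 (K h) f 0.
    have -> : \sum_(n <= k < n + p) iter k.+1 (K h) f 0 =
        \sum_(0 <= k < p) iter (k + n).+1 (K h) f 0.
      by rewrite -{1}[n]add0n big_addn addKn.
    by rewrite big_mkord; apply: eq_bigr => k _; rewrite /g1 -iterD addSn.
  have fb p : 0 <= iter p (K h) f 0 <= A.
    have := norm_iter_kernel s cb nb (ltW h0) p 0 fA normf.
    rewrite ler_norml => /andP[_ ->]; rewrite andbT.
    by apply: (iter_kernel_ge0 s cb nb (ltW h0) p 0 fA) => y; have /andP[] := f0A y.
  rewrite sh -(big_mkord xpredT (fun k => iter k.+1 (K h) f 0)).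
  pose F k := iter k.+1 (K h) f 0.
  have cat : \sum_(0 <= k < m) F k + \sum_(m <= k < n + m) F k =
      \sum_(0 <= k < n) F k + \sum_(n <= k < n + m) F k.
    by rewrite -!big_cat_nat ?leq_addl ?leq_addr.
  have h2 : \sum_(m <= k < n + m) iter k.+1 (K h) f 0 <= n%:R * A.
    rewrite (_ : n%:R * A = \sum_(m <= k < n + m) A).
      by apply: ler_sum => k _; have /andP[] := fb k.+1.
    by rewrite sumr_const_nat addnK mulr_natl.
  have h3 : 0 <= \sum_(0 <= k < n) iter k.+1 (K h) f 0.
    by apply: sumr_ge0 => k _; have /andP[] := fb k.+1.
  by move: cat; rewrite /F; lra.
have [n0 occ0] := occ h h0.
pose q := D * (h * Num.sqrt h).
have key m : (n0 <= m)%N ->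
    - (h * (n%:R * A) + 2 * D + m%:R * q) <= c * h * (theta * m%:R).
  move=> n0m; have := avg m.
  have l12 := @lipB _ _ _ f g2 fA g2A.
  rewrite (eq_bigr (fun k : 'I_m => iter k.+1 (K h) f 0 - iter k.+1 (K h) g2 0
      - c * iter k.+1 (K h) beta 0)); last first.
    move=> k _; rewrite /G (iter_kernelB s cb nb (ltW h0) k.+1 l12 clip).
    by rewrite (iter_kernelB s cb nb (ltW h0) k.+1 fA g2A) (iter_kernelZ s cb nb (ltW h0) c k.+1 blip).
  rewrite !sumrB -mulr_sumr ler_norml => /andP[_ up].
  have g12 : \sum_(k < m) iter k.+1 (K h) g2 0 <= \sum_(k < m) iter k.+1 (K h) g1 0.
    apply: ler_sum => k _.
    exact: (le_iter_kernel s cb nb (ltW h0) k.+1 0 g2A g1A g2le).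
  have := tele m; have := occ0 m n0m; move: up.
  set S1 := \sum_(k < m) iter _ _ f 0; set Sb := \sum_(k < m) iter _ _ beta 0.
  set S2 := \sum_(k < m) iter _ _ g2 0 in g12 *; set S3 := \sum_(k < m) iter _ _ g1 0 in g12 *.
  rewrite -/q => up oc te.
  (* Since [c < 0], the lower bound on the occupation becomes an upper bound here. *)
  have e1 : c * h * Sb <= c * h * (theta * m%:R) by rewrite ler_wnM2l// nmulr_rle0 // ltW.
  apply: le_trans e1.
  have e2 : - (h * (n%:R * A)) <= h * (S1 - S2).
    by rewrite -mulrN ler_wpM2l ?(ltW h0)//; lra.
  by move: up; rewrite !mulrBr; lra.
rewrite leNgt; apply/negP => clt.
pose eps := - (D * Num.sqrt h) / theta - c.
have eps0 : 0 < eps by rewrite subr_gt0.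
(* If [c] fell short by [eps], the deficit [m h theta eps] would outgrow the boundary terms, which
   do not depend on [m]. *)
pose m := maxn n0 (Num.truncn ((h * (n%:R * A) + 2 * D) / (h * theta * eps))).+1.
have := key m (leq_maxl _ _).
have ht : 0 < h * theta * eps by rewrite !mulr_gt0.
have : (h * (n%:R * A) + 2 * D) / (h * theta * eps) < m%:R.
  by rewrite (lt_le_trans (truncnS_gt _))// ler_nat leq_maxr.
rewrite ltr_pdivrMr//.
have -> : c = - (D * Num.sqrt h) / theta - eps by rewrite /eps; ring.
have -> : (- (D * Num.sqrt h) / theta - eps) * h * (theta * m%:R) =
  - (m%:R * q) - m%:R * (h * theta * eps).
  by rewrite /q; field; rewrite gt_eqF.
lra.
Qed.

End invariance.

(** * Euler chains driven by Brownian motion *)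

Section independence.
Context d (T : measurableType d) (R : realType) (P : probability T R).

(** For fixed [B], the finite measures sending [A] to [P (A & B)] and to [P A * P B] agree on a
    pi-system containing the whole space, hence on the sigma-algebra it generates. *)
Lemma independent_generated (G H : set_system T) : G `<=` measurable ->
  H `<=` measurable -> G setT -> setI_closed G ->
  independent_systems P G H -> independent_systems P <<s G >> H.
Proof.
move=> Gm Hm GT GI ind A B sA HB; have mB := Hm _ HB.
have pB : 0 <= fine (P B) by exact: fine_ge0.
pose p : {nonneg R} := NngNum pB.
have m12 C : G C -> mrestr P mB C = mscale p P C.
  move=> GC; rewrite /mrestr /mscale/= ind// muleC fineK//.
  exact: fin_num_measure.
suff : mrestr P mB A = mscale p P A.
  by rewrite /mrestr /mscale/= fineK ?fin_num_measure// muleC.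
apply: (@g_sigma_algebra_measure_unique d R T G Gm (fun=> setT) (fun=> GT) _
  (mrestr P mB) (mscale p P) GI m12 _ A sA).
  by apply/seteqP; split => // x _; exists 0%N.
move=> _; rewrite (le_lt_trans (probability_le1 _ _)) ?ltry//.
exact: measurableI.
Qed.

Lemma independent_pair_law (X Y : T -> R) :
  measurable_fun setT X -> measurable_fun setT Y ->
  (forall A B, measurable A -> measurable B ->
    P (X @^-1` A `&` Y @^-1` B) = (P (X @^-1` A) * P (Y @^-1` B))%E) ->
  forall (muX muY : probability (measurableTypeR R) R),
  (forall A, measurable A -> P (X @^-1` A) = muX A) ->
  (forall A, measurable A -> P (Y @^-1` A) = muY A) ->
  forall (f : R * R -> R) (M : R), measurable_fun setT f ->
    (forall z, `|f z| <= M) ->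
    \int[P]_t f (X t, Y t) = \int[muX]_x \int[muY]_y f (x, y).
Proof.
move=> mX mY ind muX muY XE YE f M mf fM.
have mXY : measurable_fun setT (fun t => (X t, Y t) : measurableTypeR R * measurableTypeR R).
  exact/measurable_fun_pair.
pose XY := rv_of P mXY.
have lawE : forall A, measurable A -> (muX \x muY)%E A = distribution P XY A.
  apply: product_measure_unique => A B mA mB.
  by apply: etrans _ (congr2 mule (XE _ mA) (YE _ mB)); rewrite -ind.
rewrite /Rintegral; congr fine.
transitivity (\int[distribution P XY]_z (f z)%:E)%E.
  rewrite integral_distribution//; first exact/measurable_EFinP.
  apply: measurable_bounded_integrable => //.
  - by rewrite (le_lt_trans (probability_le1 _ _)) ?ltry.
  - exact: measurableT_comp.
  - by exists M; split; [exact: num_real|move=> N MN z _; exact: le_trans (fM _) (ltW MN)].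
transitivity (\int[muX \x muY]_z (f z)%:E)%E.
  by apply: eq_measure_integral => A mA _; first [exact: esym (lawE A mA)|exact: lawE].
rewrite -integral12_prod_meas1//; last first.
  apply: measurable_bounded_integrable => //.
    have fin : (distribution P XY setT < +oo)%E.
      by rewrite (le_lt_trans (probability_le1 _ _)) ?ltry.
    exact: (eq_ind _ (fun e => (e < +oo)%E) fin _ (esym (lawE setT measurableT))).
  by exists M; split; [exact: num_real|move=> N MN z _; exact: le_trans (fM z) (ltW MN)].
apply: eq_integral => x _; rewrite /fubini_F fineK//.
apply: integrable_fin_num => //.
apply: measurable_bounded_integrable => //.
- by rewrite (le_lt_trans (probability_le1 _ _)) ?ltry.
- exact: measurableT_comp.
- by exists M; split; [exact: num_real|move=> N MN z _; exact: le_trans (fM _) (ltW MN)].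
Qed.

End independence.

Section euler_chain.
Context d (T : measurableType d) (R : realType) (P : probability T R).
Variables (b : R -> R) (s : R).
Hypotheses (cb : continuous b) (nb : forall x y, x <= y -> b y <= b x).
Variables (W : R -> {RV P >-> R}) (q : {RV P >-> R}).
Hypothesis W_bm : standard_brownian_motion W.
Hypothesis qW_indep : independent_systems P (sigma_rv q) (sigma_process `[0, +oo[ W).
Local Notation J := (implicit_step b).
Local Notation K := (euler_kernel b s).

(* The recursion is driven by a path so that it also applies pathwise. *)
Fixpoint euler_chain (h x : R) (w : R -> R) (n : nat) : R :=
  if n is m.+1 then
    J h (euler_chain h x w m + s * (w (m.+1%:R * h) - w (m%:R * h)))
  else x.

Definition euler_rv h n (t : T) : R := euler_chain h (q t) (W^~ t) n.

Lemma measurable_euler_rv h n : 0 <= h -> measurable_fun setT (euler_rv h n).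
Proof.
move=> h0; elim: n => [|n IHn]; first exact: measurable_funP.
apply: measurableT_comp.
  exact: lip_measurable (implicit_step_lip cb nb h0).
apply: measurable_funD => //; apply: measurable_funM => //.
by apply: measurable_funB; exact: measurable_funP.
Qed.

(** A pi-system generating the joint history of the initial state and of [W] up to time [n h]; a
    mere union of the two sigma-algebras would not be closed under intersection. *)
Let past n h : set_system T :=
  [set C | exists A B, [/\ sigma_rv q A, sigma_process `[0, n%:R * h] W B & C = A `&` B]].

Lemma sigma_process_measurable (I : set R) : sigma_process I W `<=` measurable.
Proof.
apply: smallest_sub; first exact: sigma_algebra_measurable.
by move=> _ [t _ [B mB <-]]; rewrite setTI; exact: measurable_funPTI.
Qed.

Lemma sigma_rv_measurable (X : {RV P >-> R}) : sigma_rv X `<=` measurable.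
Proof. by move=> _ [B mB <-]; rewrite setTI; exact: measurable_funPTI. Qed.

Let sigma_processS (I I' : set R) : I `<=` I' ->
  sigma_process I W `<=` sigma_process I' W.
Proof.
move=> II'; apply: sub_sigma_algebra2 => A [t It AW]; exists t => //.
exact: II'.
Qed.

(** For [A] from [q], [B] from the history of [W] and [E] from the increment, [P (A & B & E) = P A *
    P (B & E) = P A * P B * P E]: first [q] is split from the whole path, then the increment from
    the history. Splitting [q] once more regroups the first two factors. *)
Lemma past_indep n h : 0 < h ->
  independent_systems P <<s past n h >> (sigma_rv (W (n.+1%:R * h) \- W (n%:R * h))).
Proof.
move=> h0; have nh : 0 <= n%:R * h by rewrite mulr_ge0// ltW.
have nn : n%:R * h < n.+1%:R * h by rewrite ltr_pM2r// ltr_nat.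
have mdW : sigma_rv (W (n.+1%:R * h) \- W (n%:R * h)) `<=` measurable.
  move=> _ [B mB <-].
  by apply: (measurable_funB (measurable_funP _) (measurable_funP _)).
apply: independent_generated => //.
- move=> _ [A [B [sA sB ->]]]; apply: measurableI.
    exact: sigma_rv_measurable sA.
  exact: sigma_process_measurable sB.
- exists setT, setT; split; last by rewrite setTI.
    by exists setT => //; rewrite setTI preimage_setT.
  exact: (@measurableT _ (g_sigma_algebraType _)).
- move=> _ _ [A [B [[A' mA' <-] sB ->]]] [C [D [[C' mC' <-] sD ->]]].
  exists (q @^-1` (A' `&` C')), (B `&` D); split.
  + by exists (A' `&` C'); [exact: measurableI|rewrite setTI].
  + exact: (@measurableI _ (g_sigma_algebraType _)).
  + by rewrite !setTI preimage_setI setIACA.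
- move=> _ E [A [B [sA sB ->]]] sE.
  have [_ _ incr _] := W_bm.
  have sub t : sigma_process `[0, t] W `<=` sigma_process `[0, +oo[ W.
    by apply: sigma_processS => u /=; rewrite !in_itv/= andbT => /andP[].
  have sBE : sigma_process `[0, n.+1%:R * h] W (B `&` E).
    apply: (@measurableI _ (g_sigma_algebraType _)).
      apply: sigma_processS sB => u /=; rewrite !in_itv/= => /andP[-> /=].
      by move=> /le_trans; apply; exact: ltW.
    case: sE => E' mE' <-.
    apply: (@measurable_funB _ (g_sigma_algebraType _) _ setT (W (n.+1%:R * h)) (W (n%:R * h))) => //.
    - move=> _ C mC; apply: sub_sigma_algebra; exists (n.+1%:R * h) => /=.
        by rewrite in_itv/= lexx (le_trans nh (ltW nn)).
      by exists C.
    - move=> _ C mC; apply: sub_sigma_algebra; exists (n%:R * h) => /=.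
        by rewrite in_itv/= nh (ltW nn).
      by exists C.
  rewrite -setIA (qW_indep sA (sub _ _ sBE)) (incr _ _ nh nn _ _ sB sE).
  by rewrite (qW_indep sA (sub _ _ sB)) muleA.
Qed.

Lemma euler_rv_past n h A : 0 < h -> measurable A ->
  <<s past n h >> (euler_rv h n @^-1` A).
Proof.
move=> h0 mA.
suff H k : (k <= n)%N ->
    measurable_fun (setT : set (g_sigma_algebraType (past n h))) (euler_rv h k).
  by have := H n (leqnn n) measurableT A mA; rewrite setTI.
have Wm k' : (k' <= n)%N ->
    measurable_fun (setT : set (g_sigma_algebraType (past n h))) (W (k'%:R * h)).
  move=> kn _ C mC; apply: sub_sigma_algebra.
  exists setT, (setT `&` W (k'%:R * h) @^-1` C); split.
  - by exists setT => //; rewrite setTI preimage_setT.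
  - apply: sub_sigma_algebra; exists (k'%:R * h) => /=; last by exists C.
    by rewrite in_itv/= mulr_ge0 ?(ltW h0)//= ler_pM2r// ler_nat.
  - by rewrite setTI.
elim: k => [_|k IHk kn].
  move=> _ C mC; apply: sub_sigma_algebra.
  exists (setT `&` q @^-1` C), setT; split.
  - by exists C.
  - exact: (@measurableT _ (g_sigma_algebraType _)).
  - by rewrite setIT.
apply: measurableT_comp.
  exact: lip_measurable (implicit_step_lip cb nb (ltW h0)).
apply: measurable_funD; first by apply: IHk; exact: ltnW.
apply: measurable_funM => //; apply: measurable_funB; apply: Wm => //.
exact: ltnW.
Qed.

(** The Markov property of the chain in expectation form: its state is a function of the past, and
    the next increment is independent of the past with variance [h]. *)
Lemma euler_rv_step n h (g : R -> R) (L M : R) : 0 < h -> lip L g ->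
  (forall x, `|g x| <= M) ->
  \int[P]_t g (euler_rv h n.+1 t) = \int[P]_t K h g (euler_rv h n t).
Proof.
move=> h0 gL gM; have h0' := ltW h0.
have mX := measurable_euler_rv n h0'.
pose Y := W (n.+1%:R * h) \- W (n%:R * h).
have mY : measurable_fun setT Y by exact: measurable_funB.
have mX' : @measurable_fun _ _ T (measurableTypeR R) setT (euler_rv h n) by exact: mX.
pose X := rv_of P mX'.
have [_ _ _ lawW] := W_bm.
have nh : 0 <= n%:R * h by rewrite mulr_ge0.
have nn : n%:R * h < n.+1%:R * h by rewrite ltr_pM2r// ltr_nat.
have sh : 0 < Num.sqrt h by rewrite sqrtr_gt0.
have mJ : measurable_fun setT (J h) by exact: lip_measurable (implicit_step_lip cb nb h0').
have mg := lip_measurable gL.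
have mf : measurable_fun setT (fun z : R * R => g (J h (z.1 + s * z.2))).
  apply: measurableT_comp => //; apply: measurableT_comp => //.
  by apply: measurable_funD => //; exact: measurable_funM.
have YE A : measurable A -> P (Y @^-1` A) = normal_prob 0 (Num.sqrt h) A.
  move=> mA; rewrite (lawW _ _ nh nn _ mA) (_ : _ - _ = h)//.
  by rewrite -natr1; ring.
have := @independent_pair_law _ T R P (euler_rv h n) Y mX mY _
  (distribution P X) (normal_prob 0 (Num.sqrt h)) (fun _ _ => erefl) YE
  (fun z => g (J h (z.1 + s * z.2))) M mf (fun z => gM _).
move=> -> ; last first.
  move=> A B mA mB; apply: (past_indep (n := n) h0); first exact: euler_rv_past.
  by exists B => //; rewrite setTI.
have KE x : \int[normal_prob 0 (Num.sqrt h)]_y g (J h (x + s * y)) = K h g x.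
  have ms : @measurable_fun _ _ (measurableTypeR R) (measurableTypeR R) setT
    (fun y : R => Num.sqrt h * y) by exact: measurable_funM.
  pose Z := rv_of (normal_prob 0 1) ms.
  rewrite /euler_kernel /Rintegral; apply: (congr1 (@fine R)).
  have mgx : measurable_fun setT (fun y : R => g (J h (x + s * y))).
    apply: measurableT_comp => //; apply: measurableT_comp => //.
    by apply: measurable_funD => //; exact: measurable_funM.
  transitivity (\int[distribution (normal_prob 0 1) Z]_y (g (J h (x + s * y)))%:E)%E.
    by apply: eq_measure_integral => A mA _; exact: normal_prob_scale.
  rewrite integral_distribution//=; last 2 first.
  - exact/measurable_EFinP.
  - apply: (@gauss_integrable _ _ M) => [|y].
      exact: (measurableT_comp mgx ms).
    rewrite (le_trans (gM _))// ler_peMr ?lerDl ?exprn_even_ge0//.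
    exact: le_trans (gM 0).
  by apply: eq_integral => y _; rewrite mulrA.
under eq_Rintegral do rewrite KE.
have KL := euler_kernel_lip cb nb s h0' gL.
rewrite /Rintegral; apply: (congr1 (@fine R)); rewrite integral_distribution//.
  by apply: measurableT_comp => //; exact: lip_measurable KL.
apply: measurable_bounded_integrable => //.
- by rewrite (le_lt_trans (probability_le1 _ _)) ?ltry.
- exact: measurableT_comp (lip_measurable KL) mX.
- exists M; split; [exact: num_real|move=> N MN z _].
  have := norm_iter_kernel s cb nb h0' 1 (euler_rv h n z) gL gM.
  by move=> /le_trans; apply; exact: ltW.
Qed.

Lemma euler_rv_expectation n h (g : R -> R) (L M : R) : 0 < h -> lip L g ->
  (forall x, `|g x| <= M) ->
  \int[P]_t g (euler_rv h n t) = \int[P]_t iter n (K h) g (q t).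
Proof.
move=> h0; elim: n g => [//|n IHn] g gL gM.
rewrite (euler_rv_step n h0 gL gM) iterSr; apply: IHn.
  exact: (euler_kernel_lip cb nb s (ltW h0) gL).
by move=> x; exact: (norm_iter_kernel s cb nb (ltW h0) 1 x gL gM).
Qed.

End euler_chain.

(** * Pathwise convergence and existence of solutions *)

Section path_lemmas.
Context {R : realType}.

(** Freezing a path at its initial value for negative times makes it continuous on the whole line,
    so that antiderivatives need no one-sided version at 0. *)
Lemma continuous_extension (f : R -> R) : {within `[0, +oo[, continuous f} ->
  continuous (fun t : R => f (Num.max t 0)).
Proof.
move=> /continuous_within_itvcyP[cf cf0] x; have [x0|x0] := leP x 0; last first.
  suff : f (Num.max y 0) @[y --> x] --> f (Num.max x 0) by [].
  rewrite (max_l (ltW x0)).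
  apply: (@cvg_trans _ (f y @[y --> x])); last by apply: cf; rewrite in_itv/= x0.
  apply: near_eq_cvg; near=> y; congr f; rewrite max_l//.
  by apply/ltW; near: y; exact: lt_nbhsr.
apply/(@cvgrPdist_le _ R^o) => e e0; rewrite (max_r x0).
move/(@cvgrPdist_le _ R^o) : cf0 => /(_ e e0)/nbhs_ballP[d /= d0 dP].
have h y : y - x < d -> `|f 0 - f (Num.max y 0)| <= e.
  move=> yxd; have [y0|y0] := leP y 0; first by rewrite subrr normr0 ltW.
  by apply: dP => //; rewrite /ball/= sub0r normrN gtr0_norm//; move: yxd; lra.
near=> y; apply: h; apply: le_lt_trans (ler_norm _) _; rewrite distrC.
by near: y; exact: cvgr_dist_lt.
Unshelve. all: by end_near. Qed.

Lemma uniformly_continuous_itv (f : R -> R) (t e : R) : continuous f -> 0 < e ->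
  exists2 d : R, 0 < d & forall x y, 0 <= x <= t -> 0 <= y <= t -> `|x - y| <= d ->
    `|f x - f y| <= e.
Proof.
move=> cf e0; have e2 : 0 < e / 2 by rewrite divr_gt0.
have /compact_near_coveringP cov := @segment_compact R 0 t.
have := cov R (0^'+) (fun d x => forall y, `|x - y| <= d -> `|f x - f y| <= e) _.
case.
- move=> x _.
  have /(@cvgrPdist_le _ R^o)/(_ _ e2)/nbhs_ballP[d /= d0 dP] := cf x.
  exists (ball x (d / 2), [set u | u < d / 2]); first split => /=.
  + by apply: nbhsx_ballx; rewrite divr_gt0.
  + by apply: nbhs_right_lt; rewrite divr_gt0.
  move=> [z u] [/= xz ud] y zy.
  have h1 : `|f x - f z| <= e / 2.
    by apply: dP; apply: le_ball xz; rewrite ler_pdivrMr// ler_peMr// ?ler1n// ltW.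
  have h2 : `|f x - f y| <= e / 2.
    apply: dP; rewrite /ball/= -(subrK z x) -addrA.
    rewrite (le_lt_trans (ler_normD _ _))// (splitr d) ltrD//.
    exact: le_lt_trans ud.
  rewrite -(subrK (f x) (f z)) -addrA (le_trans (ler_normD _ _))//.
  by rewrite (splitr e) lerD// distrC.
move=> d0 /= d0P; rewrite /ball/= => H.
exists (d0 / 2) => [|x y xt yt xy]; first by rewrite divr_gt0.
apply: (H (d0 / 2)) => //=.
- by rewrite sub0r normrN gtr0_norm ?divr_gt0// ltr_pdivrMr// ltr_pMr// ltr1n.
- by rewrite divr_gt0.
Qed.

(** A vanishing derivative, expressed through increments only; it will be applied to a limit of
    chains whose differentiability is not established separately. The proof adds up increments over
    a fine uniform grid. *)
Lemma constant_of_small_increments (D : R -> R) (t : R) : 0 <= t ->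
  (forall e, 0 < e -> exists2 d : R, 0 < d & forall x y, 0 <= x -> x <= y -> y <= t ->
    y - x <= d -> `|D y - D x| <= e * (y - x)) ->
  D t = D 0.
Proof.
move=> t0 H; apply/eqP; rewrite -subr_eq0 -normr_le0; apply/ler_addgt0Pr => e e0; rewrite add0r.
have t1 : 0 < t + 1 by rewrite ltr_wpDl.
have [d d0 dD] := H (e / (t + 1)) (divr_gt0 e0 t1).
pose n := (Num.truncn (t / d)).+1; pose h := t / n%:R.
have n0 : (0 : R) < n%:R by rewrite ltr0n.
have hd : h <= d.
  by rewrite ler_pdivrMr// mulrC -ler_pdivrMr// ltW// truncnS_gt.
have h0 : 0 <= h by rewrite divr_ge0// ltW.
have nh : n%:R * h = t by rewrite mulrC divfK// gt_eqF.
have step k : (k <= n)%N -> `|D (k%:R * h) - D 0| <= e / (t + 1) * (k%:R * h).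
  elim: k => [_|k IHk kn]; first by rewrite !mul0r subrr normr0 mulr0.
  have kk : k.+1%:R * h = k%:R * h + h by rewrite -natr1 mulrDl mul1r.
  have kh0 : 0 <= k%:R * h by rewrite mulr_ge0.
  rewrite -(subrK (D (k%:R * h)) (D _)) -addrA (le_trans (ler_normD _ _))//.
  rewrite [X in _ <= _ * X]kk mulrDr [leRHS]addrC; apply: lerD; last by apply: IHk; exact: ltnW.
  have := dD (k%:R * h) (k.+1%:R * h) kh0.
  rewrite (_ : k.+1%:R * h - k%:R * h = h); last by rewrite kk addrC addKr.
  apply => //; first by rewrite kk lerDl.
  by rewrite -nh ler_wpM2r// ler_nat.
have := step n (leqnn n); rewrite nh => /le_trans; apply.
by rewrite mulrAC ler_pdivrMr// ler_pM2l// lerDl.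
Qed.

End path_lemmas.

Section path_solution.
Context {R : realType}.
Variables (b : R -> R) (s : R).
Hypotheses (cb : continuous b) (nb : forall x y, x <= y -> b y <= b x).
Local Notation J := (implicit_step b).

(* The integral equation, with the drift integral written as the increment of an
   antiderivative [F] of [b \o X]; paths are extended continuously to [t < 0]. *)
Definition path_solution (x : R) (w X : R -> R) : Prop :=
  continuous X /\ exists2 F : R -> R, (forall t : R, is_derive t 1 F (b (X t))) &
    forall t, 0 <= t -> X t = x + s * w t + (F t - F 0).

(** [z] solves the recursion up to a residual [e] per step. By accretivity the new error is at most
    the old one plus [e], so residuals simply add up. It serves both to compare the chain with a
    solution and a coarse chain with a finer one. *)
Lemma implicit_stability h e n (x z D : nat -> R) : 0 <= h ->
  (forall k, (k < n)%N -> x k.+1 = J h (x k + D k)) ->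
  (forall k, (k < n)%N -> `|z k.+1 - z k - D k - h * b (z k.+1)| <= e) ->
  `|x n - z n| <= `|x 0%N - z 0%N| + n%:R * e.
Proof.
move=> h0 xE ze; elim: n xE ze => [|n IHn] xE ze; first by rewrite mul0r addr0.
set err := z n.+1 - z n - D n - h * b (z n.+1).
apply: (@le_trans _ _ `|x n - z n - err|).
  apply: (@norm_contraction _ _ _ (h * (b (x n.+1) - b (z n.+1)))).
    have := implicit_stepE cb nb (x n + D n) h0; rewrite -xE// => xnE.
    by rewrite {1}xnE /err; ring.
  by rewrite -mulrA mulr_ge0_le0// nonincreasing_mul_le0.
rewrite (le_trans (ler_normB _ _))// -natr1 mulrDl mul1r addrA lerD ?ze//.
by apply: IHn => k kn; [apply: xE|apply: ze]; exact: ltnW.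
Qed.

(** A solution sampled on the grid satisfies the recursion up to [h] times the oscillation of
    [b (X u)] over one step, and uniform continuity makes this small. The threshold [d] depends on
    the path. *)
Lemma euler_chain_cvg (x : R) (w X : R -> R) (t e : R) : 0 <= t -> w 0 = 0 ->
  path_solution x w X -> 0 < e ->
  exists2 d : R, 0 < d & forall h n, 0 <= h -> h <= d -> n%:R * h <= t ->
    `|euler_chain b s h x w n - X (n%:R * h)| <= e.
Proof.
move=> t0 w0 [cX [F dF XE]] e0; have t1 : 0 < t + 1 by rewrite ltr_wpDl.
have cbX : continuous (fun u => b (X u)).
  by move=> u; apply: (continuous_comp (cX u)); exact: cb.
have [d d0 dP] := uniformly_continuous_itv t cbX (divr_gt0 e0 t1).
exists d => // h n h0 hd nht.
have X0 : X 0 = x by rewrite XE// w0 mulr0 subrr !addr0.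
pose D k := s * (w (k.+1%:R * h) - w (k%:R * h)).
have := @implicit_stability h (h * (e / (t + 1))) n (euler_chain b s h x w)
  (fun k => X (k%:R * h)) D h0 (fun k _ => erefl) _.
rewrite mul0r /= X0 subrr normr0 add0r => /(_ _)/le_trans; apply; last first.
  rewrite mulrA (le_trans (_ : _ <= t * (e / (t + 1))))//.
    by rewrite ler_wpM2r// divr_ge0// ltW.
  by rewrite mulrA ler_pdivrMr// mulrC ler_pM2l// lerDl.
move=> k kn; have kh0 : 0 <= k%:R * h by rewrite mulr_ge0.
have kh : k%:R * h <= k.+1%:R * h by rewrite ler_wpM2r// ler_nat.
have kht : k.+1%:R * h <= t by rewrite (le_trans _ nht)// ler_wpM2r// ler_nat.
have hE : k.+1%:R * h - k%:R * h = h by rewrite -natr1; ring.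
rewrite /D (XE _ kh0) (XE _ (le_trans kh0 kh)).
set bX := b _.
rewrite (_ : _ - _ = (F (k.+1%:R * h) - bX * (k.+1%:R * h)) - (F (k%:R * h) - bX * (k%:R * h))).
  have dG (u : R) : is_derive u 1 (fun u => F u - bX * u) (b (X u) - bX).
    by have q := dF u; apply: is_derive_eq; rewrite /GRing.scale/= mulr1.
  have -> : h * (e / (t + 1)) = e / (t + 1) * `|k.+1%:R * h - k%:R * h|.
    by rewrite hE ger0_norm// mulrC.
  apply: mean_value_bound dG _ => u; rewrite (min_idPl kh) (max_idPr kh) => /andP[u1 u2].
  rewrite /bX -(XE _ (le_trans kh0 kh)); apply: dP.
  - by rewrite (le_trans kh0)//= (le_trans u2).
  - by rewrite (le_trans kh0 kh).
  - by rewrite ler0_norm ?subr_le0//; move: u1 hd hE; lra.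
have -> : h * bX = (k.+1%:R * h - k%:R * h) * bX by rewrite hE.
by ring.
Qed.

(** * Existence of solutions by dyadic refinement *)

Section existence.
Hypothesis b_lip : forall r, exists2 L : R, 0 <= L & forall x y,
  `|x| <= r -> `|y| <= r -> `|b x - b y| <= L * `|x - y|.
Variable r : R.
Hypotheses (br : forall x, r <= x -> b x <= 0)
  (bNr : forall x, x <= - r -> 0 <= b x).
Variables (x : R) (w : R -> R).
Hypotheses (cw : continuous w) (w0 : w 0 = 0).
Local Notation X h := (euler_chain b s h x w).

(** The chain with its noise removed: it moves only by the drift, so its increments are controlled
    even where the Brownian path is rough. *)
Let Y h n := X h n - s * w (n%:R * h).

Let YS h n : 0 <= h -> Y h n.+1 = Y h n + h * b (X h n.+1).
Proof.
move=> h0.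
have XE : X h n.+1 = X h n + s * (w (n.+1%:R * h) - w (n%:R * h)) + h * b (X h n.+1).
  exact: (implicit_stepE cb nb _ h0).
by rewrite /Y {1}XE; ring.
Qed.

Let drift_sum h (c e : R) k n : 0 <= h ->
  (forall i, (i < n)%N -> `|b (X h (k + i).+1) - c| <= e) ->
  `|Y h (k + n) - Y h k - n%:R * h * c| <= n%:R * h * e.
Proof.
move=> h0; elim: n => [|n IHn] H.
  by rewrite addn0 subrr !mul0r subr0 normr0.
rewrite addnS YS//.
have -> : Y h (k + n) + h * b (X h (k + n).+1) - Y h k - n.+1%:R * h * c =
    (Y h (k + n) - Y h k - n%:R * h * c) + h * (b (X h (k + n).+1) - c).
  by rewrite -natr1; ring.
rewrite (le_trans (ler_normD _ _))// -natr1 !mulrDl mul1r lerD//.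
  by apply: IHn => i ni; apply: H; exact: ltnW.
by rewrite normrM (ger0_norm h0) ler_wpM2l// H.
Qed.

(** A discrete maximum principle. If [Y] rose above [Y0], the new [X] would lie beyond [r], where
    the drift is nonpositive; as the implicit step uses the drift at this new point, [Y] would not
    have increased. The lower side is symmetric. *)
Let chain_bounded t : 0 <= t -> exists2 B : R, 0 <= B &
  forall h k, 0 <= h -> k%:R * h <= t -> `|X h k| <= B /\ `|Y h k| <= B.
Proof.
move=> t0; have [om om0 wo] := continuous_norm_bounded t0 cw.
pose om' := `|s| * om; have om'0 : 0 <= om' by rewrite mulr_ge0.
pose Y0 := Num.max `|x| (r + om').
have Y00 : 0 <= Y0 by rewrite le_max normr_ge0.
have swo h k : 0 <= h -> k%:R * h <= t -> `|s * w (k%:R * h)| <= om'.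
  move=> h0 kh; rewrite normrM ler_wpM2l// wo// ger0_norm//.
  by rewrite mulr_ge0.
have YB h k : 0 <= h -> k%:R * h <= t -> `|Y h k| <= Y0.
  move=> h0; elim: k => [_|k IHk kh].
    by rewrite /Y mul0r w0 mulr0 subr0 le_max lexx.
  have kht : k%:R * h <= t by rewrite (le_trans _ kh)// ler_wpM2r// ler_nat.
  have := IHk kht; have := swo h k.+1 h0 kh; have YE := YS k h0.
  have XE : X h k.+1 = Y h k.+1 + s * w (k.+1%:R * h) by rewrite /Y subrK.
  have ro : r + om' <= Y0 by rewrite le_max lexx orbT.
  rewrite !ler_norml => /andP[s1 s2] /andP[y1 y2]; apply/andP; split.
    rewrite leNgt; apply/negP => Yn.
    have : 0 <= b (X h k.+1) by apply: bNr; rewrite XE; lra.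
    by move=> /(mulr_ge0 h0); lra.
  rewrite leNgt; apply/negP => Yn.
  have : b (X h k.+1) <= 0 by apply: br; rewrite XE; lra.
  by move=> /(mulr_ge0_le0 h0); lra.
exists (Y0 + om') => [|h k h0 kh]; first by rewrite addr_ge0.
split; last by rewrite (le_trans (YB h k h0 kh))// lerDl.
have -> : X h k = Y h k + s * w (k%:R * h) by rewrite /Y subrK.
by rewrite (le_trans (ler_normD _ _))// lerD// ?YB// swo.
Qed.

(* Uniform control of the chains on [0, t]: [M] bounds the drift, [L] is a
   Lipschitz constant of [b] on the region where the interpolations live. *)
Let chain_control t : 0 <= t -> exists M : R, 0 <= M /\
  (forall h k, 0 <= h -> k%:R * h <= t -> `|b (X h k)| <= M) /\
  forall e, 0 < e -> exists d : R, [/\ 0 < d,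
    forall h k n, 0 <= h -> (k + n)%:R * h <= t -> n%:R * h <= d ->
      `|X h (k + n) - X h k| <= e,
    forall h k n, 0 <= h -> (k + n)%:R * h <= t -> n%:R * h <= d ->
      `|b (X h (k + n)) - b (X h k)| <= e &
    forall h k N i, 0 <= h -> k.+1%:R * h <= t -> h <= d -> (i <= N)%N -> (0 < N)%N ->
      `|b (X h k.+1) - b (X h k + s * (w (k%:R * h + i%:R * (h / N%:R)) - w (k%:R * h)) +
          i%:R * (h / N%:R) * b (X h k.+1))| <= e].
Proof.
move=> t0; have [B B0 XB] := chain_bounded t0.
have [M M0 bM] := continuous_norm_bounded B0 cb.
have [om om0 wo] := continuous_norm_bounded t0 cw.
(* [B2] also bounds the points interpolating a step, which differ from a chain value by two noise
   values and a drift over a time at most [t]. *)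
pose B2 := B + 2 * (`|s| * om) + t * M.
have BB2 : B <= B2.
  by rewrite /B2 -addrA lerDl addr_ge0// ?mulr_ge0.
have [L L0 bL] := b_lip B2.
exists M; split=> //; split=> [h k h0 kh|e e0]; first by apply: bM; have [] := XB h k h0 kh.
(* A displacement consists of a noise part and a drift part, each at most [e1]; the minimum makes
   both [2 e1] and its image [L (2 e1)] at most [e]. *)
pose e1 := Num.min e (e / (L + 1)) / 2.
have L1 : 0 < L + 1 by rewrite ltr_wpDl.
have e10 : 0 < e1 by rewrite divr_gt0// lt_min e0 divr_gt0.
have e1e : 2 * e1 <= e by rewrite mulrC divfK// ge_min lexx.
have Le1 : L * (2 * e1) <= e.
  rewrite mulrC [2 * _]mulrC divfK//.
  apply: (@le_trans _ _ (e / (L + 1) * L)).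
    by rewrite ler_wpM2r// ge_min lexx orbT.
  by rewrite mulrAC ler_pdivrMr// ler_pM2l// lerDl.
have csw : continuous (fun u => s * w u).
  by move=> u; apply: cvgM; [exact: cvg_cst|exact: cw].
have [d1 d10 dP] := uniformly_continuous_itv t csw e10.
have M1 : 0 < M + 1 by rewrite ltr_wpDl.
pose d := Num.min d1 (e1 / (M + 1)).
have d0 : 0 < d by rewrite lt_min d10 divr_gt0.
have dM u : 0 <= u -> u <= d -> u * M <= e1.
  move=> u0 ud; apply: (@le_trans _ _ (e1 / (M + 1) * M)).
    by rewrite ler_wpM2r// (le_trans ud)// ge_min lexx orbT.
  by rewrite mulrAC ler_pdivrMr// ler_pM2l// lerDl.
have XX h k n : 0 <= h -> (k + n)%:R * h <= t -> n%:R * h <= d ->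
    `|X h (k + n) - X h k| <= 2 * e1.
  move=> h0 knt nd.
  have nh0 : 0 <= n%:R * h by rewrite mulr_ge0.
  have kh0 : 0 <= k%:R * h by rewrite mulr_ge0.
  have knE : (k + n)%:R * h = k%:R * h + n%:R * h by rewrite natrD mulrDl.
  have := @drift_sum h 0 M k n h0; rewrite mulr0 subr0 => Yb.
  have -> : X h (k + n) - X h k = (Y h (k + n) - Y h k) +
      (s * w ((k + n)%:R * h) - s * w (k%:R * h)) by rewrite /Y; ring.
  rewrite (le_trans (ler_normD _ _))// mulr2n mulrDl !mul1r lerD//.
    apply: le_trans (dM _ nh0 nd); apply: Yb => i ni; rewrite subr0.
    apply: bM; have [] // := XB h (k + i).+1 h0.
    by rewrite (le_trans _ knt)// ler_wpM2r// ler_nat -addnS leq_add2l.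
  apply: dP.
  - by rewrite knt knE addr_ge0.
  - by rewrite kh0 (le_trans _ knt)// knE lerDl.
  - by rewrite knE addrAC subrr add0r ger0_norm// (le_trans nd)// ge_min lexx.
exists d; split => //.
- by move=> h k n h0 knt nd; exact: le_trans (XX h k n h0 knt nd) e1e.
- move=> h k n h0 knt nd.
  have kt : k%:R * h <= t.
    by rewrite (le_trans _ knt)// ler_wpM2r// ler_nat leq_addr.
  have [B1 _] := XB h _ h0 knt; have [B1' _] := XB h _ h0 kt.
  apply: le_trans (bL _ _ (le_trans B1 BB2) (le_trans B1' BB2)) _.
  by apply: le_trans Le1; rewrite ler_wpM2l// XX.
move=> h k N i h0 kt hd iN N0.
set z := X h k + _ + _.
have N0' : (0 : R) < N%:R by rewrite ltr0n.
have kh0 : 0 <= k%:R * h by rewrite mulr_ge0.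
pose f := i%:R * (h / N%:R).
have f0 : 0 <= f by rewrite /f mulr_ge0// divr_ge0// ltW.
have fh : f <= h.
  by rewrite /f mulrA ler_pdivrMr// mulrC ler_wpM2l// ler_nat.
have kE : k.+1%:R * h = k%:R * h + h by rewrite -natr1; ring.
have ht : h <= t by move: kt; rewrite kE; lra.
have kt' : k%:R * h <= t by move: kt; rewrite kE; lra.
have [Xk1 _] := XB h _ h0 kt; have [Xk _] := XB h _ h0 kt'.
have bX := bM _ Xk1.
have sw u : 0 <= u <= t -> `|s * w u| <= `|s| * om.
  by move=> /andP[u0 ut]; rewrite normrM ler_wpM2l// wo// ger0_norm.
have w1 : `|s * w (k%:R * h + f)| <= `|s| * om.
  by apply: sw; move: kt; rewrite kE; lra.
have w2 : `|s * w (k%:R * h)| <= `|s| * om by apply: sw; rewrite kh0.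
have zB2 : `|z| <= B2.
  rewrite /z /B2 (le_trans (ler_normD _ _))// lerD//.
    rewrite (le_trans (ler_normD _ _))// lerD// mulrBr (le_trans (ler_normB _ _))//.
    by rewrite mulr2n mulrDl !mul1r lerD.
  by rewrite normrM (ger0_norm f0) ler_pM// (le_trans fh).
apply: le_trans (bL _ _ (le_trans Xk1 BB2) zB2) _; apply: le_trans Le1.
rewrite ler_wpM2l//.
have XE : X h k.+1 = X h k + s * (w (k.+1%:R * h) - w (k%:R * h)) + h * b (X h k.+1).
  exact: (implicit_stepE cb nb _ h0).
have -> : X h k.+1 - z = (s * w (k.+1%:R * h) - s * w (k%:R * h + f)) +
    (h - f) * b (X h k.+1).
  by rewrite {1}XE /z -/f; ring.
rewrite (le_trans (ler_normD _ _))// (_ : 2 * e1 = e1 + e1); last by ring.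
apply: lerD.
  apply: dP.
  - by rewrite kt kE addr_ge0.
  - by move: kt; rewrite kE; lra.
  - rewrite kE opprD addrACA subrr add0r ger0_norm ?subr_ge0//.
    apply: (@le_trans _ _ h); last by rewrite (le_trans hd)// ge_min lexx.
    by rewrite gerBl.
rewrite normrM; apply: (@le_trans _ _ (h * M)); last exact: dM.
by rewrite ler_pM// ger0_norm ?subr_ge0// gerBl.
Qed.

(** Each coarse step is interpolated at the [N] fine times, following the true noise and a constant
    drift. This is an approximate solution of the fine recursion, so [implicit_stability] applies
    step by step. *)
Let coarse_fine t e : 0 <= t -> 0 < e -> exists2 d : R, 0 < d &
  forall h k N, 0 <= h -> h <= d -> k%:R * h <= t -> (0 < N)%N ->
    `|X (h / N%:R) (k * N) - X h k| <= e.
Proof.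
move=> t0 e0; have t1 : 0 < t + 1 by rewrite ltr_wpDl.
have [M [_ [_ ctrl]]] := chain_control t0.
have [d [d0 _ _ fine]] := ctrl _ (divr_gt0 e0 t1).
exists d => // h k N h0 hd kt N0.
have N0' : (0 : R) < N%:R by rewrite ltr0n.
have Nn0 : N%:R != 0 :> R by rewrite gt_eqF.
pose h' := h / N%:R; have h'0 : 0 <= h' by rewrite divr_ge0// ltW.
have Nh' : N%:R * h' = h by rewrite mulrC divfK.
suff step : `|X h' (k * N) - X h k| <= k%:R * h * (e / (t + 1)).
  apply: le_trans step _; rewrite mulrA ler_pdivrMr// mulrC ler_wpM2l ?ltW//.
  by rewrite (le_lt_trans kt)// ltrDl.
elim: k kt => [_|k IHk kt]; first by rewrite mul0n subrr normr0 !mul0r.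
have kE : k.+1%:R * h = k%:R * h + h by rewrite -natr1; ring.
have kt' : k%:R * h <= t by rewrite (le_trans _ kt)// kE lerDl.
pose z i := X h k + s * (w (k%:R * h + i%:R * h') - w (k%:R * h)) +
  i%:R * h' * b (X h k.+1).
have tE i : (k * N + i)%:R * h' = k%:R * h + i%:R * h'.
  by rewrite natrD natrM mulrDl -mulrA Nh'.
have z0 : z 0%N = X h k by rewrite /z mul0r addr0 subrr mulr0 mul0r !addr0.
have zN : z N = X h k.+1.
  rewrite /z Nh' -kE; exact/esym/(implicit_stepE cb nb _ h0).
pose D i := s * (w ((k * N + i).+1%:R * h') - w ((k * N + i)%:R * h')).
have := @implicit_stability h' (h' * (e / (t + 1))) N (fun i => X h' (k * N + i)) z D
  h'0 _ _; rewrite z0 zN addn0 -mulSnr => H.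
apply: le_trans (H _ _) _.
- by move=> i _; rewrite addnS.
- move=> i iN; rewrite /D -addnS !tE.
  have -> : z i.+1 - z i - s * (w (k%:R * h + i.+1%:R * h') - w (k%:R * h + i%:R * h')) -
      h' * b (z i.+1) = h' * (b (X h k.+1) - b (z i.+1)).
    by rewrite /z -natr1; ring.
  by rewrite normrM (ger0_norm h'0) ler_wpM2l// fine.
- by rewrite mulrA Nh' kE mulrDl lerD// IHk.
Qed.

(** Dyadic meshes are nested: each divides all coarser ones an integer number of times, as
    [coarse_fine] requires. *)
Let mesh m : R := (2 ^+ m)^-1.
Let idx m (t : R) : nat := Num.truncn (t * 2 ^+ m).
Let S m t : R := X (mesh m) (idx m t).

Let mesh_gt0 m : 0 < mesh m. Proof. by rewrite invr_gt0 exprn_gt0. Qed.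

Let idx_le m t : 0 <= t -> (idx m t)%:R * mesh m <= t.
Proof.
move=> t0; rewrite ler_pdivrMr ?exprn_gt0//.
by have /andP[] := @truncn_itv R (t * 2 ^+ m) (mulr_ge0 t0 (exprn_ge0 _ (ler0n _ 2))).
Qed.

Let idx_gt m t : 0 <= t -> t < (idx m t)%:R * mesh m + mesh m.
Proof.
move=> t0; rewrite -[V in _ + V]mul1r -mulrDl natr1 ltr_pdivlMr ?exprn_gt0//.
exact: truncnS_gt.
Qed.

Let mesh_small d : 0 < d -> exists n, forall m, (n <= m)%N -> mesh m <= d.
Proof.
move=> d0; exists (Num.truncn d^-1).+1 => m nm.
rewrite -[leRHS]invrK lef_pV2 ?posrE ?exprn_gt0 ?invr_gt0//.
rewrite (le_trans (ltW (truncnS_gt _)))//.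
apply: (@le_trans _ _ m%:R); first by rewrite ler_nat.
by rewrite -natrX ler_nat ltnW// ltn_expl.
Qed.

Let S_cauchy t e : 0 <= t -> 0 < e -> exists n, forall m m', (n <= m)%N -> (m <= m')%N ->
  `|S m' t - S m t| <= e.
Proof.
move=> t0 e0; have e2 : 0 < e / 2 by rewrite divr_gt0.
have [d1 d10 cf] := coarse_fine t0 e2.
have [M [_ [_ ctrl]]] := chain_control t0.
have [d2 [d20 Xd _ _]] := ctrl _ e2.
have d120 : 0 < Num.min d1 d2 by rewrite lt_min d10.
have [n hn] := mesh_small d120.
exists n => m m' nm mm'.
have /andP[hd1 hd2] : (mesh m <= d1) && (mesh m <= d2) by rewrite -le_min hn.
pose N := (2 ^ (m' - m))%N; have N0 : (0 < N)%N by rewrite expn_gt0.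
have hE : mesh m' = mesh m / N%:R.
  by rewrite /mesh /N natrX -invfM -exprD subnKC.
have h0 := ltW (mesh_gt0 m); have h'0 := ltW (mesh_gt0 m').
have i1 := idx_le m t0; have i1' := idx_le m' t0.
have i2 := idx_gt m t0; have i2' := idx_gt m' t0.
have NhE : N%:R * mesh m' = mesh m.
  by rewrite hE mulrC divfK// gt_eqF// ltr0n.
have kk' : (idx m t * N <= idx m' t)%N.
  rewrite -ltnS -(ltr_nat R) -natr1 natrM.
  rewrite -(ltr_pM2r (mesh_gt0 m')) mulrDl mul1r -mulrA NhE.
  exact: le_lt_trans i1 i2'.
pose i := (idx m' t - idx m t * N)%N.
have kE : idx m' t = (idx m t * N + i)%N by rewrite subnKC.
have ih : i%:R * mesh m' <= d2.
  have : (idx m' t)%:R * mesh m' = (idx m t)%:R * mesh m + i%:R * mesh m'.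
    by rewrite kE natrD natrM mulrDl -mulrA NhE.
  by lra.
rewrite -(subrK (X (mesh m') (idx m t * N)) (S m' t)) -addrA.
rewrite (le_trans (ler_normD _ _))// (splitr e) lerD//.
  by rewrite /S kE; apply: Xd => //; rewrite -kE.
by rewrite hE; exact: cf.
Qed.

Let S_cvg t : 0 <= t -> cvg (S m t @[m --> \oo]).
Proof.
move=> t0; apply/cauchy_cvgP/cauchy_exP => e e0.
have [n nP] := S_cauchy t0 (divr_gt0 e0 (ltr0n _ 2)).
exists (S n t); exists n => //= m nm.
rewrite /ball/= distrC (le_lt_trans (nP _ _ (leqnn _) nm))//.
by rewrite ltr_pdivrMr// ltr_pMr// ltr1n.
Qed.

Let Q t : R := limn (S^~ (Num.max t 0)).

Let S_lim t : 0 <= t -> S m t @[m --> \oo] --> Q t.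
Proof. by move=> t0; rewrite /Q (max_l t0); exact: S_cvg. Qed.

Let mesh_cvg : mesh m @[m --> \oo] --> 0.
Proof.
apply/(@cvgrPdist_le _ R^o) => e e0; have [n nP] := mesh_small e0.
by exists n => //= m /nP h; rewrite sub0r normrN gtr0_norm.
Qed.

Let time_cvg t : 0 <= t -> (idx m t)%:R * mesh m @[m --> \oo] --> t.
Proof.
move=> t0; apply: (@squeeze_cvgr _ _ _ _ (fun m => t - mesh m) (fun=> t)).
- apply: nearW => m; rewrite idx_le// andbT.
  by have := idx_gt m t0; lra.
- by rewrite -[V in _ --> V]subr0; apply: (@cvgB _ R^o); [exact: cvg_cst|exact: mesh_cvg].
- exact: cvg_cst.
Qed.

Let Z t := Q t - s * w t.

Let Y_cvg t : 0 <= t -> Y (mesh m) (idx m t) @[m --> \oo] --> Z t.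
Proof.
move=> t0; apply: (@cvgB _ R^o); first exact: S_lim.
apply: cvgM; first exact: cvg_cst.
apply: (@cvg_comp _ _ _ (fun m => (idx m t)%:R * mesh m) w); last exact: cw.
exact: time_cvg.
Qed.

Let increment_limit t1 t2 (c : nat -> R) (l e : R) : 0 <= t1 -> t1 <= t2 ->
  c m @[m --> \oo] --> l ->
  (\forall m \near \oo, forall i, (i < idx m t2 - idx m t1)%N ->
     `|b (X (mesh m) (idx m t1 + i).+1) - c m| <= e) ->
  `|Z t2 - Z t1 - (t2 - t1) * l| <= (t2 - t1) * e.
Proof.
move=> t10 t12 cl H; have t20 := le_trans t10 t12.
have idx12 m : (idx m t1 <= idx m t2)%N.
  by apply: le_truncn; rewrite ler_wpM2r// exprn_ge0.
have nE m : (idx m t2 - idx m t1)%:R * mesh m =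
    (idx m t2)%:R * mesh m - (idx m t1)%:R * mesh m by rewrite natrB// mulrBl.
have dt : (idx m t2 - idx m t1)%:R * mesh m @[m --> \oo] --> t2 - t1.
  under eq_fun do rewrite nE.
  by apply: (@cvgB _ R^o); exact: time_cvg.
have c1 : `|Y (mesh m) (idx m t2) - Y (mesh m) (idx m t1) -
    (idx m t2 - idx m t1)%:R * mesh m * c m| @[m --> \oo] -->
    `|Z t2 - Z t1 - (t2 - t1) * l|.
  apply: (@cvg_norm _ R^o); apply: (@cvgB _ R^o); last exact: cvgM.
  by apply: (@cvgB _ R^o); exact: Y_cvg.
have c2 : (idx m t2 - idx m t1)%:R * mesh m * e @[m --> \oo] --> (t2 - t1) * e.
  by apply: cvgM => //; exact: cvg_cst.
apply: (ler_cvg_to c1 c2); apply: filterS H => m H.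
by have := drift_sum (ltW (mesh_gt0 m)) H; rewrite subnKC.
Qed.

Let near_bounds t1 t2 d : 0 <= t1 -> t1 <= t2 -> t2 - t1 < d ->
  \forall m \near \oo, forall i, (i < idx m t2 - idx m t1)%N ->
    (idx m t1 + i.+1)%:R * mesh m <= t2 /\ i.+1%:R * mesh m <= d.
Proof.
move=> t10 t12 td; have t20 := le_trans t10 t12.
have dt0 : 0 < d - (t2 - t1) by rewrite subr_gt0.
have [n nP] := mesh_small dt0.
exists n => //= m /nP hm i ii; have h0 := ltW (mesh_gt0 m).
have idx12 : (idx m t1 <= idx m t2)%N by apply: le_truncn; rewrite ler_wpM2r// exprn_ge0.
have i2 : (idx m t1 + i.+1 <= idx m t2)%N by rewrite -(subnKC idx12) leq_add2l.
split; first by rewrite (le_trans _ (idx_le m t20))// ler_wpM2r// ler_nat.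
have : (idx m t1 + i.+1)%:R * mesh m <= (idx m t2)%:R * mesh m.
  by rewrite ler_wpM2r// ler_nat.
have := idx_le m t20; have := idx_gt m t10; rewrite natrD mulrDl.
by move: hm; lra.
Qed.

Let Z_lip t : 0 <= t -> exists2 M : R, 0 <= M & forall t1 t2, 0 <= t1 -> t1 <= t2 -> t2 <= t ->
  `|Z t2 - Z t1| <= M * (t2 - t1).
Proof.
move=> t0; have [M [M0 [bM _]]] := chain_control t0.
exists M => // t1 t2 t10 t12 t2t.
have := @increment_limit t1 t2 (fun=> 0) 0 M t10 t12 (cvg_cst _).
rewrite mulr0 subr0 mulrC; apply.
have td : t2 - t1 < t2 - t1 + 1 by rewrite ltrDl.
have := near_bounds t10 t12 td; apply: filterS => m H i /H[ti _]; rewrite subr0 -addnS; apply: bM.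
  exact: ltW.
exact: le_trans ti t2t.
Qed.

Let Z_diff t e : 0 <= t -> 0 < e -> exists2 d : R, 0 < d & forall t1 t2,
  0 <= t1 -> t1 <= t2 -> t2 <= t -> t2 - t1 <= d ->
  `|Z t2 - Z t1 - (t2 - t1) * b (Q t1)| <= (t2 - t1) * e.
Proof.
move=> t0 e0; have [M [M0 [_ ctrl]]] := chain_control t0.
have [d [d0 _ bd _]] := ctrl e e0.
exists (d / 2) => [|t1 t2 t10 t12 t2t td]; first by rewrite divr_gt0.
have td' : t2 - t1 < d.
  by rewrite (le_lt_trans td)// ltr_pdivrMr// ltr_pMr// ltr1n.
apply: (@increment_limit t1 t2 (fun m => b (S m t1))) => //.
  apply: (@cvg_comp _ _ _ (fun m => S m t1) b); last exact: cb.
  exact: S_lim.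
have := near_bounds t10 t12 td'; apply: filterS => m H i /H[ti id].
rewrite -addnS; apply: bd => //; first exact: ltW.
exact: le_trans ti t2t.
Qed.

Let Q_continuous : continuous Q.
Proof.
have cZ : continuous (fun t : R => Z (Num.max t 0)).
  move=> u; have u0 : 0 <= `|u| + 1 by rewrite addr_ge0.
  have [M M0 ZM] := Z_lip u0.
  have M1 : 0 < M + 1 by rewrite ltr_wpDl.
  apply/(@cvgrPdist_le _ R^o) => e e0.
  have m0 : 0 < Num.min 1 (e / (M + 1)) by rewrite lt_min ltr01 divr_gt0.
  near=> v.
  have vu : `|u - v| < Num.min 1 (e / (M + 1)) by near: v; exact: cvgr_dist_lt.
  move: vu; rewrite lt_min => /andP[vu1 vue].
  have aux p q : `|p - q| < e / (M + 1) -> p <= q -> q <= `|u| + 1 ->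
      `|Z (Num.max q 0) - Z (Num.max p 0)| <= e.
    move=> pq lepq qu.
    have p0 : 0 <= Num.max p 0 by rewrite le_max lexx orbT.
    have pq' : Num.max p 0 <= Num.max q 0.
      by rewrite ge_max !le_max lepq lexx orbT.
    have qt : Num.max q 0 <= `|u| + 1 by rewrite ge_max qu.
    apply: le_trans (ZM _ _ p0 pq' qt) _.
    apply: (@le_trans _ _ (M * (e / (M + 1)))); last first.
      by rewrite mulrA ler_pdivrMr// mulrC ler_pM2l// lerDl.
    rewrite ler_wpM2l//; apply: le_trans (ltW pq).
    rewrite distrC ger0_norm ?subr_ge0//.
    by have [|] := leP p 0; have [|] := leP q 0; move: lepq; lra.
  have vb : v <= `|u| + 1.
    by have := ler_norm u; have := ler_norm (v - u); rewrite distrC; move: vu1; lra.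
  have ub : u <= `|u| + 1 by have := ler_norm u; lra.
  have [uv|/ltW uv] := leP u v; last by apply: aux => //; rewrite distrC.
  by rewrite distrC; exact: aux.
have QE t : Q t = Z (Num.max t 0) + s * w (Num.max t 0).
  rewrite /Z subrK /Q; congr (limn _); apply/funext => m; congr S.
  by rewrite (max_l (_ : 0 <= Num.max t 0))// le_max lexx orbT.
have cm : continuous (fun t : R => Num.max t 0).
  move=> u; apply: continuous_max; [exact: cvg_id|exact: cvg_cst].
rewrite (_ : Q = fun t => Z (Num.max t 0) + s * w (Num.max t 0)); last exact/funext.
move=> u; apply: (@cvgD _ R^o); first exact: cZ.
apply: cvgM; first exact: cvg_cst.
apply: (@cvg_comp _ _ _ (fun t : R => Num.max t 0) w); last exact: cw.
exact: cm.
Unshelve. all: by end_near. Qed.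

(** The second conclusion, that the solution is a pointwise limit of chains, is what later makes it
    measurable in the sample point. *)
Lemma euler_limit : exists2 X' : R -> R, path_solution x w X' &
  forall t, 0 <= t ->
    euler_chain b s (2 ^+ m)^-1 x w (Num.truncn (t * 2 ^+ m)) @[m --> \oo] --> X' t.
Proof.
exists Q; last exact: S_lim.
split; first exact: Q_continuous.
have cbQ : continuous (fun u => b (Q u)).
  move=> u; apply: (@cvg_comp _ _ _ Q b); last exact: cb.
  exact: Q_continuous.
have [F dF] := continuous_antiderivative cbQ; exists F => // t t0.
suff : Z t - F t = Z 0 - F 0.
  have Q0 : Q 0 = x.
    have := @cvg_unique _ (@norm_hausdorff _ R) _ _ _ _ (S_lim (lexx 0)); apply.
    by apply: cvg_near_cst; apply: nearW => m; rewrite /S /idx mul0r truncn0.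
  by rewrite /Z Q0 w0 mulr0 subr0; move: (Q t) => ?; lra.
(* Over a short interval starting at [u], both [Z] and [F] move by [b (Q u)] times its length, up to
   [e / 2] times the length. *)
apply: (constant_of_small_increments (D := fun t => Z t - F t) t0) => e e0.
have e2 : 0 < e / 2 by rewrite divr_gt0.
have [d1 d10 Z1] := Z_diff t0 e2.
have [d2 d20 b2] := uniformly_continuous_itv t cbQ e2.
exists (Num.min d1 d2) => [|u v u0 uv vt]; first by rewrite lt_min d10.
rewrite le_min => /andP[uv1 uv2].
have -> : Z v - F v - (Z u - F u) = (Z v - Z u - (v - u) * b (Q u)) -
    ((F v - b (Q u) * v) - (F u - b (Q u) * u)) by ring.
rewrite (le_trans (ler_normB _ _))//.
rewrite (_ : e * (v - u) = (v - u) * (e / 2) + e / 2 * (v - u)); last by field.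
apply: lerD; first exact: Z1.
have dG (y : R) : is_derive y 1 (fun y => F y - b (Q u) * y) (b (Q y) - b (Q u)).
  by have q := dF y; apply: is_derive_eq; rewrite /GRing.scale/= mulr1.
have -> : e / 2 * (v - u) = e / 2 * `|v - u| by rewrite ger0_norm// subr_ge0.
apply: mean_value_bound dG _ => y; rewrite (min_idPl uv) (max_idPr uv) => /andP[uy yv].
apply: b2.
- by rewrite (le_trans u0)//= (le_trans yv).
- by rewrite u0 (le_trans uv).
- by rewrite ger0_norm ?subr_ge0// (le_trans _ uv2)// lerD2r.
Qed.

End existence.
End path_solution.

(** * The drift and the stationary weight *)

Section exponential_decay.
Context {R : realType}.
Local Notation leb := (@lebesgue_measure R).

Lemma integrable_expR_norm (k : R) : 0 < k ->
  leb.-integrable setT (EFin \o (fun x : R => expR (- k * `|x|))).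
Proof.
move=> k0.
have cN : continuous (fun x : R => - k * `|x|).
  by move=> x; apply: cvgM; [exact: cvg_cst|apply: (@cvg_norm _ R^o); exact: cvg_id].
have cf : continuous (fun x : R => expR (- k * `|x|)).
  by move=> x; apply: (@cvg_comp _ _ _ _ expR); [exact: cN|exact: continuous_expR].
have mf : measurable_fun setT (fun x : R => expR (- k * `|x|)).
  exact: continuous_measurable_fun.
apply/integrableP; split; first exact/measurable_EFinP.
have -> : (\int[leb]_x `|(EFin \o (fun x : R => expR (- k * `|x|))) x| =
    \int[leb]_x (expR (- k * `|x|))%:E)%E.
  by apply: eq_integral => x _; rewrite /= ger0_norm// expR_ge0.
rewrite (ge0_symfun_integralT _ cf)//; last by move=> x /=; rewrite normrN.
have m0 : measurable [set x : R | 0 <= x] by rewrite -set_itvcy.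
suff : (\int[leb]_(x in [set x | (0 <= x)%R]) (expR (- k * `|x|))%:E <= (k^-1)%:E)%E.
  by move=> h; rewrite lte_mul_pinfty// (le_lt_trans h)// ltry.
apply: (@le_trans _ _ (\int[leb]_(x in [set x | (0 <= x)%R])
    ((k^-1)%:E * (exponential_pdf k x)%:E)%E)%E).
  rewrite le_eqVlt; apply/orP; left; apply/eqP; apply: eq_integral => x.
  rewrite inE/= => x0; rewrite exponential_pdfE// -EFinM; congr EFin.
  by rewrite mulrA mulVf ?mul1r ?gt_eqF// ger0_norm.
have mpdf : measurable_fun setT (exponential_pdf k) by exact: measurable_exponential_pdf.
rewrite ge0_integralZl//; last 3 first.
- by apply: measurable_funTS; exact/measurable_EFinP.
- by move=> x _; rewrite lee_fin exponential_pdf_ge0// ltW.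
- by rewrite lee_fin invr_ge0 ltW.
rewrite -[leRHS]mule1; apply: lee_wpmul2l; first by rewrite lee_fin invr_ge0 ltW.
rewrite -(integral_exponential_pdf k0); apply: ge0_subset_integral => //.
- exact/measurable_EFinP.
- by move=> x _; rewrite lee_fin exponential_pdf_ge0// ltW.
Qed.

Lemma max0_contraction (x y : R) : `|Num.max x 0 - Num.max y 0| <= `|x - y|.
Proof.
have := ler_norm (x - y); have := ler_norm (y - x); rewrite (distrC y x).
have := normr_ge0 (x - y); rewrite ler_norml.
by have [|] := leP x 0; have [|] := leP y 0; lra.
Qed.

Lemma continuous_of_local_lipschitz (f : R -> R) :
  (forall r, exists2 L : R, 0 <= L & forall x y, `|x| <= r -> `|y| <= r ->
     `|f x - f y| <= L * `|x - y|) -> continuous f.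
Proof.
move=> fL x; have [L L0 xL] := fL (`|x| + 1).
have L1 : 0 < L + 1 by rewrite ltr_wpDl.
apply/(@cvgrPdist_le _ R^o) => e e0.
have m0 : 0 < Num.min 1 (e / (L + 1)) by rewrite lt_min ltr01 divr_gt0.
near=> y.
have : `|x - y| < Num.min 1 (e / (L + 1)) by near: y; exact: cvgr_dist_lt.
rewrite lt_min => /andP[xy1 xye].
have xr : `|x| <= `|x| + 1 by rewrite lerDl.
have yr : `|y| <= `|x| + 1.
  rewrite -(subrK x y) addrC (le_trans (ler_normD _ _))// lerD2l distrC.
  exact: ltW.
apply: le_trans (xL x y xr yr) _.
apply: (@le_trans _ _ (L * (e / (L + 1)))); first by rewrite ler_wpM2l// ltW.
by rewrite mulrA ler_pdivrMr// mulrC ler_pM2l// lerDl.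
Unshelve. all: by end_near. Qed.

(** Beyond [r] the slope of [B] is at least [a] in modulus and directed towards the origin, so
    [B x <= M + a r - a |x|] and the exponential decays exponentially in [|x|]. *)
Lemma log_derivative_integrable (b B : R -> R) (k a r : R) :
  (forall x : R, is_derive x 1 B (b x)) -> 0 < k -> 0 < a -> 0 <= r ->
  (forall x, r <= x -> b x <= - a) -> (forall x, x <= - r -> a <= b x) ->
  leb.-integrable setT (EFin \o (fun x => expR (k * B x))).
Proof.
move=> dB k0 a0 r0 br bNr.
have cB := is_derive_continuous dB.
have [M M0 BM] := continuous_norm_bounded r0 cB.
have ka0 : 0 < k * a by rewrite mulr_gt0.
have mw : measurable_fun setT (fun x => expR (k * B x)).
  by apply: measurableT_comp => //; apply: measurable_funM => //; exact: continuous_measurable_fun.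
have bound x : B x <= M + a * r - a * `|x|.
  have [xr|xr] := leP `|x| r.
    have := BM x xr; have := ler_norm (B x).
    have : a * `|x| <= a * r by rewrite ler_wpM2l// ltW.
    by lra.
  have [x0|x0] := leP 0 x.
    move: xr; rewrite ger0_norm// => xr.
    have [c] := @MVT_segment _ B b r x (ltW xr) (fun y _ => dB y)
      (continuous_subspaceT cB).
    rewrite in_itv/= => /andP[rc cx] BE.
    have := BM r; rewrite ger0_norm// lexx => /(_ isT); have := ler_norm (B r).
    have : b c * (x - r) <= - a * (x - r).
      by rewrite ler_wpM2r ?br// subr_ge0 ltW.
    by lra.
  move: xr; rewrite ltr0_norm// => xr; have xr' : x <= - r by rewrite lerNr ltW.
  have [c] := @MVT_segment _ B b x (- r) xr' (fun y _ => dB y)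
    (continuous_subspaceT cB).
  rewrite in_itv/= => /andP[xc cr] BE.
  have := BM (- r); rewrite normrN ger0_norm// lexx => /(_ isT); have := ler_norm (B (- r)).
  have : a * (- r - x) <= b c * (- r - x).
    by rewrite ler_wpM2r ?bNr// subr_ge0.
  by lra.
apply: (@le_integrable _ _ _ leb setT measurableT _
  (EFin \o (fun x => expR (k * (M + a * r)) * expR (- (k * a) * `|x|)))).
- exact/measurable_EFinP.
- move=> x _; rewrite /= lee_fin !normrM !(ger0_norm (expR_ge0 _)) -expRD ler_expR.
  by have := bound x; rewrite -(ler_pM2l k0); lra.
- exact: (integrableZl measurableT _ (integrable_expR_norm ka0)).
Qed.

End exponential_decay.

(** * Monotonicity, regularity and dissipativity of the drift *)

Section drift.
Context {R : realType}.
Local Notation leb := (@lebesgue_measure R).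
Variables (lambda c : R) (H1 Hm1 : R -> R).

Definition drift (x : R) : R :=
  c - lambda * H1 (Num.max x 0 / lambda) + lambda * Hm1 (Num.max 0 (- x) / lambda).

Hypothesis lambda_gt0 : 0 < lambda.
Hypotheses (H1_nd : nondecreasing_on_nneg H1) (Hm1_nd : nondecreasing_on_nneg Hm1).
Hypotheses (H1_lip : locally_lipschitz_on_nneg H1)
  (Hm1_lip : locally_lipschitz_on_nneg Hm1).

(** At time 0 every prelimit is zero. Because [H1] and [Hm1] vanish at 0, only one of them acts on
    each side of the origin. *)
Lemma scaled_cdf_limit0 (H : R -> R) : scaled_cdf_limit H -> H 0 = 0.
Proof.
move=> [F [F0 /(_ 0 (lexx 0)) h]].
apply: (@cvg_unique _ (@norm_hausdorff _ R) _ _ _ _ h).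
by apply: cvg_near_cst; apply: nearW => n; rewrite mul0r F0 mulr0.
Qed.

Let pos_ge0 x : 0 <= Num.max x 0 / lambda.
Proof. by rewrite divr_ge0 ?(ltW lambda_gt0)// le_max lexx orbT. Qed.
Let neg_ge0 x : 0 <= Num.max 0 (- x) / lambda.
Proof. by rewrite divr_ge0 ?(ltW lambda_gt0)// le_max lexx. Qed.

Lemma drift_nonincreasing x y : x <= y -> drift y <= drift x.
Proof.
move=> xy; rewrite /drift lerD//.
  rewrite lerD2l lerN2 ler_pM2l// H1_nd ?pos_ge0// ler_pM2r ?invr_gt0//.
  by rewrite ge_max !le_max xy lexx orbT.
rewrite ler_pM2l// Hm1_nd ?neg_ge0// ler_pM2r ?invr_gt0//.
by rewrite ge_max !le_max lexx lerN2 xy orbT.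
Qed.

Lemma drift_local_lipschitz r : exists2 L : R, 0 <= L & forall x y,
  `|x| <= r -> `|y| <= r -> `|drift x - drift y| <= L * `|x - y|.
Proof.
have [r0|r0] := ltP r 0.
  by exists 0 => // x y xr; have := le_lt_trans xr r0; rewrite ltNge normr_ge0.
have rl0 : 0 <= r / lambda by rewrite divr_ge0// ltW.
have [L1 L10 h1] := H1_lip rl0; have [L2 L20 h2] := Hm1_lip rl0.
exists (L1 + L2) => [|x y xr yr]; first by rewrite addr_ge0// ltW.
have aux (H : R -> R) (L p q : R) : L.-lipschitz_(`[0, r / lambda]) H ->
    0 <= L -> `|p| <= r -> `|q| <= r ->
    `|lambda * H (Num.max p 0 / lambda) - lambda * H (Num.max q 0 / lambda)| <= L * `|p - q|.
  move=> hL L0 pr qr.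
  have mem u : `|u| <= r -> Num.max u 0 / lambda \in `[0, r / lambda].
    move=> ur; rewrite in_itv/= pos_ge0/= ler_pM2r ?invr_gt0// ge_max r0 andbT.
    exact: le_trans (ler_norm _) ur.
  have := hL (Num.max p 0 / lambda, Num.max q 0 / lambda) (conj (mem p pr) (mem q qr)) => /= hh.
  rewrite -mulrBr normrM gtr0_norm//.
  rewrite -[leRHS]mulr1 -(divff (lt0r_neq0 lambda_gt0)) mulrCA ler_pM2l//.
  apply: le_trans hh _; rewrite -mulrBl normrM normfV (gtr0_norm lambda_gt0) -[leRHS]mulrA.
  by rewrite ler_wpM2l// ler_pM2r ?invr_gt0// max0_contraction.
have -> : drift x - drift y =
    - (lambda * H1 (Num.max x 0 / lambda) - lambda * H1 (Num.max y 0 / lambda)) +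
    (lambda * Hm1 (Num.max (- x) 0 / lambda) - lambda * Hm1 (Num.max (- y) 0 / lambda)).
  by rewrite /drift !(maxC 0); ring.
rewrite (le_trans (ler_normD _ _))// normrN mulrDl lerD//.
  exact: aux (ltW L10) xr yr.
rewrite (_ : `|x - y| = `|- x - - y|); last by rewrite -opprD normrN.
by apply: aux (ltW L20) _ _; rewrite ?normrN.
Qed.

Lemma drift_continuous : continuous drift.
Proof. exact: continuous_of_local_lipschitz drift_local_lipschitz. Qed.

Hypotheses (H10 : H1 0 = 0) (Hm10 : Hm1 0 = 0).

Lemma drift_nneg x : 0 <= x -> drift x = c - lambda * H1 (x / lambda).
Proof.
by move=> x0; rewrite /drift max_l// max_l ?oppr_le0// mul0r Hm10 mulr0 addr0.
Qed.

Lemma drift_npos x : x <= 0 -> drift x = c + lambda * Hm1 (- x / lambda).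
Proof.
by move=> x0; rewrite /drift max_r// max_r ?oppr_ge0// mul0r H10 mulr0 subr0.
Qed.

(** [H] is monotone only on the half-line, so the existence of its limit is obtained from the
    monotone extension [H'], which agrees with [H] near infinity. A bound [H <= l] would then pass
    to the limit. *)
Lemma limit_exceeded (H : R -> R) (l : R) : nondecreasing_on_nneg H ->
  (l%:E < lim ((H x)%:E @[x --> +oo%R]))%E -> exists2 x, 0 <= x & l < H x.
Proof.
move=> Hnd; apply: contraPP => nx.
have Hl x : 0 <= x -> H x <= l by move=> x0; rewrite leNgt; apply/negP => h; apply: nx; exists x.
apply/negP; rewrite -leNgt.
pose H' x := (H (Num.max x 0))%:E.
have H'cvg : cvg (H' x @[x --> +oo%R]).
  apply: nondecreasing_is_cvge => x y xy; rewrite lee_fin; apply: Hnd.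
    by rewrite le_max lexx orbT.
  by rewrite ge_max !le_max xy lexx orbT.
have E : (\forall x \near +oo%R, H' x = (H x)%:E).
  near=> x; rewrite /H' max_l//; near: x; exact: nbhs_pinfty_ge.
have Hc : (H x)%:E @[x --> +oo%R] --> lim (H' x @[x --> +oo%R]).
  by apply: cvg_trans H'cvg; exact: near_eq_cvg.
rewrite (cvg_lim _ Hc)//.
apply: lime_le => //; near=> x.
by rewrite lee_fin Hl// le_max lexx orbT.
Unshelve. all: by end_near. Qed.

(** On the right, if [c < 0] the drift is already at most [c] by monotonicity; if [c >= 0] the limit
    hypothesis provides a point where [lambda H1] exceeds [c], and monotonicity extends the gap. The
    left side is symmetric. *)
Lemma drift_dissipative :
  (0 <= c -> ((c / lambda)%:E < lim ((H1 x)%:E @[x --> +oo%R]))%E) ->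
  (c <= 0 -> ((- (c / lambda))%:E < lim ((Hm1 x)%:E @[x --> +oo%R]))%E) ->
  exists a r : R, [/\ 0 < a, 0 <= r,
    forall x, r <= x -> drift x <= - a & forall x, x <= - r -> a <= drift x].
Proof.
move=> h1 h2.
have [a1 [r1 [a10 r10 b1]]] : exists a1 r1 : R, [/\ 0 < a1, 0 <= r1 &
    forall x, r1 <= x -> drift x <= - a1].
  have [c0|c0] := leP 0 c.
    have [x0 x00 cx] := limit_exceeded H1_nd (h1 c0).
    exists (lambda * H1 x0 - c), (lambda * x0); split.
    - by rewrite subr_gt0 mulrC -ltr_pdivrMr.
    - by rewrite mulr_ge0// ltW.
    - move=> x xx0; have x0' : 0 <= x by rewrite (le_trans _ xx0)// mulr_ge0// ltW.
      rewrite drift_nneg// opprB lerD2l lerN2 ler_pM2l// H1_nd//.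
      by rewrite ler_pdivlMr// mulrC.
  exists (- c), 0; split => //; first by rewrite oppr_gt0.
  by move=> x x0; rewrite opprK (le_trans (drift_nonincreasing x0))// drift_nneg// mul0r H10 mulr0 subr0.
have [a2 [r2 [a20 r20 b2]]] : exists a2 r2 : R, [/\ 0 < a2, 0 <= r2 &
    forall x, x <= - r2 -> a2 <= drift x].
  have [c0|c0] := leP c 0.
    have [x0 x00 cx] := limit_exceeded Hm1_nd (h2 c0).
    exists (lambda * Hm1 x0 + c), (lambda * x0); split.
    - by rewrite -ltrBlDr sub0r mulrC -ltr_pdivrMr// mulNr.
    - by rewrite mulr_ge0// ltW.
    - move=> x xx0; have xx : lambda * x0 <= - x by rewrite lerNr.
      have x0' : x <= 0 by rewrite (le_trans xx0)// oppr_le0 mulr_ge0// ltW.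
      rewrite drift_npos// addrC lerD2l ler_pM2l// Hm1_nd//.
      by rewrite ler_pdivlMr// mulrC.
  exists c, 0; split => // x; rewrite oppr0 => x0.
  by rewrite (le_trans _ (drift_nonincreasing x0))// drift_nneg// mul0r H10 mulr0 subr0.
exists (Num.min a1 a2), (Num.max r1 r2); split.
- by rewrite lt_min a10.
- by rewrite le_max r10.
- move=> x; rewrite ge_max => /andP[x1 _]; rewrite (le_trans (b1 x x1))// lerN2.
  by rewrite ge_min lexx.
- move=> x; rewrite lerNr ge_max => /andP[_ x2]; rewrite lerNr in x2.
  by rewrite (le_trans _ (b2 x x2))// ge_min lexx orbT.
Qed.

End drift.

(** * The explicit weight and the integral equation in terms of the drift *)

Section sde.
Context {R : realType}.
Local Notation leb := (@lebesgue_measure R).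
Variables (lambda c sigma1 sigmam1 : R) (H1 Hm1 : R -> R).
Hypothesis lambda_gt0 : 0 < lambda.
Hypotheses (H1_lip : locally_lipschitz_on_nneg H1)
  (Hm1_lip : locally_lipschitz_on_nneg Hm1).
Hypotheses (H10 : H1 0 = 0) (Hm10 : Hm1 0 = 0).
Local Notation b := (drift lambda c H1 Hm1).
Local Notation s := (Num.sqrt (lambda ^+ 3 * (sigma1 ^+ 2 + sigmam1 ^+ 2))).

Lemma locally_lipschitz_continuous (H : R -> R) : locally_lipschitz_on_nneg H ->
  continuous (fun x : R => H (Num.max x 0)).
Proof.
move=> hH; apply: continuous_of_local_lipschitz => r.
have [r0|r0] := ltP r 0.
  by exists 0 => // x y xr; have := le_lt_trans xr r0; rewrite ltNge normr_ge0.
have [L L0 hL] := hH r r0; exists L; first exact: ltW.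
move=> x y xr yr.
have mem u : `|u| <= r -> Num.max u 0 \in `[0, r].
  move=> ur; rewrite in_itv/= le_max lexx orbT/= ge_max r0 andbT.
  exact: le_trans (ler_norm _) ur.
have := hL (Num.max x 0, Num.max y 0) (conj (mem x xr) (mem y yr)) => /= /le_trans; apply.
by rewrite ler_pM2l// max0_contraction.
Qed.

Lemma integral_antiderivative (f g G : R -> R) (t : R) : 0 <= t -> continuous g ->
  (forall x : R, is_derive x 1 G (g x)) -> (forall u, 0 <= u -> u <= t -> f u = g u) ->
  (\int[leb]_(u in `[0, t]) f u)%R = G t - G 0.
Proof.
move=> t0 cg dG fg; rewrite /Rintegral.
have /(congr1 (@fine R)) := integral_derivative t0 dG cg; rewrite [fine (_ - _)%:E]/= => <-.
apply: (congr1 (@fine R)); apply: eq_integral => u.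
by rewrite inE/= in_itv/= => /andP[u0 ut]; rewrite fg.
Qed.

(** Both branches are the exponential of [2 / sg] times the integral of the drift from 0 to [x],
    with [sg] the squared diffusion coefficient. The factor [lambda^2] combines the [lambda] in
    front of [H1] and [Hm1] with the rescaling of the variable. *)
Lemma stationary_weightE (F : R -> R) : (forall x : R, is_derive x 1 F (b x)) ->
  forall x, stationary_weight lambda c sigma1 sigmam1 H1 Hm1 x =
    expR (2 / (lambda ^+ 3 * (sigma1 ^+ 2 + sigmam1 ^+ 2)) * (F x - F 0)).
Proof.
move=> dF x; rewrite /stationary_weight.
set k := 2 / _.
have l0 := lt0r_neq0 lambda_gt0.
have c1 := locally_lipschitz_continuous H1_lip.
have cm1 := locally_lipschitz_continuous Hm1_lip.
have [x0|x0] := leP 0 x.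
  have [G dG] := continuous_antiderivative c1.
  have xl : 0 <= x / lambda by rewrite divr_ge0// ltW.
  rewrite (integral_antiderivative xl c1 dG); last by move=> u u0 _; rewrite max_l.
  congr expR; rewrite mulNr -mulrN; congr (k * _).
  pose D y := F y - c * y + lambda ^+ 2 * G (y / lambda).
  have dD (y : R) : is_derive y 1 D (b y - c + lambda * H1 (Num.max (y / lambda) 0)).
    have dGl : is_derive y 1 (G \o (fun y => y / lambda)) (H1 (Num.max (y / lambda) 0) * lambda^-1).
      by apply: is_derive1_comp; apply: is_derive_eq; rewrite /GRing.scale/=; ring.
    rewrite /D; apply: is_derive_eq; rewrite /GRing.scale/=.
    by field.
  have : D x = D 0.
    apply: mean_value_const dD _ => y; rewrite (min_idPl x0) => /andP[y0 _].
    rewrite drift_nneg// max_l ?divr_ge0 ?(ltW lambda_gt0)//; ring.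
  by rewrite /D mul0r mulr0 subr0 => /(canRL (addrK _)); lra.
have [G dG] := continuous_antiderivative cm1.
have xl : 0 <= - x / lambda by rewrite divr_ge0 ?oppr_ge0 ?(ltW x0) ?(ltW lambda_gt0).
rewrite (integral_antiderivative xl cm1 dG); last by move=> u u0 _; rewrite max_l.
congr expR; rewrite mulNr -mulrN; congr (k * _).
pose D y := F y - c * y + lambda ^+ 2 * G (- y / lambda).
have dD (y : R) : is_derive y 1 D (b y - c - lambda * Hm1 (Num.max (- y / lambda) 0)).
  have dGl : is_derive y 1 (G \o (fun y => - y / lambda)) (Hm1 (Num.max (- y / lambda) 0) * - lambda^-1).
    by apply: is_derive1_comp; apply: is_derive_eq; rewrite /GRing.scale/=; ring.
  rewrite /D; apply: is_derive_eq; rewrite /GRing.scale/=.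
  by field.
have : D x = D 0.
  apply: mean_value_const dD _ => y; rewrite (min_idPr (ltW x0)) (max_idPl (ltW x0)) => /andP[_ y0].
  rewrite drift_npos// max_l ?divr_ge0 ?oppr_ge0 ?(ltW lambda_gt0)//; ring.
by rewrite /D oppr0 mul0r mulr0 subr0 => /(canRL (addrK _)); lra.
Qed.

Lemma drift_integral (X F : R -> R) (t : R) : continuous X ->
  (forall t : R, is_derive t 1 F (b (X t))) -> 0 <= t ->
  F t - F 0 = c * t
    - lambda * (\int[leb]_(u in `[0, t]) H1 (Num.max (X u) 0 / lambda))%R
    + lambda * (\int[leb]_(u in `[0, t]) Hm1 (Num.max 0 (- X u) / lambda))%R.
Proof.
move=> cX dF t0.
have li : 0 <= lambda^-1 by rewrite invr_ge0 ltW.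
have c1 : continuous (fun u : R => H1 (Num.max (X u) 0 / lambda)).
  rewrite (_ : (fun u => _) = (fun x : R => H1 (Num.max x 0)) \o (fun u => X u / lambda)).
    move=> u; apply: continuous_comp; last exact: locally_lipschitz_continuous.
    by apply: cvgM; [exact: cX|exact: cvg_cst].
  by apply/funext => u /=; rewrite maxr_pMl// mul0r.
have cm1 : continuous (fun u : R => Hm1 (Num.max 0 (- X u) / lambda)).
  rewrite (_ : (fun u => _) = (fun x : R => Hm1 (Num.max x 0)) \o (fun u => - X u / lambda)).
    move=> u; apply: continuous_comp; last exact: locally_lipschitz_continuous.
    by apply: cvgM; [apply: (@cvgN _ R^o); exact: cX|exact: cvg_cst].
  by apply/funext => u /=; rewrite maxC maxr_pMl// mul0r.
have [G dG] := continuous_antiderivative c1.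
have [Gm dGm] := continuous_antiderivative cm1.
rewrite (integral_antiderivative t0 c1 dG)// (integral_antiderivative t0 cm1 dGm)//.
pose D u := F u - c * u + lambda * G u - lambda * Gm u.
have dD (u : R) : is_derive u 1 D 0.
  by rewrite /D; apply: is_derive_eq; rewrite /GRing.scale/= /drift; ring.
have := @mean_value_const _ D (fun=> 0) 0 t dD (fun _ _ => erefl).
by rewrite /D; lra.
Qed.

Lemma sde_path_solution (x : R) (w X : R -> R) :
  {within `[0, +oo[, continuous X} -> sde_path lambda c sigma1 sigmam1 H1 Hm1 x w X ->
  path_solution b s x (fun t => w (Num.max t 0)) (fun t => X (Num.max t 0)).
Proof.
move=> /continuous_extension cX XE; split => //.
have cb : continuous b by exact: drift_continuous.
have cbX : continuous (fun t : R => b (X (Num.max t 0))).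
  by move=> t; apply: (@cvg_comp _ _ _ (fun t : R => X (Num.max t 0)) b); [exact: cX|exact: cb].
have [F dF] := continuous_antiderivative cbX.
exists F => // t t0; rewrite (drift_integral cX dF t0) (max_l t0) XE//.
have EX (f : R -> R) : (\int[leb]_(u in `[0, t]) f (X (Num.max u 0)))%R =
    (\int[leb]_(u in `[0, t]) f (X u))%R.
  by apply: eq_Rintegral => u; rewrite inE/= in_itv/= => /andP[u0 _]; rewrite max_l.
rewrite (EX (fun y => H1 (Num.max y 0 / lambda))).
by rewrite (EX (fun y => Hm1 (Num.max 0 (- y) / lambda))) !addrA.
Qed.

Lemma path_solution_sde (x : R) (w X : R -> R) : path_solution b s x w X ->
  sde_path lambda c sigma1 sigmam1 H1 Hm1 x w X.
Proof.
move=> [cX [F dF XE]] t t0; rewrite XE// (drift_integral cX dF t0); ring.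
Qed.

End sde.

(** * Existence of diffusions *)

Lemma density_probability (R : realType) (p : R -> R) : (forall x, 0 <= p x) ->
  (@lebesgue_measure R).-integrable setT (EFin \o p) ->
  (\int[lebesgue_measure]_x (p x)%:E = 1)%E ->
  exists pi : probability (measurableTypeR R) R,
    forall A, measurable A -> pi A = (\int[lebesgue_measure]_(x in A) (p x)%:E)%E.
Proof.
move=> p0 ip p1.
pose m (A : set (measurableTypeR R)) : \bar R := (\int[lebesgue_measure]_(x in A) (p x)%:E)%E.
have m0 : m set0 = 0%E by rewrite /m integral_set0.
have m_ge0 A : (0 <= m A)%E by apply: integral_ge0 => x _; rewrite lee_fin.
have m_sigma : semi_sigma_additive m.
  move=> /= A mA tA mUA; rewrite /m integral_bigcup//=; last first.
    exact: integrableS ip.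
  apply: is_cvg_ereal_nneg_natsum_cond => n _ _; exact: m_ge0.
have mT : m setT = 1%E by exact: p1.
pose m1 := isMeasure.Build _ _ _ m m0 m_ge0 m_sigma.
pose mu : {measure set (measurableTypeR R) -> \bar R} := HB.pack m m1.
pose m2 := @Measure_isProbability.Build _ _ R mu mT.
pose pi : probability (measurableTypeR R) R := HB.pack m m1 m2.
by exists pi.
Qed.

Section existence.
Context d (T : measurableType d) (R : realType) (P : probability T R).

Lemma euler_chain_eq_path (b : R -> R) (s h x : R) (w w' : R -> R) n : 0 <= h ->
  (forall t, 0 <= t -> w t = w' t) ->
  euler_chain b s h x w n = euler_chain b s h x w' n.
Proof.
by move=> h0 ww'; elim: n => //= n ->; rewrite !ww'// mulr_ge0.
Qed.

(** An almost sure property need not hold on a measurable set; a measurable one of full measure is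
    extracted so that its indicator is a random variable. *)
Lemma ae_good_set (C : T -> Prop) : {ae P, forall t, C t} ->
  exists A : set T, [/\ measurable A, {ae P, forall t, A t} & forall t, A t -> C t].
Proof.
move=> [N [mN PN CN]]; exists (~` N); split.
- exact: measurableC.
- by exists N; split => // t; rewrite /= notK.
- by move=> t; apply: contra_notP => nC; exact: CN.
Qed.

Variables (b : R -> R) (s r : R).
Hypotheses (cb : continuous b) (nb : forall x y, x <= y -> b y <= b x).
Hypothesis b_lip : forall r, exists2 L : R, 0 <= L & forall x y,
  `|x| <= r -> `|y| <= r -> `|b x - b y| <= L * `|x - y|.
Hypotheses (br : forall x, r <= x -> b x <= 0)
  (bNr : forall x, x <= - r -> 0 <= b x).
Variables (W : R -> {RV P >-> R}) (q : {RV P >-> R}).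
Hypothesis W_bm : standard_brownian_motion W.

Lemma path_solution_rv : exists Q : R -> {RV P >-> R},
  {ae P, forall w, exists2 X,
    path_solution b s (q w) (fun t => W (Num.max t 0) w) X &
    forall t, 0 <= t -> Q t w = X t}.
Proof.
have [W0 Wc _ _] := W_bm.
have [G [mG aeG GC]] : exists A : set T, [/\ measurable A, {ae P, forall t, A t} &
    forall w, A w -> W 0 w = 0 /\ {within `[0, +oo[, continuous (fun t => W t w)}].
  by apply: ae_good_set; apply: filterS2 W0 Wc => w.
pose w_ (w : T) (t : R) : R := W (Num.max t 0) w.
have solG w : G w -> exists X, path_solution b s (q w) (w_ w) X /\ forall t, 0 <= t ->
    euler_chain b s (2 ^+ m)^-1 (q w) (w_ w) (Num.truncn (t * 2 ^+ m)) @[m --> \oo] --> X t.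
  move=> /GC[w0 cw].
  have [||X XS XC] := @euler_limit R b s cb nb b_lip r br bNr (q w) (w_ w).
  - exact: (continuous_extension cw).
  - by rewrite /w_ /= maxxx.
  by exists X.
(* The path is chosen separately for each sample point, which says nothing about measurability. That
   comes from the chains: multiplied by the indicator of [G] they converge everywhere, to this path
   on [G] and to 0 elsewhere. *)
pose X w : R -> R := if pselect (G w) is left Gw then sval (cid (solG w Gw)) else (fun=> 0).
have XP w (Gw : G w) : path_solution b s (q w) (w_ w) (X w) /\ forall t, 0 <= t ->
    euler_chain b s (2 ^+ m)^-1 (q w) (w_ w) (Num.truncn (t * 2 ^+ m)) @[m --> \oo] --> X w t.
  by rewrite /X; case: pselect => // Gw'; exact: svalP (cid (solG w Gw')).
have mX t : measurable_fun setT (fun w => X w (Num.max t 0)).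
  pose n m := Num.truncn (Num.max t 0 * 2 ^+ m).
  have h0 m : 0 <= (2 ^+ m)^-1 :> R by rewrite invr_ge0 exprn_ge0.
  apply: (@measurable_fun_cvg _ _ _ setT
    (fun m w => euler_rv b s W q (2 ^+ m)^-1 (n m) w * \1_G w)).
    move=> m; apply: measurable_funM; first exact: measurable_euler_rv.
    exact: measurable_indic.
  move=> w _; have [Gw|nGw] := pselect (G w).
    rewrite indicE mem_set//; under eq_fun do rewrite mulr1.
    have [_ /(_ (Num.max t 0))] := XP w Gw; rewrite le_max lexx orbT => /(_ isT).
    rewrite (_ : (fun m => euler_rv b s W q (2 ^+ m)^-1 (n m) w) =
      (fun m => euler_chain b s (2 ^+ m)^-1 (q w) (w_ w) (n m)))//.
    apply/funext => m; apply: euler_chain_eq_path => // u u0.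
    by rewrite /w_ max_l.
  rewrite indicE memNset//; under eq_fun do rewrite mulr0.
  rewrite /X; case: pselect => // _; exact: cvg_cst.
pose Q t : {RV P >-> R} := rv_of P (mX t).
exists Q; apply: filterS aeG => w Gw; exists (X w); first by have [] := XP w Gw.
by move=> t t0; rewrite /Q/= max_l.
Qed.

End existence.

(** * Enlarging the space by an independent initial state *)

Section independent_initial_state.
Context d (T : measurableType d) (R : realType) (P : probability T R)
  (mu : probability (measurableTypeR R) R).

Definition joint_law : probability (measurableTypeR R * T)%type R := (mu \x P)%E.

Local Notation PP := joint_law.

Lemma joint_lawX (A : set (measurableTypeR R)) (B : set T) : measurable A -> measurable B ->
  PP (A `*` B) = (mu A * P B)%E.
Proof. exact: product_measure1E. Qed.

Lemma joint_law_fst (A : set (measurableTypeR R)) : measurable A -> PP (fst @^-1` A) = mu A.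
Proof.
move=> mA; rewrite (_ : fst @^-1` A = A `*` setT); last first.
  by apply/seteqP; split => -[x y] //= [].
by rewrite joint_lawX// probability_setT mule1.
Qed.

Lemma joint_law_snd (A : set T) : measurable A -> PP (snd @^-1` A) = P A.
Proof.
move=> mA; rewrite (_ : snd @^-1` A = setT `*` A); last first.
  by apply/seteqP; split => -[x y] //= [].
rewrite joint_lawX//; apply: etrans (mul1e _).
exact: (congr1 (fun e => e * P A)%E (@probability_setT _ _ _ mu)).
Qed.

Lemma ae_product_snd (C : T -> Prop) : {ae P, forall t, C t} -> {ae PP, forall z, C z.2}.
Proof.
move=> [N [mN PN CN]]; exists (snd @^-1` N); split.
- by rewrite -[X in measurable X]setTI; exact: measurable_snd.
- by rewrite joint_law_snd.
- by move=> z /= nC; exact: CN.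
Qed.

Variable W : R -> {RV P >-> R}.

Lemma measurable_comp_snd (X : {RV P >-> R}) :
  measurable_fun setT (fun z : measurableTypeR R * T => X z.2).
Proof. exact: measurableT_comp. Qed.

Definition rv_snd (X : {RV P >-> R}) : {RV PP >-> R} := rv_of PP (measurable_comp_snd X).

Lemma measurable_initial :
  @measurable_fun _ _ (measurableTypeR R * T)%type R setT fst.
Proof. exact: (@measurable_fst _ _ (measurableTypeR R) T). Qed.

Definition rv_fst : {RV PP >-> R} := rv_of PP measurable_initial.

(** The preimages under [snd] of events of [W] form a sigma-algebra that contains the generators. *)
Lemma sigma_process_snd (I : set R) :
  sigma_process I (fun t => rv_snd (W t)) `<=`
  [set C | exists2 B, sigma_process I W B & C = snd @^-1` B].
Proof.
apply: smallest_sub; last first.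
  move=> _ [t It [A mA <-]]; exists (W t @^-1` A); last by rewrite setTI.
  by apply: sub_sigma_algebra; exists t => //; exists A => //; rewrite setTI.
split.
- by exists set0 => //; exact: (@measurable0 _ (g_sigma_algebraType _)).
- move=> _ [B sB ->]; exists (~` B); last by rewrite setTD.
  exact: (@measurableC _ (g_sigma_algebraType _)).
- move=> A sA; have /choice[B BA] n : exists B, sigma_process I W B /\ A n = snd @^-1` B.
    by have [B sB AB] := sA n; exists B.
  exists (\bigcup_n B n).
    by apply: (@bigcup_measurable _ (g_sigma_algebraType _)) => n _; have [] := BA n.
  by rewrite preimage_bigcup; apply: eq_bigcupr => n _; have [] := BA n.
Qed.

Lemma brownian_motion_snd : standard_brownian_motion W ->
  standard_brownian_motion (fun t => rv_snd (W t)).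
Proof.
move=> [W0 Wc incr law]; split.
- exact: ae_product_snd W0.
- exact: ae_product_snd Wc.
- move=> s t s0 st _ _ /sigma_process_snd[A sA ->] [B mB <-].
  have sB : sigma_rv (W t \- W s) ((W t \- W s) @^-1` B) by exists B => //; rewrite setTI.
  have mA := sigma_process_measurable sA.
  have mB' : measurable ((W t \- W s) @^-1` B).
    rewrite -[X in measurable X]setTI.
    by apply: (measurable_funB (measurable_funP (W t)) (measurable_funP (W s))).
  rewrite setTI (_ : _ @^-1` B = snd @^-1` ((W t \- W s) @^-1` B))//.
  rewrite -preimage_setI !joint_law_snd//; last exact: measurableI.
  exact: incr sA sB.
- move=> s t s0 st A mA.
  rewrite -(law s t s0 st A mA) -joint_law_snd//.
  rewrite -[X in measurable X]setTI.
  by apply: (measurable_funB (measurable_funP (W t)) (measurable_funP (W s))).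
Qed.

Lemma independent_fst_snd :
  independent_systems PP (sigma_rv rv_fst) (sigma_process `[0, +oo[ (fun t => rv_snd (W t))).
Proof.
move=> _ _ [A mA <-] /sigma_process_snd[B sB ->].
have mB := sigma_process_measurable sB.
rewrite setTI (_ : _ `&` _ = A `*` B)// joint_lawX// joint_law_snd//.
by rewrite (_ : rv_fst @^-1` A = fst @^-1` A)// joint_law_fst.
Qed.

Lemma has_law_fst : has_law rv_fst mu.
Proof.
by move=> A mA; exact: joint_law_fst. Qed.

End independent_initial_state.

Lemma diffusion_exists (R : realType) (lambda c sigma1 sigmam1 : R) (H1 Hm1 : R -> R)
    (d : measure_display) (T : measurableType d) (P : probability T R)
    (W : R -> {RV P >-> R}) (q : {RV P >-> R}) (r : R) :
  0 < lambda -> nondecreasing_on_nneg H1 -> nondecreasing_on_nneg Hm1 ->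
  locally_lipschitz_on_nneg H1 -> locally_lipschitz_on_nneg Hm1 ->
  (forall x, r <= x -> drift lambda c H1 Hm1 x <= 0) ->
  (forall x, x <= - r -> 0 <= drift lambda c H1 Hm1 x) ->
  standard_brownian_motion W ->
  independent_systems P (sigma_rv q) (sigma_process `[0, +oo[ W) ->
  exists Q, diffusion lambda c sigma1 sigmam1 H1 Hm1 W q Q.
Proof.
move=> l0 nd1 ndm1 lip1 lipm1 br bNr W_bm qW.
have cb := drift_continuous (c := c) l0 lip1 lipm1.
have nb := drift_nonincreasing c l0 nd1 ndm1.
have b_lip := drift_local_lipschitz c l0 lip1 lipm1.
have [Q QE] := path_solution_rv (Num.sqrt (lambda ^+ 3 * (sigma1 ^+ 2 + sigmam1 ^+ 2)))
  cb nb b_lip br bNr q W_bm.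
exists Q; split => //; apply: filterS QE => w [X XS QX].
  have cX : {within `[0, +oo[, continuous X} by apply: continuous_subspaceT; have [] := XS.
  apply: subspace_eq_continuous cX => t; rewrite inE/= in_itv/= andbT => t0.
  by apply/esym; exact: QX.
have XE := path_solution_sde l0 lip1 lipm1 XS.
move=> t t0; rewrite QX// XE// max_l//.
have EX (f : R -> R) : (\int[lebesgue_measure]_(u in `[0, t]) f (Q u w))%R =
    (\int[lebesgue_measure]_(u in `[0, t]) f (X u))%R.
  by apply: eq_Rintegral => u; rewrite inE/= in_itv/= => /andP[u0 _]; rewrite QX.
rewrite (EX (fun y => H1 (Num.max y 0 / lambda))).
by rewrite (EX (fun y => Hm1 (Num.max 0 (- y) / lambda))).
Qed.

(** * Stationarity and uniqueness *)

Section bounded_expectations.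
Context d (T : measurableType d) (R : realType) (P : probability T R).

Lemma bounded_integrable (f : T -> R) (M : R) : measurable_fun setT f ->
  (forall t, `|f t| <= M) -> P.-integrable setT (EFin \o f).
Proof.
move=> mf fM; apply: measurable_bounded_integrable => //.
- by rewrite (le_lt_trans (probability_le1 _ _)) ?ltry.
- by exists M; split; [exact: num_real|move=> N MN t _; exact: le_trans (fM t) (ltW MN)].
Qed.

Lemma prob_Rintegral_cst (r : R) : \int[P]_t r = r.
Proof.
rewrite Rintegral_cst//; have /(congr1 fine) /= -> := @probability_setT _ _ R P.
by rewrite mulr1.
Qed.

Lemma has_law_expectation (X : {RV P >-> R}) (mu : probability (measurableTypeR R) R)
    (g : R -> R) (M : R) : has_law X mu -> measurable_fun setT g ->
  (forall x, `|g x| <= M) -> \int[P]_t g (X t) = \int[mu]_x g x.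
Proof.
move=> XE mg gM; rewrite /Rintegral; apply: (congr1 (@fine R)).
have mX : @measurable_fun _ _ T (measurableTypeR R) setT X.
  by have mX : measurable_fun setT X by []; exact: mX.
transitivity (\int[distribution P (rv_of P mX)]_x (g x)%:E)%E.
  rewrite integral_distribution//; first exact/measurable_EFinP.
  apply: (@bounded_integrable _ M) => [|t]; last exact: gM.
  exact: measurableT_comp.
by apply: eq_measure_integral => A mA _; exact: XE.
Qed.

End bounded_expectations.

(** * Comparing laws through compactly supported test functions *)

Section comparison.
Context {R : realType}.
Implicit Types m : probability (measurableTypeR R) R.

Definition test_function (A r : R) (f : R -> R) :=
  [/\ 0 <= A, lip A f, forall x, 0 <= f x <= A & forall x, r <= `|x| -> f x = 0].

Lemma test_function_norm A r f : test_function A r f -> forall x, `|f x| <= A.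
Proof. by move=> [_ _ fA _] x; have /andP[f0 ?] := fA x; rewrite ger0_norm. Qed.

Lemma cutoff_test_function (L r : R) (f : R -> R) : 0 <= L -> lip L f ->
  (forall x, 0 <= f x <= 1) -> test_function (1 + L) r (fun x => cutoff r x * f x).
Proof.
move=> L0 fL f01; split.
- by rewrite addr_ge0.
- have fn x : `|f x| <= 1 by have /andP[? ?] := f01 x; rewrite ger0_norm.
  by have := lipM (@cutoff_lip _ r) fL (@norm_cutoff _ r) fn; rewrite !mul1r.
- move=> x; have /andP[f0 f1] := f01 x; rewrite mulr_ge0 ?cutoff_ge0//=.
  by rewrite (@le_trans _ _ (1 * 1))// ?mul1r ?lerDl// -[leRHS]mul1r ler_pM ?cutoff_ge0 ?cutoff_le1.
- by move=> x /cutoff_eq0 ->; rewrite mul0r.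
Qed.

Lemma probability_le_of_test m m' (B : set R) (g : nat -> R -> R) : measurable B ->
  (forall A r f, test_function A r f -> \int[m]_x f x <= \int[m']_x f x) ->
  (forall n, lip n%:R (g n)) -> (forall n x, 0 <= g n x <= 1) ->
  (forall x, g n x @[n --> \oo] --> (\1_B x : R)) ->
  fine (m B) <= fine (m' B).
Proof.
move=> mB le_mm' gL g01 gB.
have cvg mu : \int[mu : probability (measurableTypeR R) R]_x (cutoff n%:R x * g n x)
    @[n --> \oo] --> fine (mu B).
  have -> : fine (mu B) = \int[mu]_x \1_B x.
    by rewrite /Rintegral integral_indic// setIT.
  apply: (@Rdominated_cvg _ _ R mu _ _ (fun=> 1)).
  - move=> n; apply: measurable_funM; first exact: lip_measurable (@cutoff_lip _ _).
    exact: lip_measurable (gL n).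
  - exact: measurable_indic.
  - apply: aeW => x; rewrite -[X in _ --> X]mul1r; apply: cvgM => //.
    exact: cvg_cutoff (@cvgr_idn R).
  - by apply: (@bounded_integrable _ _ _ _ _ 1) => // t; rewrite normr1.
  - move=> n x; have /andP[g0 g1] := g01 n x.
    by rewrite normrM mulr_ile1 ?norm_cutoff// ger0_norm.
apply: ler_cvg_to (cvg m) (cvg m') _; apply: nearW => n.
exact: le_mm' (cutoff_test_function _ _ (gL n) (g01 n)).
Qed.

(* Inequality suffices because both measures have mass one. *)
Lemma probability_eq_of_test m m' :
  (forall A r f, test_function A r f -> \int[m]_x f x <= \int[m']_x f x) ->
  forall A, measurable A -> m A = m' A.
Proof.
move=> le_mm'; apply: probability_eq_rays => x.
pose B : set R := `]-oo, x]%classic.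
have mB : measurable (B : set (measurableTypeR R)) by exact: measurable_itv.
(* Lipschitz ramps converging pointwise to the indicator of the open ray beyond [x]; [1 - g n] then
   approximates the closed ray, so the hypothesis gives the inequality for the ray and for its
   complement. *)
pose g (n : nat) (y : R) : R := Num.min 1 (n%:R * Num.max (y - x) 0).
have gL n : lip n%:R (g n).
  move=> y z; have min1 (p q : R) : `|Num.min 1 p - Num.min 1 q| <= `|p - q|.
    have := ler_norm (p - q); have := ler_norm (q - p); rewrite (distrC q p).
    have := normr_ge0 (p - q); rewrite ler_norml.
    by have [|] := leP 1 p; have [|] := leP 1 q; lra.
  rewrite (le_trans (min1 _ _))// -mulrBr normrM ger0_norm// ler_wpM2l//.
  by rewrite (le_trans (max0_contraction _ _))// opprB addrA subrK.
have g01 n y : 0 <= g n y <= 1.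
  by rewrite /g le_min ler01 ge_min lexx mulr_ge0// le_max lexx orbT.
have gB y : g n y @[n --> \oo] --> (\1_(~` B) y : R).
  apply: cvg_near_cst; have [yx|xy] := leP y x.
    rewrite indicE memNset; last by rewrite /B /= in_itv/= yx.
    by apply: nearW => n; rewrite /g max_r ?subr_le0// mulr0 min_r.
  rewrite indicE mem_set; last first.
    by rewrite /B /= in_itv/=; apply/negP; rewrite -ltNge.
  near=> n; rewrite /g max_l ?subr_ge0 ?(ltW xy)// min_l//.
  rewrite -ler_pdivrMr ?subr_gt0// mul1r.
  by near: n; exact: nbhs_infty_ger.
have leC := @probability_le_of_test m m' (~` B) g (measurableC mB) le_mm' gL g01 gB.
have le : fine (m B) <= fine (m' B).
  apply: (@probability_le_of_test m m' B (fun n y => 1 - g n y)) => //.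
  - move=> n y z; have E (p u : R) : 1 - p - (1 - u) = u - p by ring.
    by rewrite E distrC; exact: gL.
  - by move=> n y; have := g01 n y; lra.
  - move=> y; have -> : (\1_B y : R) = 1 - \1_(~` B) y.
      by rewrite !indicE in_setC; case: (_ \in _); rewrite ?subr0 ?subrr.
    by apply: (@cvgB _ R^o); [exact: cvg_cst|exact: gB].
have fC mu : fine ((mu : probability (measurableTypeR R) R) (~` B)) = 1 - fine (mu B).
  by rewrite probability_setC// fineB ?fin_num_measure.
rewrite !fC lerD2l lerN2 in leC.
have e : fine (m B) = fine (m' B) by apply/eqP; rewrite eq_le le.
by rewrite -(fineK (fin_num_measure m _ mB)) e fineK ?fin_num_measure.
Unshelve. all: by end_near. Qed.

End comparison.

(** * Convergence of the chain in law *)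

Section weak_convergence.
Context d (T : measurableType d) (R : realType) (P : probability T R).
Variables (b : R -> R) (s : R).
Hypotheses (cb : continuous b) (nb : forall x y, x <= y -> b y <= b x).
Variables (W : R -> {RV P >-> R}) (q : {RV P >-> R}) (Q : R -> {RV P >-> R}).
Hypothesis Q_sol : {ae P, forall w, W 0 w = 0 /\
  path_solution b s (q w) (fun t => W (Num.max t 0) w) (fun t => Q (Num.max t 0) w)}.

Lemma bounded_euler_integrable (f : R -> R) (A M h : R) n : 0 <= h -> lip A f ->
  (forall x, `|f x| <= M) -> P.-integrable setT (EFin \o (fun w => f (euler_rv b s W q h n w))).
Proof.
move=> h0 fA fM; apply: (@bounded_integrable _ _ _ _ _ M) => [|w]; last exact: fM.
by apply: measurableT_comp; [exact: lip_measurable fA|exact: measurable_euler_rv].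
Qed.

(** The pathwise threshold depends on the sample point, so uniformity over the grid times up to [t]
    is obtained by contradiction: a sequence of bad pairs [(h, n)] with [h] tending to 0 would
    violate dominated convergence. *)
Lemma euler_expectation_cvg (f : R -> R) (A M t e : R) : 0 <= t -> 0 <= A -> lip A f ->
  (forall x, `|f x| <= M) -> 0 < e ->
  exists2 dt : R, 0 < dt & forall h n, 0 < h -> h <= dt -> n%:R * h <= t ->
    `|\int[P]_w f (euler_rv b s W q h n w) - \int[P]_w f (Q (n%:R * h) w)| <= e.
Proof.
move=> t0 A0 fA fM e0; apply: contrapT => nH.
have /choice[hn hnP] (m : nat) : exists hn : R * nat,
    [/\ 0 < hn.1, hn.1 <= m.+1%:R^-1, hn.2%:R * hn.1 <= t &
      e < `|\int[P]_w f (euler_rv b s W q hn.1 hn.2 w) - \int[P]_w f (Q (hn.2%:R * hn.1) w)|].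
  apply: contrapT => nex; apply: nH; exists m.+1%:R^-1; first by rewrite invr_gt0.
  move=> h n h0 hm nh; rewrite leNgt; apply/negP => eh; apply: nex.
  by exists (h, n).
pose h m := (hn m).1; pose n m := (hn m).2.
have h0 m : 0 <= h m by have [/ltW] := hnP m.
have mf := lip_measurable fA.
have iQ u : P.-integrable setT (EFin \o (fun w => f (Q u w))).
  apply: (@bounded_integrable _ _ _ _ _ M) => [|w]; last exact: fM.
  exact: measurableT_comp.
have iX m := bounded_euler_integrable (n m) (h0 m) fA fM.
pose g m w := f (euler_rv b s W q (h m) (n m) w) - f (Q ((n m)%:R * h m) w).
have gcvg : \int[P]_w g m w @[m --> \oo] --> \int[P]_w (fun=> (0 : R)) w.
  apply: (@Rdominated_cvg _ _ R P _ _ (fun=> M + M)).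
  - move=> m; apply: measurable_funB; apply: measurableT_comp => //.
    exact: measurable_euler_rv.
  - exact: measurable_cst.
  - apply: filterS Q_sol => w [w0 sol].
    apply/(@cvgrPdist_le _ R^o) => e' e'0.
    have eA : 0 < e' / (A + 1) by rewrite divr_gt0// ltr_wpDl.
    have wm0 : W (Num.max 0 0) w = 0 by rewrite maxxx.
    have [dt dt0 H] := euler_chain_cvg cb nb t0 wm0 sol eA.
    near=> m; have [hm0 hmm nht _] := hnP m.
    rewrite sub0r normrN /g.
    apply: le_trans (fA _ _) _.
    have hdt : h m <= dt.
      apply: le_trans hmm _; rewrite invf_ple ?posrE//.
      by rewrite (@le_trans _ _ m%:R) ?ler_nat//; near: m; exact: nbhs_infty_ger.
    have := H (h m) (n m) (h0 m) hdt nht; rewrite max_l ?mulr_ge0//.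
    rewrite -(@euler_chain_eq_path _ b s (h m) (q w) (W^~ w)) => [XQ||u u0]; last 2 first.
    - exact: h0.
    - by rewrite max_l.
    apply: le_trans (ler_wpM2l A0 XQ) _.
    by rewrite mulrA ler_pdivrMr ?ltr_wpDl// mulrC ler_pM2l// lerDl.
  - apply: (@bounded_integrable _ _ _ _ _ `|M + M|) => [|w //]; exact: measurable_cst.
  - by move=> m w; rewrite (le_trans (ler_normB _ _))// lerD.
rewrite prob_Rintegral_cst in gcvg.
have /(@cvgrPdist_le _ R^o) /(_ e e0) := gcvg.
move=> [m _ /(_ m (leqnn m))] /=.
rewrite sub0r normrN RintegralB//; last first.
have [_ _ _ em] := hnP m.
by rewrite leNgt em.
Unshelve. all: by end_near. Qed.

End weak_convergence.

Section stationarity.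
Context {R : realType}.
Local Notation leb := (@lebesgue_measure R).

(** Makes [t] itself a grid point, so that chain and solution are compared at exactly that time. *)
Lemma time_step (t d : R) : 0 <= t -> 0 < d ->
  exists h n, [/\ 0 < h, h <= d & n%:R * h = t].
Proof.
move=> t0 d0; have [->|tn0] := eqVneq t 0; first by exists d, 0%N; rewrite mul0r.
have tgt0 : 0 < t by rewrite lt_def tn0.
exists (t / (Num.truncn (t / d)).+1%:R), (Num.truncn (t / d)).+1; split.
- by rewrite divr_gt0.
- rewrite ler_pdivrMr// mulrC -ler_pdivrMr//.
  exact: ltW (truncnS_gt _).
- by rewrite mulrC divfK.
Qed.

Lemma cutoff_expectation_cvg (m : probability (measurableTypeR R) R) :
  \int[m]_x cutoff n%:R x @[n --> \oo] --> (1 : R).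
Proof.
rewrite -[X in _ --> X](prob_Rintegral_cst m).
apply: (@Rdominated_cvg _ _ R m _ _ (fun=> 1)).
- by move=> n; exact: lip_measurable (@cutoff_lip _ _).
- exact: measurable_cst.
- by apply: aeW => x; exact: cvg_cutoff (@cvgr_idn R).
- by apply: (@bounded_integrable _ _ _ _ _ 1) => // t; rewrite normr1.
- by move=> n x; exact: norm_cutoff.
Qed.

Variables (b w : R -> R) (s a r : R).
Hypotheses (cb : continuous b) (nb : forall x y, x <= y -> b y <= b x).
Hypothesis b_lip : forall r, exists2 L : R, 0 <= L & forall x y,
  `|x| <= r -> `|y| <= r -> `|b x - b y| <= L * `|x - y|.
Hypothesis s_gt0 : 0 < s.
Hypotheses (a_gt0 : 0 < a) (r_ge0 : 0 <= r).
Hypotheses (br : forall x, r <= x -> b x <= - a) (bNr : forall x, x <= - r -> a <= b x).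
Hypothesis w_gt0 : forall x, 0 < w x.
Hypothesis dw : forall x : R, is_derive x 1 w (2 / s ^+ 2 * b x * w x).
Hypothesis iw : leb.-integrable setT (EFin \o w).
Variables (pi : probability (measurableTypeR R) R) (kap : R).
Hypothesis kap_gt0 : 0 < kap.
Hypothesis piE : forall (g : R -> R) (M : R), measurable_fun setT g -> (forall x, `|g x| <= M) ->
  \int[pi]_x g x = kap * \int[leb]_x (g x * w x).
Local Notation K := (euler_kernel b s).

Section diffusion.
Context d (T : measurableType d) (P : probability T R).
Variables (W : R -> {RV P >-> R}) (q : {RV P >-> R}) (Q : R -> {RV P >-> R}).
Hypothesis W_bm : standard_brownian_motion W.
Hypothesis qW_indep : independent_systems P (sigma_rv q) (sigma_process `[0, +oo[ W).
Hypothesis Q_sol : {ae P, forall w, W 0 w = 0 /\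
  path_solution b s (q w) (fun t => W (Num.max t 0) w) (fun t => Q (Num.max t 0) w)}.

Lemma weight_stationary t : has_law q pi -> 0 <= t -> has_law (Q t) pi.
Proof.
move=> qpi t0.
have mQ : @measurable_fun _ _ T (measurableTypeR R) setT (Q t).
  by have mX : measurable_fun setT (Q t) by []; exact: mX.
suff QE : forall A, measurable A -> distribution P (rv_of P mQ) A = pi A by exact: QE.
apply: probability_eq_of_test => A r0 f tf.
have [A0 fA fA' fr] := tf; have fn := test_function_norm tf.
have mf := lip_measurable fA.
have Qm : has_law (Q t) (distribution P (rv_of P mQ)) by [].
rewrite -(has_law_expectation Qm mf fn).
(* One third of [e] pays for replacing [Q t] by the chain, one for the mass of [pi] outside the
   cutoff, one for the [sqrt h] error. The radius [rho] is fixed before [h], since the constant of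
   the latter error depends on it. *)
apply/ler_addgt0Pr => e e0; have e3 : 0 < e / 3 by rewrite divr_gt0.
have eA : 0 < e / 3 / (A + 1) by rewrite divr_gt0// ltr_wpDl.
have /(@cvgrPdist_le _ R^o)/(_ _ eA)[N _ /(_ N (leqnn N))/= rhoP] := cutoff_expectation_cvg pi.
pose rho : R := N%:R.
have [C C0 CP] := kernel_almost_invariant cb nb b_lip s_gt0 a_gt0 r_ge0 br bNr
  w_gt0 dw iw A0 fA fA' fr rho.
have [dt dt0 dtP] := euler_expectation_cvg cb nb Q_sol t0 A0 fA fn e3.
have kC : 0 < kap * C + 1 by rewrite ltr_wpDl// mulr_ge0// ltW.
pose e4 := e / 3 / (kap * C + 1); have e40 : 0 < e4 by rewrite divr_gt0.
have [h [n [h0 hd nh]]] : exists h n, [/\ 0 < h, h <= Num.min (Num.min 1 dt) (e4 ^+ 2) &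
    n%:R * h = t].
  by apply: time_step => //; rewrite !lt_min ltr01 dt0 exprn_gt0.
move: hd; rewrite !le_min => /andP[/andP[h1 hdt] he4].
have sh : Num.sqrt h <= e4.
  by rewrite -[e4]ger0_norm ?(ltW e40)// -sqrtr_sqr ler_wsqrtr.
have h0' := ltW h0.
have := dtP h n h0 hdt; rewrite nh lexx => /(_ isT) close.
have Kl := iter_kernel_lip s cb nb h0' n fA.
have Kn x := norm_iter_kernel s cb nb h0' n x fA fn.
have K0 x : 0 <= iter n (K h) f x.
  by apply: (iter_kernel_ge0 s cb nb h0' n x fA) => y; have /andP[] := fA' y.
have mc := lip_measurable (@cutoff_lip R rho).
have mK := lip_measurable Kl.
have EK : \int[P]_t f (euler_rv b s W q h n t) = \int[pi]_x iter n (K h) f x.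
  rewrite (@euler_rv_expectation _ T R P b s cb nb W q W_bm qW_indep n h f A A h0 fA fn).
  exact: has_law_expectation qpi mK Kn.
have i1 : pi.-integrable setT (EFin \o (fun x => cutoff rho x * iter n (K h) f x)).
  apply: (@bounded_integrable _ _ _ _ _ A) => [|x]; first exact: measurable_funM.
  by rewrite normrM -[leRHS]mul1r ler_pM// ?norm_cutoff.
have i2 : pi.-integrable setT (EFin \o (fun x => A * (1 - cutoff rho x))).
  apply: (@bounded_integrable _ _ _ _ _ A) => [|x].
    by apply: measurable_funM => //; exact: measurable_funB.
  rewrite normrM ger0_norm// ler_piMr// ger0_norm ?subr_ge0 ?cutoff_le1//.
  by rewrite gerBl cutoff_ge0.
have ic : pi.-integrable setT (EFin \o cutoff rho).
  by apply: (@bounded_integrable _ _ _ _ _ 1) => // x; exact: norm_cutoff.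
have i0 : pi.-integrable setT (EFin \o iter n (K h) f).
  exact: (@bounded_integrable _ _ _ pi (iter n (K h) f) A mK Kn).
have le1 : \int[pi]_x iter n (K h) f x <=
    \int[pi]_x (cutoff rho x * iter n (K h) f x) + \int[pi]_x (A * (1 - cutoff rho x)).
  rewrite -RintegralD//; apply: le_Rintegral => //; first exact: (integrableD measurableT i1 i2).
  move=> x _; have := Kn x; rewrite ger0_norm// => KA.
  have := ler_wpM2r (_ : 0 <= 1 - cutoff rho x) KA; rewrite subr_ge0 cutoff_le1 => /(_ isT).
  by lra.
have i3 : pi.-integrable setT (EFin \o (fun=> 1 : R)).
  by apply: (@bounded_integrable _ _ _ _ _ 1) => // x; rewrite normr1.
have E2 : \int[pi]_x (A * (1 - cutoff rho x)) = A * (1 - \int[pi]_x cutoff rho x).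
  rewrite RintegralZl//; last exact: (integrableB measurableT i3 ic).
  by rewrite RintegralB// prob_Rintegral_cst.
have le2 : A * (1 - \int[pi]_x cutoff rho x) <= e / 3.
  apply: le_trans (ler_wpM2l A0 (le_trans (ler_norm _) rhoP)) _.
  by rewrite mulrA ler_pdivrMr ?ltr_wpDl// mulrC ler_pM2l// lerDl.
have le3 : \int[pi]_x (cutoff rho x * iter n (K h) f x) <= \int[pi]_x f x + e / 3.
  have cKn x : `|cutoff rho x * iter n (K h) f x| <= A.
    by rewrite normrM -[leRHS]mul1r ler_pM// ?norm_cutoff.
  rewrite (piE mf fn) (piE _ cKn); last exact: measurable_funM.
  apply: (@le_trans _ _ (kap * (\int[leb]_x (f x * w x) + C * Num.sqrt h))).
    by rewrite ler_pM2l//; exact: CP.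
  rewrite mulrDr lerD2l mulrA.
  have kC0 : 0 <= kap * C by rewrite mulr_ge0// ltW.
  apply: le_trans (ler_wpM2l kC0 sh) _.
  by rewrite /e4 mulrA ler_pdivrMr// mulrC ler_pM2l// lerDl.
have := ler_norm (\int[P]_w f (Q t w) - \int[P]_w f (euler_rv b s W q h n w)).
rewrite distrC => /le_trans/(_ close).
by rewrite EK; lra.
Qed.

(** Over a unit of time the Poisson estimate sums to [E u(X_n) - E u(X_0) = h * sum of E g(X_k)] up
    to [2 e]. By stationarity each [E g(X_k)] is close to the integral of [g], while both values of
    [E u] are close to the integral of [u]; the difference on the left is thus at most [e]. *)
Lemma expectation_invariant (mu : probability (measurableTypeR R) R) (g : R -> R) (A r0 : R) :
  has_law q mu -> (forall t, 0 <= t -> has_law (Q t) mu) ->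
  0 <= A -> lip A g -> (forall x, `|g x| <= A) -> (forall x, r0 <= `|x| -> g x = 0) ->
  \int[leb]_x (g x * w x) = 0 -> \int[mu]_x g x = 0.
Proof.
move=> qmu Qmu A0 gA gn gr gw0.
pose r1 := Num.max r r0.
have rr1 : r <= r1 by rewrite le_max lexx.
have gr1 x : r1 <= `|x| -> g x = 0.
  by rewrite ge_max => /andP[_]; exact: gr.
have [D D0 DP] := poisson_kernel cb nb b_lip s_gt0 a_gt0 r_ge0 br bNr w_gt0 dw rr1 A0.
have [u [uD uL uK]] := DP g gA gn gr1 gw0.
have mg := lip_measurable gA; have mu_ := lip_measurable uL.
set gam := \int[mu]_x g x.
have main e : 0 < e -> `|gam| <= 3 * e.
  move=> e0.
  have [d1 d10 P1] := euler_expectation_cvg cb nb Q_sol ler01 A0 gA gn e0.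
  have [d2 d20 P2] := euler_expectation_cvg cb nb Q_sol ler01 D0 uL uD e0.
  have DD : 0 < D + 1 by rewrite ltr_wpDl.
  pose e4 := e / (D + 1); have e40 : 0 < e4 by rewrite divr_gt0.
  have [h [n [h0 hd nh]]] : exists h n, [/\ 0 < h,
      h <= Num.min (Num.min 1 (e4 ^+ 2)) (Num.min d1 d2) & n%:R * h = 1].
    by apply: time_step => //; rewrite !lt_min ltr01 d10 d20 exprn_gt0.
  move: hd; rewrite !le_min => /andP[/andP[h1 he4] /andP[hd1 hd2]].
  have sh : D * Num.sqrt h <= e.
    apply: (@le_trans _ _ (D * e4)).
      by rewrite ler_wpM2l// -[e4]ger0_norm ?(ltW e40)// -sqrtr_sqr ler_wsqrtr.
    by rewrite /e4 mulrA ler_pdivrMr// mulrC ler_pM2l// lerDl.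
  have h0' := ltW h0.
  pose U k := \int[P]_w u (euler_rv b s W q h k w).
  have step k : k%:R * h <= 1 -> `|U k.+1 - U k - h * gam| <= h * (2 * e).
    move=> kh.
    have gk : `|\int[P]_w g (euler_rv b s W q h k w) - gam| <= e.
      have := P1 h k h0 hd1 kh.
      by rewrite (has_law_expectation (Qmu (k%:R * h) (mulr_ge0 (ler0n _ _) h0')) mg gn).
    have iu := @bounded_euler_integrable _ T R P b s cb nb W q _ _ _ h k h0' uL uD.
    have ig := @bounded_euler_integrable _ T R P b s cb nb W q _ _ _ h k h0' gA gn.
    have KL := iter_kernel_lip s cb nb h0' 1 uL.
    have KD x := norm_iter_kernel s cb nb h0' 1 x uL uD.
    have iK := @bounded_euler_integrable _ T R P b s cb nb W q _ _ _ h k h0' KL KD.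
    have ihg := integrableZl measurableT h ig.
    have E : U k.+1 - U k - h * \int[P]_w g (euler_rv b s W q h k w) =
        \int[P]_w (K h u (euler_rv b s W q h k w) - u (euler_rv b s W q h k w)
          - h * g (euler_rv b s W q h k w)).
      rewrite /U (@euler_rv_step _ T R P b s cb nb W q W_bm qW_indep k h u D D h0 uL uD).
      rewrite RintegralB//; last exact: (integrableB measurableT iK iu).
      by rewrite RintegralB// RintegralZl.
    have bnd : `|U k.+1 - U k - h * \int[P]_w g (euler_rv b s W q h k w)| <= h * e.
      rewrite E; apply: (@le_trans _ _ (\int[P]_w (D * (h * Num.sqrt h)))).
        have iall := integrableB measurableT (integrableB measurableT iK iu) ihg.
        apply: le_trans (le_normr_Rintegral measurableT iall) _.
        apply: le_Rintegral => //.
        - exact: integrable_norm iall.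
        - apply: (@bounded_integrable _ _ _ _ _ `|D * (h * Num.sqrt h)|) => //.
        - by move=> w' _; exact: uK.
      by rewrite prob_Rintegral_cst mulrCA ler_pM2l.
    have := ler_wpM2l h0' gk; rewrite -(ger0_norm h0') -normrM (ger0_norm h0') mulrBr => hgk.
    have := ler_normD (U k.+1 - U k - h * \int[P]_w g (euler_rv b s W q h k w))
      (h * \int[P]_w g (euler_rv b s W q h k w) - h * gam).
    rewrite addrA subrK => /le_trans; apply.
    by rewrite (le_trans (lerD bnd hgk))// -mulrDr ler_pM2l//; lra.
  have tele k : (k <= n)%N -> `|U k - U 0%N - (k%:R * h) * gam| <= (k%:R * h) * (2 * e).
    elim: k => [_|k IHk kn]; first by rewrite mul0r !mul0r subrr subr0 normr0.
    have kh : k%:R * h <= 1.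
      by rewrite -[leRHS]nh ler_pM2r// ler_nat ltnW.
    have -> : U k.+1 - U 0%N - (k.+1%:R * h) * gam =
        (U k.+1 - U k - h * gam) + (U k - U 0%N - (k%:R * h) * gam).
      by rewrite -natr1; ring.
    rewrite (le_trans (ler_normD _ _))// (le_trans (lerD (step k kh) (IHk (ltnW kn))))//.
    by rewrite -natr1; lra.
  have := tele n (leqnn n); rewrite nh !mul1r => tn.
  have := P2 h n h0 hd2; rewrite nh lexx => /(_ isT).
  rewrite (has_law_expectation (Qmu 1 ler01) mu_ uD) -/(U n).
  have <- : U 0%N = \int[mu]_x u x by exact: has_law_expectation qmu mu_ uD.
  have := ler_norm (U n - U 0%N); have := ler_norm (- (U n - U 0%N)); rewrite normrN.
  move: tn; rewrite !ler_norml => /andP[t1 t2] t3 t4 t5.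
  by apply/andP; split; lra.
apply/eqP; rewrite -normr_le0; apply/ler_addgt0Pr => e e0.
by have := main (e / 3) (divr_gt0 e0 _); rewrite ltr0n => /(_ isT); lra.
Qed.

(** Subtracting from [f] the multiple of [cutoff 1] with the same integral against [w] gives a
    function of zero mean, to which [expectation_invariant] applies. So [mu] is [c0] times [pi] on
    test functions, and widening cutoffs force [c0 = 1]. *)
Lemma stationary_unique (mu : probability (measurableTypeR R) R) :
  has_law q mu -> (forall t, 0 <= t -> has_law (Q t) mu) ->
  forall A, measurable A -> mu A = pi A.
Proof.
move=> qmu Qmu.
pose W0 := \int[leb]_x (cutoff 1 x * w x).
have W0_gt0 : 0 < W0 by exact: (cutoff_weight_gt0 w_gt0 dw iw (lexx 1)).
pose c0 := \int[mu]_x cutoff 1 x / (kap * W0).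
have prop A r0 f : test_function A r0 f -> \int[mu]_x f x = c0 * \int[pi]_x f x.
  move=> tf; have [A0 fA fA' fr] := tf; have fn := test_function_norm tf.
  have mf := lip_measurable fA; have mc := lip_measurable (@cutoff_lip R 1).
  have ifw := bounded_mul_integrable dw iw mf fn.
  have icw := bounded_mul_integrable dw iw mc (@norm_cutoff R 1).
  pose c := (\int[leb]_x (f x * w x)) / W0.
  pose A' := A + `|c|.
  have A'0 : 0 <= A' by rewrite addr_ge0.
  have gL : lip A' (fun x => f x - c * cutoff 1 x).
    by have := lipB fA (lipZ c (@cutoff_lip R 1)); rewrite mulr1.
  have gn x : `|f x - c * cutoff 1 x| <= A'.
    rewrite (le_trans (ler_normB _ _))// lerD// normrM ler_piMr//.
    exact: norm_cutoff.
  have gr x : Num.max 1 r0 <= `|x| -> f x - c * cutoff 1 x = 0.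
    by rewrite ge_max => /andP[x1 x2]; rewrite fr// cutoff_eq0// mulr0 subrr.
  have gw : \int[leb]_x ((f x - c * cutoff 1 x) * w x) = 0.
    have -> : (\int[leb]_x ((f x - c * cutoff 1 x) * w x) =
        \int[leb]_x (f x * w x - c * (cutoff 1 x * w x)))%R.
      by apply: eq_Rintegral => x _; ring.
    rewrite RintegralB//; last exact: (integrableZl measurableT c icw).
    by rewrite RintegralZl// -/W0 /c divfK ?subrr// gt_eqF.
  have := expectation_invariant qmu Qmu A'0 gL gn gr gw.
  have ic : mu.-integrable setT (EFin \o cutoff 1).
    by apply: (@bounded_integrable _ _ _ _ _ 1) => // x; exact: norm_cutoff.
  rewrite RintegralB//; last 2 first.
  - exact: (@bounded_integrable _ _ _ mu f A mf fn).
  - exact: (integrableZl measurableT c ic).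
  rewrite RintegralZl// => /eqP; rewrite subr_eq0 => /eqP ->.
  rewrite (piE mf fn) /c0 /c; field.
  by rewrite !gt_eqF.
have c1 : c0 = 1.
  have tc n : test_function 1 n%:R (@cutoff R n%:R).
    split => //; first exact: cutoff_lip.
    - by move=> x; rewrite cutoff_ge0 cutoff_le1.
    - by move=> x; exact: cutoff_eq0.
  have l1 := cutoff_expectation_cvg mu.
  have l2 : c0 * \int[pi]_x cutoff n%:R x @[n --> \oo] --> c0 * (1 : R).
    by apply: cvgM; [exact: cvg_cst|exact: cutoff_expectation_cvg].
  have E : (fun n => \int[mu]_x cutoff n%:R x) = (fun n => c0 * \int[pi]_x cutoff n%:R x).
    by apply/funext => n; exact: prop (tc n).
  rewrite E in l1; rewrite mulr1 in l2.
  exact: (@cvg_unique _ (@norm_hausdorff _ R) _ _ _ _ l2 l1).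
apply: probability_eq_of_test => A r0 f tf.
by rewrite (prop A r0 f tf) c1 mul1r.
Qed.

End diffusion.
End stationarity.

Theorem theorem4p3 (R : realType) (lambda c sigma1 sigmam1 : R)
    (H1 Hm1 : R -> R)
    (lambda_gt0 : 0 < lambda)
    (sigma1_ge0 : 0 <= sigma1) (sigmam1_ge0 : 0 <= sigmam1)
    (sigma_gt0 : 0 < sigma1 ^+ 2 + sigmam1 ^+ 2)
    (H1_ge0 : nonnegative_on_nneg H1) (Hm1_ge0 : nonnegative_on_nneg Hm1)
    (H1_nd : nondecreasing_on_nneg H1) (Hm1_nd : nondecreasing_on_nneg Hm1)
    (H1_lip : locally_lipschitz_on_nneg H1)
    (Hm1_lip : locally_lipschitz_on_nneg Hm1)
    (H1_lim : scaled_cdf_limit H1) (Hm1_lim : scaled_cdf_limit Hm1)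
    (d : measure_display) (T : measurableType d) (P : probability T R)
    (W : R -> {RV P >-> R}) (q : {RV P >-> R}) (Q : R -> {RV P >-> R})
    (Q_diffusion : diffusion lambda c sigma1 sigmam1 H1 Hm1 W q Q)
    (H1_large : 0 <= c -> ((c / lambda)%:E < lim ((H1 x)%:E @[x --> +oo%R]))%E)
    (Hm1_large : c <= 0 ->
       ((- (c / lambda))%:E < lim ((Hm1 x)%:E @[x --> +oo%R]))%E) :
  exists (C0 : R) (pi : probability (measurableTypeR R) R),
    [/\ 0 < C0,
        (\int[lebesgue_measure]_x
           (C0 * stationary_weight lambda c sigma1 sigmam1 H1 Hm1 x)%:E = 1)%E,
        (forall A, measurable A ->
           pi A = \int[lebesgue_measure]_(x in A)
             (C0 * stationary_weight lambda c sigma1 sigmam1 H1 Hm1 x)%:E)%E,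
        stationary_distribution lambda c sigma1 sigmam1 H1 Hm1 pi &
        forall mu : probability (measurableTypeR R) R,
          stationary_distribution lambda c sigma1 sigmam1 H1 Hm1 mu ->
          forall A, measurable A -> mu A = pi A].

Proof.
set b := drift lambda c H1 Hm1.
set sg := lambda ^+ 3 * (sigma1 ^+ 2 + sigmam1 ^+ 2).
set w := stationary_weight lambda c sigma1 sigmam1 H1 Hm1.
have sg0 : 0 < sg by rewrite mulr_gt0// exprn_gt0.
pose s := Num.sqrt sg; have s0 : 0 < s by rewrite sqrtr_gt0.
have sE : s ^+ 2 = sg by rewrite sqr_sqrtr// ltW.
have H10 := scaled_cdf_limit0 H1_lim; have Hm10 := scaled_cdf_limit0 Hm1_lim.
have cb : continuous b by exact: drift_continuous.
have nb : forall x y, x <= y -> b y <= b x by exact: drift_nonincreasing.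
have b_lip := drift_local_lipschitz c lambda_gt0 H1_lip Hm1_lip; rewrite -/b in b_lip.
have [a [r [a0 r0 br bNr]]] := drift_dissipative lambda_gt0 H1_nd Hm1_nd H10 Hm10 H1_large Hm1_large.
rewrite -/b in br bNr.
have br0 x : r <= x -> b x <= 0 by move=> /br /le_trans; apply; rewrite oppr_le0 ltW.
have bNr0 x : x <= - r -> 0 <= b x by move=> /bNr; apply: le_trans; exact: ltW.
have [F dF] := continuous_antiderivative cb.
have wE x : w x = expR (2 / sg * (F x - F 0)) by exact: stationary_weightE.
have k0 : 0 < 2 / sg by rewrite divr_gt0.
have dB (x : R) : is_derive x 1 (fun x => F x - F 0) (b x).
  by apply: is_derive_eq; rewrite /GRing.scale/=; ring.
have w0 x : 0 < w x by rewrite wE expR_gt0.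
have dw (x : R) : is_derive x 1 w (2 / s ^+ 2 * b x * w x).
  rewrite sE (_ : w = expR \o (fun x => 2 / sg * (F x - F 0))); last exact/funext.
  have dl : is_derive x 1 (fun x => 2 / sg * (F x - F 0)) (2 / sg * b x).
    by apply: is_derive_eq; rewrite /GRing.scale/=; ring.
  have := @is_derive1_comp _ expR _ x _ _ (is_derive_expR _) dl.
  by rewrite [X in is_derive _ _ _ X -> _]mulrC.
have iw : (@lebesgue_measure R).-integrable setT (EFin \o w).
  rewrite (_ : w = fun x => expR (2 / sg * (F x - F 0))); last exact/funext.
  exact: log_derivative_integrable dB k0 a0 r0 br bNr.
have mw : measurable_fun setT w.
  exact: continuous_measurable_fun (is_derive_continuous dw).
pose I := \int[lebesgue_measure]_x w x.
have I0 : 0 < I.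
  apply: lt_le_trans (cutoff_weight_gt0 w0 dw iw (lexx 1)) _.
  apply: le_Rintegral => //.
    exact: (bounded_mul_integrable dw iw (lip_measurable (@cutoff_lip R 1)) (@norm_cutoff R 1)).
  by move=> x _; rewrite -[leRHS]mul1r ler_wpM2r ?cutoff_le1// ltW.
pose C0 := I^-1; have C00 : 0 < C0 by rewrite invr_gt0.
have ip := integrableZl measurableT C0 iw.
have p1 : (\int[lebesgue_measure]_x (C0 * w x)%:E = 1)%E.
  rewrite -[LHS]fineK; last exact: (integrable_fin_num measurableT ip).
  rewrite -[fine _]/(\int[lebesgue_measure]_x (C0 * w x))%R RintegralZl//.
  by rewrite mulVf// gt_eqF.
have p0 x : 0 <= C0 * w x by rewrite mulr_ge0// ltW.
have [pi piA] := density_probability p0 ip p1.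
have piE (g : R -> R) (M : R) : measurable_fun setT g -> (forall x, `|g x| <= M) ->
    \int[pi]_x g x = C0 * \int[lebesgue_measure]_x (g x * w x).
  move=> mg gM; have igw := bounded_mul_integrable dw iw mg gM.
  rewrite -RintegralZl// /Rintegral; apply: (congr1 (@fine R)).
  rewrite (integral_density p0 _ piA mg); last exact: measurable_funM.
  by apply: eq_integral => x _; rewrite mulrCA.
have sol (d' : measure_display) (T' : measurableType d') (P' : probability T' R)
    (W' : R -> {RV P' >-> R}) (q' : {RV P' >-> R}) (Q' : R -> {RV P' >-> R}) :
    diffusion lambda c sigma1 sigmam1 H1 Hm1 W' q' Q' ->
    {ae P', forall w, W' 0 w = 0 /\ path_solution b s (q' w)
      (fun t => W' (Num.max t 0) w) (fun t => Q' (Num.max t 0) w)}.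
  move=> [[W'0 _ _ _] _ Q'c Q's]; apply: filterS3 W'0 Q'c Q's => z z0 zc zs.
  by split => //; exact: sde_path_solution zc zs.
exists C0, pi; split => //.
- split.
    (* The witness reuses the Brownian motion of the given diffusion on the product space, where the
       first coordinate is an independent initial state of law [pi]. *)
    have [W_bm _ _ _] := Q_diffusion.
    have [Q' Q'P] := @diffusion_exists R lambda c sigma1 sigmam1 H1 Hm1 _ _ _ _
      (rv_fst P pi) r lambda_gt0 H1_nd Hm1_nd H1_lip Hm1_lip br0 bNr0
      (brownian_motion_snd pi W_bm) (@independent_fst_snd _ T R P pi W).
    exists _, _, (joint_law P pi), (fun t => rv_snd pi (W t)), (rv_fst P pi), Q'.
    by split => //; exact: has_law_fst.
  move=> d' T' P' W' q' Q' D qpi t t0.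
  have [W_bm qW _ _] := D.
  exact: (weight_stationary cb nb b_lip s0 a0 r0 br bNr w0 dw iw C00 piE W_bm qW (sol _ _ _ _ _ _ D) qpi t0).
- move=> mu [[d' [T' [P' [W' [q' [Q' [D qmu]]]]]]] st].
  have [W_bm qW _ _] := D.
  apply: (stationary_unique cb nb b_lip s0 a0 r0 br bNr w0 dw iw C00 piE W_bm qW (sol _ _ _ _ _ _ D) qmu).
  exact: st D qmu.
Qed.
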